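(* For all $\varepsilon>0$ and $R>0$ there exist $M=M(\varepsilon)>0$ and $\delta_0=\delta_0(\varepsilon,R)>0$ such that the following holds for all $\delta\in(0,\delta_0]$. Let $L\subset \mathcal{L}_{SL_2}\cap B(0,R)$ (a finite set) satisfy the two-dimensional ball condition $$\#(L\cap B)\le (r/\delta)^2\quad\text{for all } r\in[\delta,1] \text{ and all balls } B\subset\mathbb{R}^4 \text{ of radius } r.$$ Let $E\subset B(0,R)\subset\mathbb{R}^3$ be a union of $\delta$-cubes, and suppose $|\ell\cap E|\ge\lambda$ for each $\ell\in L$. Then $$|E|\ge \delta^{\varepsilon}\lambda^{M}\,(\delta^2\,\#L).$$
   Context: For $(a,b,c,d)\in\mathbb{R}^4$ with $ad-bc=1$, let $\ell_{(a,b,c,d)}=\{(a,b,0)+s(c,d,1): s\in\mathbb{R}\}\subset\mathbb{R}^3$, and let $\mathcal{L}_{SL_2}$ be the set of all such lines. Each line $\ell_{(a,b,c,d)}$ is identified with the point $(a,b,c,d)\in\mathbb{R}^4$; thus $\mathcal{L}_{SL_2}\cap B(0,R)$ means the lines whose parameter $(a,b,c,d)$ lies in the ball $B(0,R)\subset\mathbb{R}^4$, and $L\cap B$ for a ball $B\subset\mathbb{R}^4$ refers to parameters. $|\ell\cap E|$ denotes the one-dimensional Lebesgue measure of $\ell\cap E$, and $|E|$ the three-dimensional Lebesgue measure. *)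

(* Defs.v *)
From HB Require Import structures.
From mathcomp Require Import all_boot all_order all_algebra.
From mathcomp Require Import all_classical all_reals all_analysis.
Set Implicit Arguments. Unset Strict Implicit. Unset Printing Implicit Defensive.
Import Order.TTheory GRing.Theory Num.Theory.
Local Open Scope classical_set_scope.
Local Open Scope ring_scope.

Section Defs.
Variable R : realType.

Definition pt4 := (R * R * R * R)%type.
Definition pt3 := (R * R * R)%type.

Definition norm4 (p : pt4) : R :=
  let: (a, b, c, d) := p in Num.sqrt (a ^+ 2 + b ^+ 2 + c ^+ 2 + d ^+ 2).
Definition norm3 (x : pt3) : R :=
  let: (x1, x2, x3) := x in Num.sqrt (x1 ^+ 2 + x2 ^+ 2 + x3 ^+ 2).

Definition in_ball4 (z : pt4) (r : R) (p : pt4) : bool :=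
  let: (a, b, c, d) := p in let: (a', b', c', d') := z in
  norm4 (a - a', b - b', c - c', d - d') < r.

Definition ball3_0 (r : R) : set pt3 := [set x | norm3 x < r].

Definition SL2param (p : pt4) : Prop :=
  let: (a, b, c, d) := p in a * d - b * c = 1.

Definition line_pt (p : pt4) (s : R) : pt3 :=
  let: (a, b, c, d) := p in (a + s * c, b + s * d, s).

Definition dcube (delta : R) (k : int * int * int) : set pt3 :=
  let: (k1, k2, k3) := k in
  [set x | let: (x1, x2, x3) := x in
     [/\ delta * k1%:~R <= x1 <= delta * (k1 + 1)%:~R,
         delta * k2%:~R <= x2 <= delta * (k2 + 1)%:~R &
         delta * k3%:~R <= x3 <= delta * (k3 + 1)%:~R]].

Definition union_of_dcubes (delta : R) (E : set pt3) : Prop :=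
  exists K : set (int * int * int), E = \bigcup_(k in K) dcube delta k.

Definition leb3 : set pt3 -> \bar R :=
  ((@lebesgue_measure R \x @lebesgue_measure R) \x @lebesgue_measure R)%E.

(* one-dimensional Lebesgue (arc-length) measure of l_p ∩ E:
   the parametrisation s |-> (a,b,0)+s(c,d,1) has speed |(c,d,1)| *)
Definition line_meas (p : pt4) (E : set pt3) : \bar R :=
  let: (a, b, c, d) := p in
  ((Num.sqrt (c ^+ 2 + d ^+ 2 + 1))%:E *
    @lebesgue_measure R [set s | E (line_pt p s)])%E.

End Defs.

(* Main.v *)
(* A line of the family meets the plane of points with first coordinate x, provided that c <> 0, at
   s = A + x B and -y = B + x D, where A = -a/c, B = 1/c and D = -d/c; if c is small then d is not,
   and a quarter turn of space exchanges them. The family at the time x is thus seen through the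
   projection (A, B, D) -> (A + x B, B + x D), whose frequencies fill a plane tangent to a cone.
   Replacing the occupied cells by Fejer bumps, one gets functions f_i of the projections at about
   1/delta times x_i, such that sum_i f_i bounds from above the number of cubes met by a line. After the
   frequencies have been cut into logarithmically many bands, the average of f_i f_j f_k f_l vanishes
   unless the four times pair up at the scale of the band. Iterating this over an m-adic tree of times
   bounds the average of the fourth power of sum_i f_i with a loss of delta^-eps only, and the ball
   condition allows one to pass from the average over all (A, B, D) to the sum over the lines. Hence
   #L (lambda/delta)^4 <= C delta^(-3-eps) #(cubes), which is the assertion with M = 4. *)
Require Import Defs.
From HB Require Import structures.
From mathcomp Require Import all_boot all_order all_algebra.
From mathcomp Require Import all_classical all_reals all_analysis.
From mathcomp Require Import ring lra zify.
Set Implicit Arguments. Unset Strict Implicit. Unset Printing Implicit Defensive.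
Import Order.TTheory GRing.Theory Num.Theory.
Import numFieldNormedType.Exports.
Local Open Scope classical_set_scope.
Local Open Scope ring_scope.

(** * Trigonometric sums and the Fejer kernel *)

Section Trig.
Variable R : realType.
Implicit Types (x y phi : R) (k : int) (M N n : nat).

(** Everything is finite: n is about 1/delta, points run through a grid of step 1/n, functions are
    real trigonometric polynomials, and an average vanishes exactly once a frequency leaves the unit
    cube. Two effects have to balance. A polynomial with frequencies of size N is roughly constant
    at distance 1/N, where the ball condition allows (n/N)^2 lines, so passing from the average to
    the sum over lines loses a factor N. The fourth moment of a band must gain it back: a band has
    |h| about A and |b| about B, N is about A + B, and every estimate bounds the fourth moment times
    A + B. The pairing works only while blocks of times are long compared with B/A and A^(-1/2).
    Where it stops, the trivial bound suffices if B^2 is at most comparable to A; otherwise distant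
    times are orthogonal in L^2. A step of the tree costs a constant C0 besides the harmless factor
    m, so K steps cost C0^K, which is a small power of n once C0 is at most a small power of m. The
    relative width of the bands, about (m + 1)^(-2), is then dictated by m. *)

Lemma sin_mvt x : 0 < x -> exists2 c, 0 < c < x & sin x = x * cos c.
Proof.
move=> x0.
have [|c cin] := @MVT R sin cos 0 x x0 (fun y _ => is_derive_sin y).
  exact/continuous_subspaceT/continuous_sin.
rewrite sin0 !subr0 => e; exists c; last by rewrite e mulrC.
by move: cin; rewrite in_itv.
Qed.

Lemma normr_sin_le x : `|sin x| <= `|x|.
Proof.
wlog x0 : x / 0 < x => [H|].
  case: (ltrgtP 0 x) => [/H//|x0|<-]; last by rewrite sin0 normr0.
  by have := H (- x); rewrite sinN !normrN oppr_gt0; apply.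
have [c _ ->] := sin_mvt x0.
by rewrite normrM ler_piMr// cos_max.
Qed.

Lemma sin_sq_le x : sin x ^+ 2 <= x ^+ 2.
Proof. by rewrite -(@real_normK _ (sin x)) ?num_real// -(@real_normK _ x) ?num_real// lerXn2r ?nnegrE// normr_sin_le. Qed.

Lemma cos_ge x : 1 - x ^+ 2 / 2 <= cos x.
Proof.
have e : cos x = 1 - 2 * sin (x / 2) ^+ 2.
  have ex : x = (x / 2) *+ 2 by rewrite mulr2n; lra.
  rewrite [in LHS]ex.
  by rewrite cos_mulr2n cos2sin2; set s := sin _; rewrite mulr2n; ring.
have := sin_sq_le (x / 2); rewrite e exprMn.
set s := sin _ ^+ 2; set q := x ^+ 2; lra.
Qed.

Lemma sin_sq_ge x : `|x| <= 1 -> x ^+ 2 / 4 <= sin x ^+ 2.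
Proof.
wlog x0 : x / 0 < x => [H|].
  case: (ltrgtP 0 x) => [/H|x0|<-].
  - by [].
  - by move=> x1; have := H (- x); rewrite sinN !sqrrN normrN oppr_gt0; apply.
  - by rewrite sin0 expr0n /= mul0r.
rewrite (gtr0_norm x0) => x1.
have [c /andP[c0 cx] ->] := sin_mvt x0.
have := cos_ge c; rewrite exprMn ler_pM2l ?exprn_gt0// => h.
have : 1/2 <= cos c by nra.
nra.
Qed.

Lemma sin2pin x n : sin (x + 2 * pi * n%:R) = sin x.
Proof. by rewrite -(periodicn (@sinD2pi R) n x); congr sin; rewrite -[_ *+ n]mulr_natr mulr2n; ring. Qed.

Lemma cos2pin x n : cos (x + 2 * pi * n%:R) = cos x.
Proof. by rewrite -(periodicn (@cosD2pi R) n x); congr cos; rewrite -[_ *+ n]mulr_natr mulr2n; ring. Qed.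

Lemma sin2piz x k : sin (x + 2 * pi * k%:~R) = sin x.
Proof.
case: k => n; first exact: sin2pin.
by rewrite NegzE -(sin2pin (x + _) n.+1); congr sin; rewrite mulrNz -pmulrn; ring.
Qed.

Lemma cos2piz x k : cos (x + 2 * pi * k%:~R) = cos x.
Proof.
case: k => n; first exact: cos2pin.
by rewrite NegzE -(cos2pin (x + _) n.+1); congr cos; rewrite mulrNz -pmulrn; ring.
Qed.

Lemma cosM2 x y : cos x * cos y = 2^-1 * (cos (x + y) + cos (x - y)).
Proof. by rewrite cosD cosB; field. Qed.

(** The factor 2 sin(h/2) turns each cosine into a difference of sines and the sum telescopes;
    nothing is divided, so no value of h is excluded. *)
Lemma sum_cos_arith h phi M :
  2 * sin (h / 2) * (\sum_(j < M) cos (j%:R * h + phi)) =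
  sin (M%:R * h - h / 2 + phi) - sin (- (h / 2) + phi).
Proof.
rewrite mulr_sumr -(big_mkord xpredT (fun j => 2 * sin (h / 2) * cos (j%:R * h + phi))).
rewrite (telescope_sumr_eq (fun j => sin (j%:R * h - h / 2 + phi))) => [|//|j _].
  by rewrite mul0r add0r.
have -> : j.+1%:R * h - h / 2 + phi = (j%:R * h + phi) + h / 2.
  by rewrite -natr1; field.
have -> : j%:R * h - h / 2 + phi = (j%:R * h + phi) - h / 2 by ring.
by rewrite sinD sinB; ring.
Qed.

Definition ang M : R := 2 * pi / M%:R.

Lemma sum_cos_ang M k phi : (`|k| < M)%N ->
  \sum_(j < M) cos (j%:R * (k%:~R * ang M) + phi) = (k == 0)%:R * (M%:R * cos phi).
Proof.
move=> kM; have M0 : (0 < M)%N by lia.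
have MR : (M%:R : R) != 0 by rewrite pnatr_eq0; lia.
case: (altP (k =P 0)) => [->|k0].
  under eq_bigr do rewrite mul0r mulr0 add0r.
  by rewrite sumr_const card_ord mul1r mulr_natl.
rewrite mul0r.
have := sum_cos_arith (k%:~R * ang M) phi M.
have -> : M%:R * (k%:~R * ang M) - k%:~R * ang M / 2 + phi =
  - (k%:~R * ang M / 2) + phi + 2 * pi * k%:~R by rewrite /ang; field.
rewrite sin2piz subrr => /eqP; rewrite !mulf_eq0 pnatr_eq0/= => /orP[|/eqP//].
(* Since 0 < |k| < M, the angle pi k / M is not a multiple of pi, so the sine in front cannot be the
   vanishing factor. *)
have -> : k%:~R * ang M / 2 = pi * (k%:~R / M%:R) by rewrite /ang; field.
move=> /eqP s0; exfalso; move: s0.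
wlog kp : k k0 kM / (0 < k)%R => [H|].
  case: (ltrP 0 k) => kp; first exact: H.
  have : (0 < - k)%R by lia.
  move=> /(H (- k)); rewrite mulrNz mulNr mulrN sinN => {}H s0.
  by apply: H; rewrite ?s0 ?oppr0//; lia.
move=> s0; suff : 0 < sin (pi * (k%:~R / M%:R) : R) by rewrite s0 ltxx.
apply: sin_gt0_pi; apply/andP; split.
  by rewrite !mulr_gt0 ?pi_gt0 ?invr_gt0 ?ltr0n// ltr0z.
rewrite -[ltRHS]mulr1 ltr_pM2l ?pi_gt0// ltr_pdivrMr ?ltr0n// mul1r.
by rewrite (_ : M%:R = M%:~R)// ltr_int; lia.
Qed.

(** N times the usual Fejer kernel, as the squared modulus of an exponential sum: the peak is N^2
    and the coefficient of the frequency k is N - |k|. *)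
Definition fej N x := (\sum_(a < N) cos (a%:R * x)) ^+ 2 + (\sum_(a < N) sin (a%:R * x)) ^+ 2.

Lemma fej_ge0 N x : 0 <= fej N x.
Proof. by rewrite addr_ge0 ?sqr_ge0. Qed.

Lemma fejE N x : fej N x = \sum_(a < N) \sum_(b < N) cos ((a%:Z - b%:Z)%:~R * x).
Proof.
rewrite /fej !expr2 !big_distrlr /= -big_split/=; apply: eq_bigr => a _.
rewrite -big_split/=; apply: eq_bigr => b _.
by rewrite -cosB; congr cos; rewrite intrB; ring.
Qed.

(** The closed form of the kernel, cleared of its denominator. It yields the decay away from the
    peaks, and also lower bounds wherever the right side is large. *)
Lemma fej_sin N x : fej N (x *+ 2) * sin x ^+ 2 = sin (N%:R * x) ^+ 2.
Proof.
have hx : x *+ 2 / 2 = x by rewrite mulr2n; lra.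
have C := sum_cos_arith (x *+ 2) 0 N.
have S := sum_cos_arith (x *+ 2) (- (pi / 2)) N.
have ES : \sum_(j < N) cos (j%:R * (x *+ 2) - pi / 2) = \sum_(j < N) sin (j%:R * (x *+ 2)).
  by apply: eq_bigr => j _; rewrite cosBpihalf.
move: C S; rewrite ES !hx /fej.
under eq_bigr do rewrite addr0.
set c := \sum_(a < N) cos _; set s := \sum_(a < N) sin _.
rewrite !addr0 !sinBpihalf => C S.
have -> : (c ^+ 2 + s ^+ 2) * sin x ^+ 2 = ((2 * sin x * c) ^+ 2 + (2 * sin x * s) ^+ 2) / 4 by field.
rewrite C S.
set u := N%:R * x; set v := u - x.
have -> : N%:R * (x *+ 2) - x = v + u by rewrite /v /u mulr2n; ring.
have -> : - x = v - u by rewrite /v; ring.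
rewrite (sinD v u) (sinB v u) (cosD v u) (cosB v u).
transitivity (sin u ^+ 2 * (cos v ^+ 2 + sin v ^+ 2)); last by rewrite cos2Dsin2 mulr1.
by field.
Qed.

Lemma fejD2pi N x k : fej N (x + 2 * pi * k%:~R) = fej N x.
Proof.
rewrite /fej; congr (_ ^+ 2 + _ ^+ 2); apply: eq_bigr => a _.
  by rewrite -[RHS](cos2piz _ (k * a%:Z)%R) intrM; congr cos; rewrite -pmulrn; ring.
by rewrite -[RHS](sin2piz _ (k * a%:Z)%R) intrM; congr sin; rewrite -pmulrn; ring.
Qed.

Lemma fej_le N x : fej N x <= N%:R ^+ 2.
Proof.
rewrite fejE; apply: (@le_trans _ _ (\sum_(a < N) \sum_(b < N) 1)).
  by apply: ler_sum => a _; apply: ler_sum => b _; exact: cos_le1.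
by rewrite !sumr_const !card_ord -[leLHS]mulr_natr expr2.
Qed.

Lemma fej_ge N x : N%:R * `|x| <= 1 -> N%:R ^+ 2 / 4 <= fej N x.
Proof.
move=> h; rewrite /fej.
have : N%:R / 2 <= \sum_(a < N) cos (a%:R * x).
  have -> : N%:R / 2 = \sum_(a < N) (2^-1 : R).
    by rewrite sumr_const card_ord -[RHS]mulr_natr mulrC.
  apply: ler_sum => a _; apply: le_trans (cos_ge _).
  have : `|a%:R * x| <= 1.
    rewrite normrM normr_nat; apply: le_trans h; rewrite ler_wpM2r//.
    by rewrite ler_nat ltnW.
  rewrite -(@real_normK _ (a%:R * x)) ?num_real//; have := normr_ge0 (a%:R * x).
  set y := `|_|; nra.
set c := \sum_(a < N) _; set s := \sum_(a < N) _.
have : 0 <= (N%:R : R) by [].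
set q : R := N%:R; nra.
Qed.

(** The frequencies a - b + k and a - b - k are nonzero and below M in modulus, so sampling at M
    points creates no aliasing. The phase [psi] is there for the shifted kernel in [w1]. *)
Lemma sum_fej_cos0 M N k (psi phi : R) : (N <= `|k|)%N -> (`|k| + N <= M)%N ->
  \sum_(j < M) fej N (j%:R * ang M + psi) * cos (j%:R * (k%:~R * ang M) + phi) = 0.
Proof.
move=> Nk kM.
under eq_bigr => j _ do rewrite fejE mulr_suml.
rewrite exchange_big big1// => a _.
under eq_bigr => j _ do rewrite mulr_suml.
rewrite exchange_big big1// => b _.
under eq_bigr => j _ do rewrite cosM2.
rewrite -mulr_sumr big_split/=.
set z := (a%:Z - b%:Z)%R.
have -> : \sum_(j < M) cos (z%:~R * (j%:R * ang M + psi) + (j%:R * (k%:~R * ang M) + phi)) =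
  \sum_(j < M) cos (j%:R * ((z + k)%:~R * ang M) + (z%:~R * psi + phi)).
  by apply: eq_bigr => j _; rewrite intrD; congr cos; ring.
have -> : \sum_(j < M) cos (z%:~R * (j%:R * ang M + psi) - (j%:R * (k%:~R * ang M) + phi)) =
  \sum_(j < M) cos (j%:R * ((z - k)%:~R * ang M) + (z%:~R * psi - phi)).
  by apply: eq_bigr => j _; rewrite intrB; congr cos; ring.
have := ltn_ord a; have := ltn_ord b; rewrite /z => ? ?.
rewrite !sum_cos_ang; try lia.
have -> : (a%:Z - b%:Z + k == 0)%R = false by apply/eqP; lia.
have -> : (a%:Z - b%:Z - k == 0)%R = false by apply/eqP; lia.
by rewrite !mul0r addr0 mulr0.
Qed.

Lemma count_diff N k : (\sum_(a < N) \sum_(b < N) ((a%:Z - b%:Z)%R == k))%N = (N - `|k|)%N.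
Proof.
wlog k0 : k / (0 <= k)%R => [H|].
  case: (leP 0%R k) => k0; first exact: H.
  have -> : `|k|%N = `|- k|%N by lia.
  rewrite -H; last by lia.
  rewrite exchange_big; apply: eq_bigr => a _; apply: eq_bigr => b _.
  by congr nat_of_bool; apply/eqP/eqP; lia.
case: k k0 => // k _; rewrite exchange_big /=.
transitivity (\sum_(b < N) (b < N - k))%N.
  apply: eq_bigr => b _.
  case: (ltnP b (N - k)) => bk.
    have bkN : (b + k < N)%N by lia.
    rewrite (bigD1 (Ordinal bkN))//= big1 ?addn0; first by apply/eqP; rewrite eqb1; apply/eqP; lia.
    move=> a ab; apply/eqP; rewrite eqb0; apply: contra ab => /eqP ab; apply/eqP/val_inj => /=; lia.
  rewrite big1// => a _; apply/eqP; rewrite eqb0; apply/eqP; have := ltn_ord a; lia.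
rewrite -big_mkcond/= sum1_card.
transitivity #|[pred i : 'I_N | (i < N - k)%N]|; first by apply: eq_card => i; rewrite !inE.
have NkN : (N - k <= N)%N by lia.
rewrite -[RHS](card_ord (N - k)) -[RHS](card_codom (f := widen_ord NkN)).
  apply: eq_card => i; rewrite !inE; apply/idP/codomP => [h|[j ->]]; last by rewrite /= ltn_ord.
  by exists (Ordinal h); apply/val_inj.
by move=> i j /(congr1 val) /= ij; apply/val_inj.
Qed.

(** The truncated subtraction [N - |k|] is the number of ways to write k as a difference of two
    indices below N. *)
Lemma sum_fej_cos M N k phi : (`|k| + N <= M)%N ->
  \sum_(j < M) fej N (j%:R * ang M) * cos (j%:R * (k%:~R * ang M) + phi) =
  M%:R * (N - `|k|)%:R * cos phi.
Proof.
move=> kM; case: (posnP N) => [->|N0].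
  rewrite sub0n mulr0 mul0r big1// => j _; rewrite /fej !big_ord0 expr0n/=; ring.
have [Nk|kN] := leqP N `|k|.
  have := @sum_fej_cos0 M N k 0 phi Nk kM.
  have -> : (N - `|k| = 0)%N by lia.
  rewrite mulr0n mulr0 mul0r => h; rewrite -[RHS]h.
  by apply: eq_bigr => j _; rewrite addr0.
under eq_bigr => j _ do rewrite fejE mulr_suml.
rewrite exchange_big -count_diff natr_sum mulr_sumr mulr_suml.
transitivity (\sum_(a < N) \sum_(b < N)
  (2^-1 * M%:R * cos phi * ((a%:Z - b%:Z)%R == k)%:R +
   2^-1 * M%:R * cos phi * ((a%:Z - b%:Z)%R == - k)%:R)).
  apply: eq_bigr => a _; under eq_bigr => j _ do rewrite mulr_suml.
  rewrite exchange_big; apply: eq_bigr => b _.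
  under eq_bigr => j _ do rewrite cosM2.
  rewrite -mulr_sumr big_split/=.
  set z := (a%:Z - b%:Z)%R.
  have -> : \sum_(j < M) cos (z%:~R * (j%:R * ang M) + (j%:R * (k%:~R * ang M) + phi)) =
    \sum_(j < M) cos (j%:R * ((z + k)%:~R * ang M) + phi).
    by apply: eq_bigr => j _; rewrite intrD; congr cos; ring.
  have -> : \sum_(j < M) cos (z%:~R * (j%:R * ang M) - (j%:R * (k%:~R * ang M) + phi)) =
    \sum_(j < M) cos (j%:R * ((z - k)%:~R * ang M) + (- phi)).
    by apply: eq_bigr => j _; rewrite intrB; congr cos; ring.
  have := ltn_ord a; have := ltn_ord b; rewrite /z => ? ?.
  rewrite !sum_cos_ang; try lia.
  rewrite cosN subr_eq0 addr_eq0; ring.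
under eq_bigr => a _ do rewrite big_split/= -!mulr_sumr.
rewrite big_split/= -!mulr_sumr.
have cnt l : \sum_(a < N) \sum_(b < N) ((a%:Z - b%:Z)%R == l)%:R = (N - `|l|)%:R :> R.
  by rewrite -count_diff natr_sum; apply: eq_bigr => a _; rewrite natr_sum.
rewrite !cnt abszN -mulr_suml -mulr_sumr.
under eq_bigr => a _ do rewrite natr_sum.
by rewrite cnt; field.
Qed.

Lemma sum_fej M N psi : (N <= M)%N -> \sum_(j < M) fej N (j%:R * ang M + psi) = M%:R * N%:R.
Proof.
move=> NM.
under eq_bigr => j _ do rewrite fejE.
rewrite exchange_big; under eq_bigr => a _ do rewrite exchange_big.
have -> : (M%:R * N%:R : R) = \sum_(a < N) \sum_(b < N) M%:R * ((a%:Z - b%:Z)%R == 0)%:R.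
  under eq_bigr => a _ do rewrite -mulr_sumr.
  rewrite -mulr_sumr; congr (_ * _).
  rewrite -[N in LHS]subn0 -[0%N in LHS]absz0 -count_diff natr_sum; apply: eq_bigr => a _.
  by rewrite natr_sum.
apply: eq_bigr => a _; apply: eq_bigr => b _.
set z := (a%:Z - b%:Z)%R.
transitivity (\sum_(j < M) cos (j%:R * (z%:~R * ang M) + z%:~R * psi)).
  by apply: eq_bigr => j _; congr cos; ring.
rewrite sum_cos_ang; last by have := ltn_ord a; have := ltn_ord b; rewrite /z; lia.
by case: eqP => [->|_]; rewrite ?mul0r ?mulr0// cos0 mulr1 mul1r.
Qed.

End Trig.

(** * Fourth moments of sums indexed by a tree *)

Section Sums.
Variable R : realType.

Lemma sum_sq_le_ord m (a : 'I_m -> R) :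
  (\sum_(i < m) a i) ^+ 2 <= m%:R * \sum_(i < m) a i ^+ 2.
Proof.
elim: m a => [|m IH] a; first by rewrite !big_ord0 expr0n mulr0.
rewrite !big_ord_recr/=; have {IH} := IH (fun i => a (widen_ord (leqnSn m) i)).
set S := \sum_(i < m) a _; set Q := \sum_(i < m) _ ^+ 2; set x := a _.
have Q0 : 0 <= Q by apply: sumr_ge0 => i _; exact: sqr_ge0.
case: (posnP m) => [m0|m0].
  have -> : S = 0 by rewrite /S big1// => i _; exfalso; have := ltn_ord i; lia.
  have -> : Q = 0 by rewrite /Q big1// => i _; exfalso; have := ltn_ord i; lia.
  by rewrite m0 !add0r mul1r.
rewrite -natr1; have : 1 <= (m%:R : R) by rewrite ler1n.
set n : R := m%:R => n1 h.
suff : 2 * S * x <= Q + n * x ^+ 2 by nra.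
have n0 : 0 < n by lra.
rewrite -(ler_pM2l n0); have := sqr_ge0 (S - n * x); nra.
Qed.

Lemma sum_pow4_le m (a : 'I_m -> R) :
  (\sum_(i < m) a i) ^+ 4 <= m%:R ^+ 3 * \sum_(i < m) a i ^+ 4.
Proof.
have h1 := sum_sq_le_ord a; have h2 := sum_sq_le_ord (fun i => a i ^+ 2).
have -> : (\sum_(i < m) a i) ^+ 4 = ((\sum_(i < m) a i) ^+ 2) ^+ 2 by rewrite -exprM.
have e : \sum_(i < m) (a i ^+ 2) ^+ 2 = \sum_(i < m) a i ^+ 4.
  by apply: eq_bigr => i _; rewrite -exprM.
rewrite e in h2.
apply: (@le_trans _ _ ((m%:R * \sum_(i < m) a i ^+ 2) ^+ 2)).
  rewrite lerXn2r// ?nnegrE ?sqr_ge0// mulr_ge0//.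
  by apply: sumr_ge0 => i _; exact: sqr_ge0.
rewrite exprMn (_ : 3 = 2 + 1)%N// exprD expr1 -mulrA ler_wpM2l// sqr_ge0.
Qed.

Definition near_idx (c i j : nat) := (i <= j + c)%N && (j <= i + c)%N.

Lemma near_idxC c i j : near_idx c i j = near_idx c j i.
Proof. by rewrite /near_idx andbC. Qed.

Lemma near_idx_norm c i j : `|i%:R - j%:R : R| <= c%:R -> near_idx c i j.
Proof.
rewrite ler_norml /near_idx -!(ler_nat R) !natrD => /andP[h1 h2]; apply/andP; split; lra.
Qed.

Lemma count_near c i m : (\sum_(j < m) near_idx c i j <= 2 * c + 1)%N.
Proof.
rewrite -(big_mkord xpredT (fun j => nat_of_bool (near_idx c i j))) -big_mkcond /=.
rewrite sum1_count -size_filter -(size_iota (i - c) (2 * c + 1)).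
apply: uniq_leq_size; first by rewrite filter_uniq// iota_uniq.
by move=> j; rewrite mem_filter mem_iota /near_idx => /andP[/andP[? ?] _]; lia.
Qed.

(** Schur's test: g_i g_j is at most the mean of g_i^2 and g_j^2, and an index has at most 2c + 1
    neighbours. *)
Lemma sum_near_le c m (g : nat -> R) :
  \sum_(i < m) \sum_(j < m) (near_idx c i j)%:R * (g i * g j) <=
  (2 * c + 1)%:R * \sum_(i < m) g i ^+ 2.
Proof.
apply: (@le_trans _ _ (\sum_(i < m) \sum_(j < m)
    (2^-1 * ((near_idx c i j)%:R * g i ^+ 2) + 2^-1 * ((near_idx c i j)%:R * g j ^+ 2)))).
  apply: ler_sum => i _; apply: ler_sum => j _.
  set n := (_)%:R; rewrite -subr_ge0.
  have -> : 2^-1 * (n * g i ^+ 2) + 2^-1 * (n * g j ^+ 2) - n * (g i * g j) =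
    2^-1 * n * (g i - g j) ^+ 2 by field.
  have n0 : 0 <= n by exact: ler0n.
  by rewrite mulr_ge0 ?sqr_ge0// mulr_ge0// invr_ge0.
under eq_bigr => i _ do rewrite big_split/=.
rewrite big_split/= [X in _ + X]exchange_big/=.
under [X in _ + X]eq_bigr => i _ do under eq_bigr => j _ do rewrite near_idxC.
have H : \sum_(i < m) \sum_(j < m) 2^-1 * ((near_idx c i j)%:R * g i ^+ 2) <=
   2^-1 * ((2 * c + 1)%:R * \sum_(i < m) g i ^+ 2).
  rewrite mulr_sumr mulr_sumr; apply: ler_sum => i _.
  rewrite -mulr_sumr ler_wpM2l// -mulr_suml ler_wpM2r ?sqr_ge0//.
  by rewrite -natr_sum ler_nat count_near.
apply: le_trans (lerD H H) _.
by set X := (2 * c + 1)%:R * _; lra.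
Qed.

Lemma sum_ordM (N q : nat) (f : nat -> R) :
  \sum_(i < N * q) f i = \sum_(j < N) \sum_(i < q) f (j * q + i)%N.
Proof.
elim: N => [|N IH]; first by rewrite mul0n !big_ord0.
rewrite big_ord_recr /= -IH -(big_mkord xpredT f) -(big_mkord xpredT f).
rewrite (big_cat_nat (n := (N * q)%N))//=; last by rewrite leq_mul2r leqnSn orbT.
congr (_ + _).
rewrite -{1}(add0n (N * q)%N) big_addn.
rewrite (_ : (N.+1 * q - N * q = q)%N); last by rewrite -mulnBl subSnn mul1n.
by rewrite big_mkord; apply: eq_bigr => i _; rewrite addnC.
Qed.

End Sums.

(** * Weighted averages and their orthogonality estimates *)

Section Functional.
Variables (R : realType) (T : finType) (W : T -> R).
Hypothesis W0 : forall t, 0 <= W t.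
Implicit Types F G : T -> R.

(** The average is left unnormalised; its total mass is carried along and cancels in
    [core_piece]. *)
Definition lam F := \sum_t W t * F t.

Lemma lam_le F G : (forall t, F t <= G t) -> lam F <= lam G.
Proof. by move=> h; apply: ler_sum => t _; rewrite ler_wpM2l. Qed.

Lemma lam_ge0 F : (forall t, 0 <= F t) -> 0 <= lam F.
Proof. by move=> h; apply: sumr_ge0 => t _; rewrite mulr_ge0. Qed.

Lemma eq_lam F G : F =1 G -> lam F = lam G.
Proof. by move=> h; apply: eq_bigr => t _; rewrite h. Qed.

Lemma lam0 : lam (fun => 0) = 0.
Proof. by rewrite /lam big1// => t _; rewrite mulr0. Qed.

Lemma lamD F G : lam (fun t => F t + G t) = lam F + lam G.
Proof. by rewrite /lam -big_split; apply: eq_bigr => t _; rewrite mulrDr. Qed.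

Lemma lamZ a F : lam (fun t => a * F t) = a * lam F.
Proof. by rewrite /lam mulr_sumr; apply: eq_bigr => t _; rewrite mulrCA. Qed.

Lemma lam_sum (I : Type) (r : seq I) (P : pred I) (F : I -> T -> R) :
  lam (fun t => \sum_(i <- r | P i) F i t) = \sum_(i <- r | P i) lam (F i).
Proof. by rewrite /lam exchange_big; apply: eq_bigr => t _; rewrite mulr_sumr. Qed.

Definition adm c i j k l :=
  [|| near_idx c i j && near_idx c k l, near_idx c i k && near_idx c j l
    | near_idx c i l && near_idx c j k].

(* Only quadruples that pair up survive; by Cauchy-Schwarz they contribute at most
   three times [(\sum_(i ~ j) |f i| |f j|)^2], which costs a single factor [m]. *)
Lemma quad_step c m (f : nat -> T -> R) :
  (forall i j k l, (i < m)%N -> (j < m)%N -> (k < m)%N -> (l < m)%N ->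
     ~~ adm c i j k l -> lam (fun t => f i t * f j t * f k t * f l t) = 0) ->
  lam (fun t => (\sum_(i < m) f i t) ^+ 4) <=
  (3 * (2 * c + 1) ^ 2)%:R * m%:R * \sum_(i < m) lam (fun t => f i t ^+ 4).
Proof.
move=> H.
pose g i t := `|f i t|.
pose n i j : R := (near_idx c i j)%:R.
pose q i j k l := lam (fun t => g i t * g j t * g k t * g l t).
have n0 i j : 0 <= n i j by rewrite /n ler0n.
have g0 i t : 0 <= g i t by rewrite /g.
have q0 i j k l : 0 <= q i j k l by apply: lam_ge0 => t; rewrite /g -!normrM.
have -> : lam (fun t => (\sum_(i < m) f i t) ^+ 4) =
  \sum_(i < m) \sum_(j < m) \sum_(k < m) \sum_(l < m)
    lam (fun t => f i t * f j t * f k t * f l t).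
  under eq_bigr => i _ do under eq_bigr => j _ do
    under eq_bigr => k _ do rewrite -lam_sum.
  under eq_bigr => i _ do under eq_bigr => j _ do rewrite -lam_sum.
  under eq_bigr => i _ do rewrite -lam_sum.
  rewrite -lam_sum; apply: eq_lam => t.
  rewrite (_ : 4 = 2 + 2)%N// exprD expr2 [X in X * X]big_distrlr/=.
  rewrite mulr_suml; apply: eq_bigr => i _.
  rewrite mulr_suml; apply: eq_bigr => j _.
  rewrite mulr_sumr; apply: eq_bigr => k _.
  by rewrite mulr_sumr; apply: eq_bigr => l _; rewrite mulrA.
apply: (@le_trans _ _ (\sum_(i < m) \sum_(j < m) \sum_(k < m) \sum_(l < m)
   (n i j * n k l + n i k * n j l + n i l * n j k) * q i j k l)).
  apply: ler_sum => i _; apply: ler_sum => j _; apply: ler_sum => k _; apply: ler_sum => l _.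
  have n3 : 0 <= n i j * n k l + n i k * n j l + n i l * n j k.
    by rewrite !addr_ge0 ?mulr_ge0.
  case: (boolP (adm c i j k l)) => [ad|/H ->//]; last exact: mulr_ge0.
  have n1 : 1 <= n i j * n k l + n i k * n j l + n i l * n j k.
    move: ad => /or3P[]/andP[]; rewrite /n => -> ->; rewrite mulr1.
    - by rewrite -addrA lerDl addr_ge0// mulr_ge0.
    - by rewrite addrAC lerDr addr_ge0// mulr_ge0.
    - by rewrite lerDr addr_ge0// mulr_ge0.
  apply: (@le_trans _ _ (1 * q i j k l)); last by rewrite ler_wpM2r.
  rewrite mul1r /q; apply: lam_le => t.
  by rewrite /g -!normrM ler_norm.
pose Q := \sum_(i < m) \sum_(j < m) \sum_(k < m) \sum_(l < m) n i j * n k l * q i j k l.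
have eqQ (F G : 'I_m -> 'I_m -> 'I_m -> 'I_m -> R) :
  (forall i j k l, F i j k l = G i j k l) ->
  \sum_(i < m) \sum_(j < m) \sum_(k < m) \sum_(l < m) F i j k l =
  \sum_(i < m) \sum_(j < m) \sum_(k < m) \sum_(l < m) G i j k l.
  move=> FG; apply: eq_bigr => i _; apply: eq_bigr => j _.
  by apply: eq_bigr => k _; apply: eq_bigr => l _.
have -> : \sum_(i < m) \sum_(j < m) \sum_(k < m) \sum_(l < m)
   (n i j * n k l + n i k * n j l + n i l * n j k) * q i j k l = Q + Q + Q.
  (* [q] is symmetric in its four indices, so renaming the summation indices reduces the other two
     pairings to the first. *)
  transitivity (Q + (\sum_(i < m) \sum_(j < m) \sum_(k < m) \sum_(l < m) n i k * n j l * q i j k l)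
     + (\sum_(i < m) \sum_(j < m) \sum_(k < m) \sum_(l < m) n i l * n j k * q i j k l)).
    rewrite /Q -!big_split; apply: eq_bigr => i _; rewrite -!big_split; apply: eq_bigr => j _.
    rewrite -!big_split; apply: eq_bigr => k _; rewrite -!big_split; apply: eq_bigr => l _.
    by rewrite /= !mulrDl.
  congr (_ + _ + _).
    under eq_bigr => i _ do rewrite exchange_big.
    by apply: eqQ => i j k l; congr (_ * _); apply: eq_lam => t; ring.
  under eq_bigr => i _ do under eq_bigr => j _ do rewrite exchange_big.
  under eq_bigr => i _ do rewrite exchange_big.
  by apply: eqQ => i j k l; congr (_ * _); apply: eq_lam => t; ring.
have QE : Q = lam (fun t => (\sum_(i < m) \sum_(j < m) n i j * (g i t * g j t)) ^+ 2).
  transitivity (\sum_(i < m) \sum_(j < m) \sum_(k < m) \sum_(l < m)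
     lam (fun t => n i j * (g i t * g j t) * (n k l * (g k t * g l t)))).
    apply: eqQ => i j k l; rewrite /q -lamZ; apply: eq_lam => t; ring.
  under eq_bigr => i _ do under eq_bigr => j _ do
    under eq_bigr => k _ do rewrite -lam_sum.
  under eq_bigr => i _ do under eq_bigr => j _ do rewrite -lam_sum.
  under eq_bigr => i _ do rewrite -lam_sum.
  rewrite -lam_sum; apply: eq_lam => t.
  rewrite expr2 mulr_suml; apply: eq_bigr => i _.
  rewrite mulr_suml; apply: eq_bigr => j _.
  rewrite mulr_sumr; apply: eq_bigr => k _.
  by rewrite mulr_sumr.
have QB : Q <= (2 * c + 1)%:R ^+ 2 * m%:R * \sum_(i < m) lam (fun t => f i t ^+ 4).
  rewrite QE -lam_sum -lamZ; apply: lam_le => t.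
  have h1 := @sum_near_le R c m (fun i => g i t).
  have h2 := sum_sq_le_ord (fun i : 'I_m => g i t ^+ 2).
  have e : \sum_(i < m) (g i t ^+ 2) ^+ 2 = \sum_(i < m) f i t ^+ 4.
    by apply: eq_bigr => i _; rewrite /g real_normK ?num_real// -exprM.
  rewrite e in h2; rewrite -mulrA.
  apply: (@le_trans _ _ (((2 * c + 1)%:R * \sum_(i < m) g i t ^+ 2) ^+ 2)).
    rewrite lerXn2r// ?nnegrE.
      apply: sumr_ge0 => i _; apply: sumr_ge0 => j _.
      by rewrite mulr_ge0// mulr_ge0.
    by rewrite mulr_ge0//; apply: sumr_ge0 => i _; exact: sqr_ge0.
  by rewrite exprMn ler_wpM2l// sqr_ge0.
rewrite natrM natrX; move: QB.
set X := _ ^+ 2; set Y := \sum_(i < m) _ => QB.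
rewrite (_ : 3%:R * X * m%:R * Y = X * m%:R * Y + X * m%:R * Y + X * m%:R * Y); last by ring.
by rewrite !lerD.
Qed.

Definition blk m (f : nat -> T -> R) (a k : nat) t := \sum_(i < m ^ k) f (a + i)%N t.

Lemma blkM m f a k l t : blk m f a (l + k) t = \sum_(j < m ^ l) blk m f (a + j * m ^ k) k t.
Proof.
rewrite /blk expnD (sum_ordM _ _ (fun i => f (a + i)%N t)).
by apply: eq_bigr => j _; apply: eq_bigr => i _; rewrite addnA.
Qed.

(** Each level costs [D * m]. The factor m is what square-root cancellation among m children of
    equal size would give anyway; only D is a loss. *)
Lemma decouple m (D : R) (f : nat -> T -> R) k0 K : 0 <= D ->
  (forall k a, (k0 <= k < K)%N ->
     lam (fun t => blk m f a k.+1 t ^+ 4) <=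
     D * m%:R * \sum_(c < m) lam (fun t => blk m f (a + c * m ^ k) k t ^+ 4)) ->
  forall l a, (k0 + l <= K)%N ->
     lam (fun t => blk m f a (l + k0) t ^+ 4) <=
     (D * m%:R) ^+ l * \sum_(j < m ^ l) lam (fun t => blk m f (a + j * m ^ k0) k0 t ^+ 4).
Proof.
move=> D0 H; elim=> [|l IH] a h.
  by rewrite expn0 expr0 mul1r big_ord_recl big_ord0 addr0 mul0n addn0.
rewrite addSn; apply: le_trans (H _ _ _) _; first by lia.
rewrite exprS -[leRHS]mulrA ler_wpM2l ?mulr_ge0//.
apply: (@le_trans _ _ (\sum_(c < m) ((D * m%:R) ^+ l *
   \sum_(j < m ^ l) lam (fun t => blk m f (a + c * m ^ (l + k0) + j * m ^ k0) k0 t ^+ 4)))).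
  by apply: ler_sum => c _; apply: IH; lia.
rewrite -mulr_sumr ler_wpM2l ?exprn_ge0 ?mulr_ge0// expnS.
rewrite (sum_ordM m (m ^ l) (fun j => lam (fun t => blk m f (a + j * m ^ k0) k0 t ^+ 4))).
apply: ler_sum => c _; apply: ler_sum => j _.
by rewrite mulnDl -mulnA -expnD addnA.
Qed.

(* Almost orthogonality: each index interacts with at most [2 c + 1] others. *)
Lemma l2_block c m (f : nat -> T -> R) :
  (forall i j, (i < m)%N -> (j < m)%N -> ~~ near_idx c i j ->
     lam (fun t => f i t * f j t) = 0) ->
  lam (fun t => (\sum_(i < m) f i t) ^+ 2) <=
  (2 * c + 1)%:R * \sum_(i < m) lam (fun t => f i t ^+ 2).
Proof.
move=> H; rewrite -lam_sum -lamZ.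
have -> : lam (fun t => (\sum_(i < m) f i t) ^+ 2) =
   lam (fun t => \sum_(i < m) \sum_(j < m) (near_idx c i j)%:R * (f i t * f j t)).
  transitivity (\sum_(i < m) \sum_(j < m) lam (fun t => f i t * f j t)).
    under eq_bigr => i _ do rewrite -lam_sum.
    by rewrite -lam_sum; apply: eq_lam => t; rewrite expr2 big_distrlr.
  rewrite lam_sum; apply: eq_bigr => i _; rewrite lam_sum; apply: eq_bigr => j _.
  rewrite lamZ; case: (boolP (near_idx c i j)) => [_|/H ->//]; first by rewrite mul1r.
  by rewrite mul0r.
by apply: lam_le => t; exact: (@sum_near_le R c m (fun i => f i t)).
Qed.

End Functional.

(** * Trigonometric polynomials and frequency bands *)

Section TrigPoly.
Variables (R : realType) (L : nat).
Hypothesis L0 : (0 < L)%N.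
Notation V := (R * R * R)%type.
Implicit Types (u v x : V) (F G : V -> R) (P : V -> Prop).

Definition dot u x : R := u.1.1 * x.1.1 + u.1.2 * x.1.2 + u.2 * x.2.
Definition sc (t : R) v : V := (t * v.1.1, t * v.1.2, t * v.2).

Lemma dotDl u v x : dot (u + v) x = dot u x + dot v x.
Proof. by rewrite /dot/=; ring. Qed.

Lemma dotBl u v x : dot (u - v) x = dot u x - dot v x.
Proof. by rewrite /dot/=; ring. Qed.

Lemma dotDr u v x : dot u (v + x) = dot u v + dot u x.
Proof. by rewrite /dot/=; ring. Qed.

Lemma dot_sc u t v : dot u (sc t v) = t * dot u v.
Proof. by rewrite /dot/=; ring. Qed.

Definition atom u (phi : R) : V -> R := fun x => cos (ang R L * dot u x + phi).

Lemma atomM u v phi psi x : atom u phi x * atom v psi x =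
  2^-1 * atom (u + v) (phi + psi) x + 2^-1 * atom (u - v) (phi - psi) x.
Proof.
rewrite /atom cosM2 mulrDr dotDl dotBl; congr (_ * cos _ + _ * cos _); ring.
Qed.

(** Trigonometric polynomials with spectrum in [P], built from real cosines with free phases. A
    cosine does not distinguish u from -u, so the spectrum of a product has to contain both u + v
    and u - v, as in [pm]. *)
Inductive span P : (V -> R) -> Prop :=
| span_nil : span P (fun=> 0)
| span_cons a u phi F : P u -> span P F -> span P (fun x => a * atom u phi x + F x).

Lemma eq_span P F G : F =1 G -> span P F -> span P G.
Proof. by move=> /funext ->. Qed.

Lemma sub_span P P' F : (forall u, P u -> P' u) -> span P F -> span P' F.
Proof. by move=> h; elim=> [|a u phi G Pu _ IH]; constructor => //; exact: h. Qed.

Lemma spanD P F G : span P F -> span P G -> span P (fun x => F x + G x).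
Proof.
move=> + hG; elim=> [|a u phi F' Pu _ IH].
  by apply: eq_span hG => x; rewrite add0r.
by apply: eq_span (span_cons a phi Pu IH) => x; rewrite addrA.
Qed.

Lemma spanZ P c F : span P F -> span P (fun x => c * F x).
Proof.
elim=> [|a u phi F' Pu _ IH]; first by apply: eq_span (span_nil P) => x; rewrite mulr0.
by apply: eq_span (span_cons (c * a) phi Pu IH) => x; rewrite mulrDr mulrA.
Qed.

Lemma span_atom P a u phi : P u -> span P (fun x => a * atom u phi x).
Proof. by move=> Pu; apply: eq_span (span_cons a phi Pu (span_nil P)) => x; rewrite addr0. Qed.

Lemma span_sum P (I : Type) (r : seq I) (A : pred I) (F : I -> V -> R) :
  (forall i, A i -> span P (F i)) -> span P (fun x => \sum_(i <- r | A i) F i x).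
Proof.
move=> h; elim: r => [|i r IH].
  by apply: eq_span (span_nil P) => x; rewrite big_nil.
case: (boolP (A i)) => Ai.
  by apply: eq_span (spanD (h i Ai) IH) => x; rewrite big_cons Ai.
by apply: eq_span IH => x; rewrite big_cons (negbTE Ai).
Qed.

Definition pm P P' : V -> Prop :=
  fun w => exists u v, [/\ P u, P' v & w = u + v \/ w = u - v].

Lemma spanM P P' F G : span P F -> span P' G -> span (pm P P') (fun x => F x * G x).
Proof.
move=> hF hG; elim: hF => [|a u phi F' Pu _ IH].
  by apply: eq_span (span_nil _) => x; rewrite mul0r.
apply: (@eq_span _ (fun x => a * atom u phi x * G x + F' x * G x)).
  by move=> x; rewrite mulrDl.
apply: spanD IH => {F'}; elim: hG => [|b v psi G' Pv _ IH].
  by apply: eq_span (span_nil _) => x; rewrite mulr0.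
apply: (@eq_span _ (fun x => a * b / 2 * atom (u + v) (phi + psi) x +
  (a * b / 2 * atom (u - v) (phi - psi) x + a * atom u phi x * G' x))).
  move=> x; rewrite mulrDr (_ : a * atom u phi x * (b * atom v psi x) =
    a * b * (atom u phi x * atom v psi x)); last by ring.
  by rewrite atomM; field.
constructor; first by exists u, v; split => //; left.
by constructor => //; exists u, v; split => //; right.
Qed.

Definition linear_op (Op : (V -> R) -> V -> R) :=
  Op (fun=> 0) =1 (fun=> 0) /\
  forall a F G x, Op (fun y => a * F y + G y) x = a * Op F x + Op G x.

(** A diagonal operator narrows the spectrum because the atoms with [c u = 0] disappear. *)
Lemma span_op P (Op : (V -> R) -> V -> R) (c : V -> R) F : linear_op Op ->
  (forall u phi x, P u -> Op (atom u phi) x = c u * atom u phi x) ->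
  span P F -> span (fun u => P u /\ c u <> 0) (Op F).
Proof.
move=> [Op0 OpD] h; elim=> [|a u phi G Pu _ IH].
  by apply: eq_span (span_nil _) => x; rewrite Op0.
have [c0|c0] := pselect (c u = 0).
  by apply: eq_span IH => x; rewrite OpD h// c0 mul0r mulr0 add0r.
have : P u /\ c u <> 0 by [].
move=> /(@span_cons _ (a * c u) u phi _)/(_ IH); apply: eq_span => x.
by rewrite OpD h// mulrA.
Qed.

Lemma span_op_id P (Op : (V -> R) -> V -> R) F x : linear_op Op ->
  (forall u phi y, P u -> Op (atom u phi) y = atom u phi y) ->
  span P F -> Op F x = F x.
Proof.
by move=> [Op0 OpD] h; elim=> [|a u phi G Pu _ IH]; rewrite ?Op0// OpD h// IH.
Qed.

(** Fejer mean along the segment from x to x + v, sampled at M points. An atom whose phase makes k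
    turns along v is multiplied by (N - |k|)/N. *)
Definition avg N M v F x :=
  \sum_(k < M) fej N (k%:R * ang R M) / (M%:R * N%:R) * F (x + sc (k%:R / M%:R) v).

Lemma avg_linear N M v : linear_op (avg N M v).
Proof.
split=> [x|a F G x]; first by rewrite /avg big1// => k _; rewrite mulr0.
by rewrite /avg mulr_sumr -big_split; apply: eq_bigr => k _; rewrite /=; ring.
Qed.

Lemma avg_weight N M : (0 < N)%N -> (N <= M)%N ->
  \sum_(k < M) fej N (k%:R * ang R M) / (M%:R * N%:R) = 1.
Proof.
move=> N0 NM; rewrite -mulr_suml.
under eq_bigr => k _ do rewrite -[k%:R * _]addr0.
rewrite sum_fej// divff// mulf_neq0// pnatr_eq0; lia.
Qed.

Lemma avg_atom N M v u (k : int) phi x : (0 < N)%N -> (`|k| + N <= M)%N ->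
  dot u v = L%:R * k%:~R ->
  avg N M v (atom u phi) x = (N - `|k|)%:R / N%:R * atom u phi x.
Proof.
move=> N0 kM uv; rewrite /avg.
have M0 : (0 < M)%N by lia.
have Mn0 : (M%:R : R) != 0 by rewrite pnatr_eq0; lia.
have Nn0 : (N%:R : R) != 0 by rewrite pnatr_eq0; lia.
have Ln0 : (L%:R : R) != 0 by rewrite pnatr_eq0; lia.
transitivity ((M%:R * N%:R)^-1 *
  \sum_(j < M) fej N (j%:R * ang R M) *
     cos (j%:R * (k%:~R * ang R M) + (ang R L * dot u x + phi))).
  rewrite mulr_sumr; apply: eq_bigr => j _; rewrite mulrAC mulrC; congr (_ * (_ * cos _)).
  by rewrite dotDr dot_sc uv /ang; field; rewrite Mn0 Ln0.
rewrite sum_fej_cos// /atom; field.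
by rewrite Mn0 Nn0.
Qed.

(** De la Vallee-Poussin mean: the combination of two Fejer means whose multiplier [tau] is a
    trapezoid, equal to 1 up to N and to 0 from N' on. *)
Definition Top N N' M v F x :=
  (N'%:R * avg N' M v F x - N%:R * avg N M v F x) / (N'%:R - N%:R).

Lemma Top_linear N N' M v : linear_op (Top N N' M v).
Proof.
have [a0 aD] := avg_linear N M v; have [b0 bD] := avg_linear N' M v.
split=> [x|a F G x]; first by rewrite /Top a0 b0 !mulr0 subrr mul0r.
by rewrite /Top aD bD; ring.
Qed.

Definition tau N N' (k : nat) : R :=
  ((N' - k)%:R - (N - k)%:R) / (N'%:R - N%:R).

Lemma Top_atom N N' M v u (k : int) phi x : (0 < N)%N -> (N < N')%N -> (`|k| + N' <= M)%N ->
  dot u v = L%:R * k%:~R ->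
  Top N N' M v (atom u phi) x = tau N N' `|k| * atom u phi x.
Proof.
move=> N0 NN kM uv; rewrite /Top !(avg_atom _ _ _ _ uv)//; try lia.
have ? : (N%:R : R) != 0 by rewrite pnatr_eq0; lia.
have ? : (N'%:R : R) != 0 by rewrite pnatr_eq0; lia.
have NN0 : (N'%:R - N%:R : R) != 0 by rewrite subr_eq0 eqr_nat; lia.
by rewrite /tau; field; apply/and3P; split.
Qed.

Lemma tau1 N N' k : (N < N')%N -> (k <= N)%N -> tau N N' k = 1.
Proof.
move=> NN kN; rewrite /tau !natrB//; last by lia.
have NN0 : (N'%:R - N%:R : R) != 0 by rewrite subr_eq0 eqr_nat; lia.
by field.
Qed.

Lemma tau0 N N' k : (N < N')%N -> (N' <= k)%N -> tau N N' k = 0.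
Proof.
move=> NN kN; rewrite /tau.
have -> : (N - k = 0)%N by lia.
have -> : (N' - k = 0)%N by lia.
by rewrite subrr mul0r.
Qed.

(** * Cutting a polynomial into frequency bands *)

Section Pieces.
Variables (Nd : nat -> nat) (sg M : nat) (v : V).
Hypothesis sg0 : (0 < sg)%N.
Hypothesis Nd0 : forall p, (0 < Nd p)%N.
Hypothesis NdS : forall p, (Nd p < Nd p.+1)%N.

(* Localises the frequency along [v] to the band between the nodes [p - 1] and [p + 1]. *)
Definition HH p F x :=
  if p is p'.+1 then Top (sg * Nd p) (sg * Nd p.+1) M v F x - Top (sg * Nd p') (sg * Nd p) M v F x
  else Top (sg * Nd 0) (sg * Nd 1) M v F x.

Lemma HH_linear p : linear_op (HH p).
Proof.
case: p => [|p] /=; first exact: Top_linear.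
have [a0 aD] := Top_linear (sg * Nd p.+1) (sg * Nd p.+2) M v.
have [b0 bD] := Top_linear (sg * Nd p) (sg * Nd p.+1) M v.
split=> [x|a F G x]; first by rewrite /HH a0 b0 subrr.
by rewrite /HH aD bD; ring.
Qed.

Lemma sum_HH J F x : \sum_(p < J.+1) HH p F x = Top (sg * Nd J) (sg * Nd J.+1) M v F x.
Proof.
elim: J => [|J IH]; first by rewrite big_ord_recl big_ord0 addr0.
by rewrite big_ord_recr IH /= addrC subrK.
Qed.

Lemma sum_HH_id P J F x : span P F ->
  (forall u, P u -> exists2 k : int, dot u v = L%:R * k%:~R &
     (`|k| <= sg * Nd J)%N && (`|k| + sg * Nd J.+1 <= M)%N) ->
  \sum_(p < J.+1) HH p F x = F x.
Proof.
move=> sF h; rewrite sum_HH; apply: span_op_id sF; first exact: Top_linear.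
move=> u phi y /h[k uv /andP[k1 k2]].
have h1 : (sg * Nd J < sg * Nd J.+1)%N by rewrite ltn_pmul2l.
rewrite (Top_atom _ _ _ _ _ uv) ?tau1 ?mul1r//.
by rewrite muln_gt0 sg0 Nd0.
Qed.

Lemma HH_span P p F : span P F ->
  (forall u, P u -> exists2 k : int, dot u v = L%:R * k%:~R & (`|k| + sg * Nd p.+1 <= M)%N) ->
  span (fun u => P u /\ exists k : int, [/\ dot u v = L%:R * k%:~R,
     (`|k| < sg * Nd p.+1)%N & (p == 0)%N || (sg * Nd p.-1 < `|k|)%N]) (HH p F).
Proof.
move=> sF h.
(* The integer attached to a frequency of [P] is chosen once and for all; the value 0 outside [P] is
   arbitrary. *)
pose K u : int := if pselect (P u) is left Pu then projT1 (cid2 (h u Pu)) else 0.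
have KP u : P u -> dot u v = L%:R * (K u)%:~R /\ (`|K u| + sg * Nd p.+1 <= M)%N.
  by move=> Pu; rewrite /K; case: pselect => // ?; case: cid2.
have lt q : (sg * Nd q < sg * Nd q.+1)%N by rewrite ltn_pmul2l.
have pos q : (0 < sg * Nd q)%N by rewrite muln_gt0 sg0 Nd0.
pose c u := if p is p'.+1 then tau (sg * Nd p) (sg * Nd p.+1) `|K u| - tau (sg * Nd p') (sg * Nd p) `|K u|
  else tau (sg * Nd 0) (sg * Nd 1) `|K u|.
have hc u phi x : P u -> HH p (atom u phi) x = c u * atom u phi x.
  move=> /KP[uv kM]; rewrite /c /HH; case: (p) kM => [|p'] kM.
    by rewrite (Top_atom _ _ _ _ _ uv).
  have := lt p'.+1 => ltp.
  by rewrite !(Top_atom _ _ _ _ _ uv)// ?mulrBl//; lia.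
apply: sub_span (span_op (HH_linear p) hc sF) => u [Pu cu]; split => //.
have [uv kM] := KP u Pu; exists (K u); split => //.
  rewrite ltnNge; apply/negP => kN; apply: cu; rewrite /c; case: (p) kN => [|p'] kN.
    by rewrite tau0.
  have := lt p'.+1 => ltp.
  by rewrite !tau0// ?subrr//; lia.
apply/orP; move: cu; rewrite /c; case: (p) => [|p'] cu; first by left.
right; rewrite /= ltnNge; apply/negP => kN; apply: cu.
have := lt p' => ltp.
by rewrite !tau1 ?subrr//; lia.
Qed.

End Pieces.

Section Good.
Variables (T : finType) (W : T -> R) (X : T -> V) (b a : R).
Hypothesis W0 : forall t, 0 <= W t.

(** The sup norm and the mean of |F| are both preserved by Fejer means. The mean is controlled for
    all translates at once, because these operators shift the argument. *)
Definition good c F :=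
  (forall x, `|F x| <= c * b) /\ (forall w, lam W (fun t => `|F (X t + w)|) <= c * a).

Lemma good_lin c d al be F G : good c F -> good d G ->
  good (`|al| * c + `|be| * d) (fun x => al * F x + be * G x).
Proof.
move=> [F1 F2] [G1 G2]; split=> [x|w].
  rewrite mulrDl; apply: le_trans (ler_normD _ _) _.
  by rewrite !normrM -!mulrA; apply: lerD; apply: ler_wpM2l.
apply: (@le_trans _ _ (lam W (fun t => `|al| * `|F (X t + w)| + `|be| * `|G (X t + w)|))).
  by apply: lam_le => // t; apply: le_trans (ler_normD _ _) _; rewrite !normrM.
by rewrite lamD !lamZ mulrDl -!mulrA; apply: lerD; apply: ler_wpM2l.
Qed.

Lemma good_avg N M v c F : (0 < N)%N -> (N <= M)%N -> good c F -> good c (avg N M v F).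
Proof.
move=> N0 NM [F1 F2].
have w0 k : 0 <= fej N (k%:R * ang R M) / (M%:R * N%:R) by rewrite divr_ge0 ?fej_ge0 ?mulr_ge0.
have sw y : y = (\sum_(k < M) fej N (k%:R * ang R M) / (M%:R * N%:R)) * y.
  by rewrite avg_weight// mul1r.
have ha x : `|avg N M v F x| <= \sum_(k < M) fej N (k%:R * ang R M) / (M%:R * N%:R) *
    `|F (x + sc (k%:R / M%:R) v)|.
  apply: le_trans (ler_norm_sum _ _ _) _; apply: ler_sum => k _.
  by rewrite normrM (ger0_norm (w0 k)).
split=> [x|w].
  apply: le_trans (ha x) _; rewrite (sw (c * b)) mulr_suml.
  by apply: ler_sum => k _; apply: ler_wpM2l.
apply: le_trans (lam_le W0 (fun t => ha (X t + w))) _.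
rewrite lam_sum (sw (c * a)) mulr_suml.
apply: ler_sum => k _; rewrite lamZ; apply: ler_wpM2l => //.
apply: le_trans (F2 (w + sc (k%:R / M%:R) v)).
by rewrite le_eqVlt; apply/orP; left; apply/eqP/eq_lam => t; rewrite addrA.
Qed.

(** Each Fejer mean is an average, so the combination has norm at most (N' + N)/(N' - N), which
    depends only on the relative width of the band. *)
Lemma good_Top N N' M v c r F : (0 < N)%N -> (N < N')%N -> (N' <= M)%N ->
  ((N' + N)%:R <= r * (N' - N)%:R) -> 0 <= c -> 0 <= a -> 0 <= b ->
  good c F -> good (r * c) (Top N N' M v F).
Proof.
move=> N0 NN NM hr c0 a0 b0 gF.
have NN0 : (0 : R) < N'%:R - N%:R by rewrite subr_gt0 ltr_nat.
have := good_lin (N'%:R / (N'%:R - N%:R)) (- (N%:R / (N'%:R - N%:R)))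
  (good_avg v (ltn_trans N0 NN) NM gF) (good_avg v N0 (leq_trans (ltnW NN) NM) gF).
rewrite normrN !ger0_norm; try by rewrite divr_ge0// ltW.
have le1 : N'%:R / (N'%:R - N%:R) * c + N%:R / (N'%:R - N%:R) * c <= r * c.
  rewrite -mulrDl ler_wpM2r// -mulrDl ler_pdivrMr// -natrD -natrB//; exact: ltnW.
move=> [h1 h2]; split=> [x|w].
  apply: le_trans (ler_wpM2r b0 le1); apply: le_trans (h1 x).
  by rewrite le_eqVlt; apply/orP; left; apply/eqP; congr `|_|; rewrite /Top; ring.
apply: le_trans (ler_wpM2r a0 le1); apply: le_trans (h2 w).
rewrite le_eqVlt; apply/orP; left; apply/eqP/eq_lam => t; congr `|_|; rewrite /Top; ring.
Qed.

Lemma good_HH Nd sg M v r p c F : (0 < sg)%N -> (forall q, (0 < Nd q)%N) ->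
  (forall q, (Nd q < Nd q.+1)%N) ->
  (forall q, ((Nd q.+1 + Nd q)%:R <= r * (Nd q.+1 - Nd q)%:R)) ->
  (sg * Nd p.+1 <= M)%N -> 0 <= c -> 0 <= a -> 0 <= b -> 0 <= r ->
  good c F -> good (2 * r * c) (HH Nd sg M v p F).
Proof.
move=> sg0 Nd0 NdS hr hM c0 a0 b0 r0 gF.
have T0 q : (q <= p)%N -> good (r * c) (Top (sg * Nd q) (sg * Nd q.+1) M v F).
  move=> qp; apply: good_Top => //.
  - by rewrite muln_gt0 sg0 Nd0.
  - by rewrite ltn_pmul2l.
  - apply: leq_trans hM; rewrite leq_pmul2l//.
    by apply: (@homo_leq _ Nd leq leqnn leq_trans) => // i; exact: ltnW.
  - by rewrite -mulnDr -mulnBr !natrM mulrCA ler_wpM2l.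
case: p T0 {hM} => [|p] T0.
  have [h1 h2] := T0 0%N (leqnn _).
  have le2 : r * c <= 2 * r * c by have := mulr_ge0 r0 c0; lra.
  split=> [x|w].
    exact: le_trans (h1 x) (ler_wpM2r b0 le2).
  exact: le_trans (h2 w) (ler_wpM2r a0 le2).
have := good_lin 1 (-1) (T0 p.+1 (leqnn _)) (T0 p (leqnSn _)).
rewrite normrN normr1 !mul1r (_ : r * c + r * c = 2 * r * c); last by ring.
move=> [h1 h2]; split=> [x|w].
  by have := h1 x; rewrite mul1r mulN1r.
apply: le_trans (h2 w).
by rewrite le_eqVlt; apply/orP; left; apply/eqP/eq_lam => t; rewrite mul1r mulN1r.
Qed.

Definition van u := forall phi, lam W (fun t => atom u phi (X t)) = 0.

Lemma lam_span0 P F : span P F -> (forall u, P u -> van u) -> lam W (fun t => F (X t)) = 0.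
Proof.
move=> + h; elim=> [|c u phi G Pu _ IH]; first exact: lam0.
by rewrite lamD lamZ (h u Pu) IH mulr0 addr0.
Qed.

End Good.
End TrigPoly.

(** * Averages over a grid and bumps on cells *)

Section Grid.
Variables (R : realType) (L n S : nat).
Hypotheses (L0 : (0 < L)%N) (n0 : (0 < n)%N).
Notation V := (R * R * R)%type.
(** Frequencies lie in (1/n)Z and are scaled by 1/L in [atom], so all functions have period L n in
    each coordinate; in steps of 1/n a period has L n^2 points. *)
Let M := (L * n * n)%N.
Hypothesis LS : (4 * S + 8 <= L)%N.

Let T : finType := ('I_M * 'I_M * 'I_M)%type.
Definition gridpt (t : T) : V := (t.1.1%:R / n%:R, t.1.2%:R / n%:R, t.2%:R / n%:R).
(** A Fejer weight localises to coordinates of order L and lets only frequencies below 1 survive,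
    but it has zeros. The shift by pi/n exchanges sin^2 and cos^2 in the numerator of the kernel, so
    the sum of both copies has none; see [w1_low]. *)
Definition w1 (j : nat) : R := fej n (j%:R * ang R M + 0) + fej n (j%:R * ang R M + pi / n%:R).
Definition gridW (t : T) : R := w1 t.1.1 * w1 t.1.2 * w1 t.2.

Let MR : (M%:R : R) = L%:R * n%:R * n%:R. Proof. by rewrite !natrM. Qed.
Let nn0 : (n%:R : R) != 0. Proof. by rewrite pnatr_eq0; lia. Qed.
Let Ln0 : (L%:R : R) != 0. Proof. by rewrite pnatr_eq0; lia. Qed.
Let nM : (n <= M)%N. Proof. by rewrite /M; nia. Qed.

Lemma w1_ge0 j : 0 <= w1 j.
Proof. by rewrite addr_ge0 ?fej_ge0. Qed.

Lemma gridW_ge0 t : 0 <= gridW t.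
Proof. by rewrite !mulr_ge0 ?w1_ge0. Qed.

Lemma sum_grid (F : nat -> nat -> nat -> R) :
  \sum_(t : T) F t.1.1 t.1.2 t.2 = \sum_(i < M) \sum_(j < M) \sum_(k < M) F i j k.
Proof.
rewrite pair_big pair_big /=; apply: eq_bigr => -[[i j] k] _ //=.
Qed.

Lemma sum_w1 : \sum_(j < M) w1 j = 2 * M%:R * n%:R.
Proof. by rewrite big_split/= !sum_fej//; ring. Qed.

Lemma sum_w1_cos (k : int) psi : (n <= `|k|)%N -> (`|k| + n <= M)%N ->
  \sum_(j < M) w1 j * cos (j%:R * (k%:~R * ang R M) + psi) = 0.
Proof.
move=> nk kM; under eq_bigr => j _ do rewrite mulrDl.
by rewrite big_split/= !sum_fej_cos0// addr0.
Qed.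

Lemma lam_gridW1 : lam gridW (fun=> 1) = (2 * M%:R * n%:R) ^+ 3.
Proof.
rewrite /lam; under eq_bigr => t _ do rewrite mulr1.
rewrite (sum_grid (fun i j k => w1 i * w1 j * w1 k)).
under eq_bigr => i _ do under eq_bigr => j _ do rewrite -mulr_sumr sum_w1.
under eq_bigr => i _ do rewrite -mulr_suml -mulr_sumr sum_w1.
by rewrite -mulr_suml -mulr_suml sum_w1; ring.
Qed.

Definition lat (B : nat) (a : R) := exists2 k : int, a = k%:~R / n%:R & (`|k| <= B)%N.

Definition vlat B (u : V) := [/\ lat B u.1.1, lat B u.1.2 & lat B u.2].

Definition smallv (u : V) := [/\ `|u.1.1| < 1, `|u.1.2| < 1 & `|u.2| < 1].

Lemma lat_big B (a : R) : lat B a -> ~~ (`|a| < 1) -> exists k : int,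
  [/\ a = k%:~R / n%:R, (n <= `|k|)%N & (`|k| <= B)%N].
Proof.
move=> [k -> kB]; rewrite -leNgt normrM normfV normr_nat => h.
exists k; split => //; move: h; rewrite ler_pdivlMr ?ltr0n// mul1r.
by rewrite -intr_norm -abszE pmulrn ler_int lez_nat.
Qed.

(** A coordinate of modulus at least 1 is k/n with |k| at least n, outside the spectrum of [w1], so
    the sum over that coordinate alone vanishes. The bound [B + n <= M] excludes aliasing. *)
Lemma van_grid B u : vlat B u -> (B + n <= M)%N -> ~ smallv u -> van L gridW gridpt u.
Proof.
move=> [l1 l2 l3] BM nsm phi.
pose G (i j k : nat) : R := ang R L * dot u (i%:R / n%:R, j%:R / n%:R, k%:R / n%:R) + phi.
have -> : lam gridW (fun t => atom L u phi (gridpt t)) =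
  \sum_(i < M) \sum_(j < M) \sum_(k < M) w1 i * w1 j * w1 k * cos (G i j k).
  by rewrite -(sum_grid (fun i j k => w1 i * w1 j * w1 k * cos (G i j k))).
case: (boolP (`|u.1.1| < 1)) => [s1|/(lat_big l1)[k [e nk kB]]]; last first.
  rewrite exchange_big big1// => j _; rewrite exchange_big big1// => l _.
  under eq_bigr => i _ do rewrite -mulrA -mulrA mulrCA mulrC.
  transitivity ((w1 j * w1 l) * \sum_(i < M) w1 i *
    cos (i%:R * (k%:~R * ang R M) + (ang R L * (u.1.2 * (j%:R / n%:R) + u.2 * (l%:R / n%:R)) + phi))).
    rewrite mulr_sumr; apply: eq_bigr => i _.
    have -> : G i j l = i%:R * (k%:~R * ang R M) +
      (ang R L * (u.1.2 * (j%:R / n%:R) + u.2 * (l%:R / n%:R)) + phi).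
      by rewrite /G /dot /= e /ang MR; field; rewrite Ln0 nn0.
    by ring.
  by rewrite sum_w1_cos ?mulr0//; lia.
case: (boolP (`|u.1.2| < 1)) => [s2|/(lat_big l2)[k [e nk kB]]]; last first.
  rewrite big1// => i _; rewrite exchange_big big1// => l _.
  transitivity ((w1 i * w1 l) * \sum_(j < M) w1 j *
    cos (j%:R * (k%:~R * ang R M) + (ang R L * (u.1.1 * (i%:R / n%:R) + u.2 * (l%:R / n%:R)) + phi))).
    rewrite mulr_sumr; apply: eq_bigr => j _.
    have -> : G i j l = j%:R * (k%:~R * ang R M) +
      (ang R L * (u.1.1 * (i%:R / n%:R) + u.2 * (l%:R / n%:R)) + phi).
      by rewrite /G /dot /= e /ang MR; field; rewrite Ln0 nn0.
    by ring.
  by rewrite sum_w1_cos ?mulr0//; lia.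
case: (boolP (`|u.2| < 1)) => [s3|/(lat_big l3)[k [e nk kB]]]; first by case: nsm.
rewrite big1// => i _; rewrite big1// => j _.
transitivity ((w1 i * w1 j) * \sum_(l < M) w1 l *
    cos (l%:R * (k%:~R * ang R M) + (ang R L * (u.1.1 * (i%:R / n%:R) + u.1.2 * (j%:R / n%:R)) + phi))).
  rewrite mulr_sumr; apply: eq_bigr => l _.
  have -> : G i j l = l%:R * (k%:~R * ang R M) +
      (ang R L * (u.1.1 * (i%:R / n%:R) + u.1.2 * (j%:R / n%:R)) + phi).
    by rewrite /G /dot /= e /ang MR; field; rewrite Ln0 nn0.
  by ring.
by rewrite sum_w1_cos ?mulr0//; lia.
Qed.

Lemma latD B B' a b : lat B a -> lat B' b -> lat (B + B') (a + b).
Proof.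
by move=> [k -> kB] [l -> lB]; exists (k + l)%R; [rewrite intrD mulrDl | lia].
Qed.

Lemma latB B B' a b : lat B a -> lat B' b -> lat (B + B') (a - b).
Proof.
by move=> [k -> kB] [l -> lB]; exists (k - l)%R; [rewrite intrB mulrBl | lia].
Qed.

Lemma vlat_pm B B' (P P' : V -> Prop) : (forall u, P u -> vlat B u) -> (forall u, P' u -> vlat B' u) ->
  forall u, pm P P' u -> vlat (B + B') u.
Proof.
move=> h h' u [v [w [/h[v1 v2 v3] /h'[w1 w2 w3] [->|->]]]].
  by split; apply: latD.
by split; apply: latB.
Qed.

(* Lines at time [tm i] meet the plane in [prj i x]; the frequencies of functions of
   [prj i x] are the [freq i e1 e2], i.e. the quadratics
   [(z - s) (e1 z - e2)] with [s = tm i], up to the sign of the middle coefficient. *)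
Definition tm (i : nat) : R := i%:R / n%:R - S%:R.
Definition prj (i : nat) (x : V) : R * R := (x.1.1 + tm i * x.1.2, x.1.2 + tm i * x.2).
Definition freq (i : nat) (e1 e2 : int) : V :=
  (e1%:~R, e2%:~R + tm i * e1%:~R, tm i * e2%:~R).

Lemma dot_freq i e1 e2 x :
  dot (freq i e1 e2) x = e1%:~R * (prj i x).1 + e2%:~R * (prj i x).2.
Proof. by rewrite /dot /freq /prj /=; ring. Qed.

Lemma freqD i e1 e2 f1 f2 : freq i e1 e2 + freq i f1 f2 = freq i (e1 + f1) (e2 + f2).
Proof. by congr (_, _, _); rewrite /= !intrD; ring. Qed.

Lemma freqB i e1 e2 f1 f2 : freq i e1 e2 - freq i f1 f2 = freq i (e1 - f1) (e2 - f2).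
Proof. by congr (_, _, _); rewrite /= !intrB; ring. Qed.

Lemma tm_int i : tm i = (i%:Z - (S * n)%:Z)%:~R / n%:R.
Proof. by rewrite /tm intrB -!pmulrn natrM; field. Qed.

Lemma freq_vlat i e1 e2 : (i <= 2 * S * n)%N -> (`|e1| < n)%N -> (`|e2| < n)%N ->
  vlat ((S + 1) * n * n) (freq i e1 e2).
Proof.
move=> iS h1 h2; rewrite /freq tm_int; set z : int := (i%:Z - _)%R.
have zS : (`|z| <= S * n)%N by rewrite /z; lia.
clearbody z.
split => /=.
- by exists (e1 * n%:Z)%R; [rewrite intrM -!pmulrn; field | nia].
- exists (e2 * n%:Z + z * e1)%R; first by rewrite intrD !intrM -!pmulrn; field.
  have : (`|(z * e1)%R| <= S * n * n)%N by rewrite abszM leq_mul// ltnW.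
  have : (`|(e2 * n%:Z)%R| <= n * n)%N by rewrite abszM leq_mul// ltnW.
  lia.
- exists (z * e2)%R; first by rewrite !intrM; field.
  have : (`|(z * e2)%R| <= S * n * n)%N by rewrite abszM leq_mul// ltnW.
  lia.
Qed.

Lemma freq_small i e1 e2 : smallv (freq i e1 e2) -> e1 = 0 /\ e2 = 0.
Proof.
have H (e : int) : `|e%:~R : R| < 1 -> e = 0.
  by rewrite -intr_norm (_ : 1 = 1%:~R)// ltr_int; lia.
move=> [/H e10]; rewrite /= e10 mulr0 addr0 => /H e20 _.
by [].
Qed.

(** Period L, height 1, width of order L/n. Its frequencies are integers below n in modulus, so a
    product of bumps in the two coordinates of [prj i] has its spectrum among the [freq i e1 e2]. *)
Definition bump (y : R) : R := fej n (ang R L * y) / n%:R ^+ 2.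

Lemma bump_ge0 y : 0 <= bump y.
Proof. by rewrite divr_ge0 ?fej_ge0 ?sqr_ge0. Qed.

Lemma bumpE y : bump y = \sum_(a < n) \sum_(b < n)
  n%:R ^- 2 * cos ((a%:Z - b%:Z)%:~R * (ang R L * y)).
Proof.
rewrite /bump fejE mulrC mulr_sumr; apply: eq_bigr => a _.
by rewrite mulr_sumr.
Qed.

Lemma sum_bump y : \sum_(c < L * n) bump (y - c%:R / n%:R) = L%:R.
Proof.
rewrite -mulr_suml.
transitivity ((\sum_(c < L * n) fej n (c%:R * ang R (L * n) + - (ang R L * y))) / n%:R ^+ 2).
  congr (_ / _); apply: eq_bigr => c _.
  have fejN x : fej n (- x) = fej n x :> R.
    rewrite /fej; congr (_ ^+ 2 + _); first by apply: eq_bigr => a _; rewrite mulrN cosN.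
    under eq_bigr => a _ do rewrite mulrN sinN.
    by rewrite sumrN sqrrN.
  rewrite -fejN; congr fej; rewrite /ang natrM; field.
  by rewrite Ln0 nn0.
rewrite sum_fej; last by nia.
by rewrite natrM; field.
Qed.

Lemma bump_span1 i y0 : span L (fun u => exists2 e : int, u = freq i e 0 & (`|e| < n)%N)
  (fun x => bump ((prj i x).1 - y0)).
Proof.
apply: (@eq_span _ _ _ (fun x => \sum_(a < n) \sum_(b < n)
  n%:R ^- 2 * atom L (freq i (a%:Z - b%:Z) 0) (- ((a%:Z - b%:Z)%:~R * (ang R L * y0))) x)).
  move=> x; rewrite bumpE; apply: eq_bigr => a _; apply: eq_bigr => b _.
  by rewrite /atom dot_freq; congr (_ * cos _); ring.
apply: span_sum => a _; apply: span_sum => b _; apply: span_atom.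
exists (a%:Z - b%:Z)%R => //; have := ltn_ord a; have := ltn_ord b; lia.
Qed.

Lemma bump_span2 i y0 : span L (fun u => exists2 e : int, u = freq i 0 e & (`|e| < n)%N)
  (fun x => bump ((prj i x).2 - y0)).
Proof.
apply: (@eq_span _ _ _ (fun x => \sum_(a < n) \sum_(b < n)
  n%:R ^- 2 * atom L (freq i 0 (a%:Z - b%:Z)) (- ((a%:Z - b%:Z)%:~R * (ang R L * y0))) x)).
  move=> x; rewrite bumpE; apply: eq_bigr => a _; apply: eq_bigr => b _.
  by rewrite /atom dot_freq; congr (_ * cos _); ring.
apply: span_sum => a _; apply: span_sum => b _; apply: span_atom.
exists (a%:Z - b%:Z)%R => //; have := ltn_ord a; have := ltn_ord b; lia.
Qed.

Lemma prjD i x w : prj i (x + w) = prj i x + prj i w.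
Proof. by congr (_, _); rewrite /=; ring. Qed.

(** By [freq_small] zero is the only small frequency at a fixed time, so only the constant term
    n^(-2) of the product survives, for every translation. *)
Lemma lam_bump2 i y1 y2 w : (i <= 2 * S * n)%N ->
  lam gridW (fun t => bump ((prj i (gridpt t + w)).1 - y1) * bump ((prj i (gridpt t + w)).2 - y2)) =
  lam gridW (fun=> 1) / n%:R ^+ 2.
Proof.
move=> iS.
pose th1 := ang R L * ((prj i w).1 - y1); pose th2 := ang R L * ((prj i w).2 - y2).
pose F (e1 e2 : int) t := cos (e1%:~R * (ang R L * (prj i (gridpt t)).1 + th1)) *
  cos (e2%:~R * (ang R L * (prj i (gridpt t)).2 + th2)).
have lamF (e1 e2 : int) : (`|e1| < n)%N -> (`|e2| < n)%N ->
  lam gridW (F e1 e2) = (e1 == 0)%:R * (e2 == 0)%:R * lam gridW (fun=> 1).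
  move=> h1 h2; case: (boolP ((e1 == 0) && (e2 == 0))) => [/andP[/eqP -> /eqP ->]|ne].
    by rewrite !mul1r; apply: eq_lam => t; rewrite /F !mul0r cos0 mulr1.
  rewrite -natrM mulnb (negbTE ne) mul0r.
  transitivity (lam gridW (fun t => 2^-1 * atom L (freq i e1 e2) (e1%:~R * th1 + e2%:~R * th2) (gridpt t)
     + 2^-1 * atom L (freq i e1 (- e2)) (e1%:~R * th1 - e2%:~R * th2) (gridpt t))).
    apply: eq_lam => t; rewrite /F cosM2 /atom !dot_freq mulrDr mulrNz.
    by congr (_ * cos _ + _ * cos _); ring.
  have BM : ((S + 1) * n * n + n <= M)%N by rewrite /M; nia.
  rewrite lamD !lamZ (van_grid (freq_vlat iS h1 h2) BM); last first.
    by move=> /freq_small[e10 e20]; move: ne; rewrite e10 e20.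
  rewrite (van_grid (freq_vlat iS h1 (_ : (`|- e2| < n)%N)) BM) ?mulr0 ?addr0//; first lia.
  by move=> /freq_small[e10 /eqP]; rewrite oppr_eq0 => /eqP e20; move: ne; rewrite e10 e20.
transitivity (\sum_(a < n) \sum_(b < n) \sum_(c < n) \sum_(d < n)
   n%:R ^- 4 * lam gridW (F (a%:Z - b%:Z)%R (c%:Z - d%:Z)%R)).
  under eq_bigr => a _ do under eq_bigr => b _ do under eq_bigr => c _ do
    under eq_bigr => d _ do rewrite -lamZ.
  under eq_bigr => a _ do under eq_bigr => b _ do under eq_bigr => c _ do rewrite -lam_sum.
  under eq_bigr => a _ do under eq_bigr => b _ do rewrite -lam_sum.
  under eq_bigr => a _ do rewrite -lam_sum.
  rewrite -lam_sum; apply: eq_lam => t; rewrite !bumpE.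
  rewrite mulr_suml; apply: eq_bigr => a _; rewrite mulr_suml; apply: eq_bigr => b _.
  rewrite mulr_sumr; apply: eq_bigr => c _; rewrite mulr_sumr; apply: eq_bigr => d _.
  rewrite /F prjD /th1 /th2 mulrACA; congr (_ * (cos _ * cos _)); try by rewrite /=; ring.
  by field.
transitivity (\sum_(a < n) \sum_(b < n) (((a%:Z - b%:Z)%R == 0)%:R *
   \sum_(c < n) \sum_(d < n) n%:R ^- 4 * ((((c%:Z - d%:Z)%R == 0)%:R) * lam gridW (fun=> 1)))).
  apply: eq_bigr => a _; apply: eq_bigr => b _.
  rewrite mulr_sumr; apply: eq_bigr => c _; rewrite mulr_sumr; apply: eq_bigr => d _.
  have := ltn_ord a; have := ltn_ord b; have := ltn_ord c; have := ltn_ord d => *.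
  rewrite lamF; [|lia|lia]; ring.
have cnt : \sum_(a < n) \sum_(b < n) (((a%:Z - b%:Z)%R == 0)%:R : R) = n%:R.
  under eq_bigr => a _ do rewrite -natr_sum.
  by rewrite -natr_sum (count_diff n 0) subn0.
under eq_bigr => a _ do rewrite -mulr_suml.
rewrite -mulr_suml cnt.
under eq_bigr => c _ do rewrite -mulr_sumr -mulr_suml.
rewrite -mulr_sumr -mulr_suml cnt; field.
by [].
Qed.

Variable K : nat -> nat -> nat -> bool.

(** The factor [i <= 2 * S * n] extends the family by zero, which allows the number of times to be
    rounded up to a power of m. *)
Definition fs (i : nat) (x : V) : R :=
  (i <= 2 * S * n)%:R * \sum_(c1 < L * n) \sum_(c2 < L * n) (K i c1 c2)%:R *
    (bump ((prj i x).1 - c1%:R / n%:R) * bump ((prj i x).2 - c2%:R / n%:R)).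

Definition Kcount (i : nat) : nat :=
  ((i <= 2 * S * n) * \sum_(c1 < L * n) \sum_(c2 < L * n) K i c1 c2)%N.

Lemma fs_ge0 i x : 0 <= fs i x.
Proof.
apply: mulr_ge0 => //; apply: sumr_ge0 => c1 _; apply: sumr_ge0 => c2 _.
by apply: mulr_ge0 => //; apply: mulr_ge0; exact: bump_ge0.
Qed.

Lemma fs_le i x : fs i x <= L%:R ^+ 2.
Proof.
rewrite expr2 -{1}(sum_bump (prj i x).1) -(sum_bump (prj i x).2) big_distrlr/=.
have H : 0 <= \sum_(c1 < L * n) \sum_(c2 < L * n)
   bump ((prj i x).1 - c1%:R / n%:R) * bump ((prj i x).2 - c2%:R / n%:R).
  by apply: sumr_ge0 => ? _; apply: sumr_ge0 => ? _; rewrite mulr_ge0 ?bump_ge0.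
rewrite /fs; case: (_ <= _)%N; last by rewrite mul0r.
rewrite mul1r; apply: ler_sum => c1 _; apply: ler_sum => c2 _.
by case: (K _ _ _); rewrite ?mul1r// mul0r mulr_ge0 ?bump_ge0.
Qed.

Lemma lam_fs i w : lam gridW (fun t => fs i (gridpt t + w)) =
  (Kcount i)%:R * (lam gridW (fun=> 1) / n%:R ^+ 2).
Proof.
rewrite /fs /Kcount lamZ; case: (leqP i (2 * S * n)) => iS; last by rewrite mul0n !mul0r.
rewrite mul1r mul1n lam_sum natr_sum mulr_suml; apply: eq_bigr => c1 _.
rewrite lam_sum natr_sum mulr_suml; apply: eq_bigr => c2 _.
by rewrite lamZ lam_bump2.
Qed.

Definition fs_freq (i : nat) (u : V) := (i <= 2 * S * n)%N /\
  exists e1 e2 : int, [/\ u = freq i e1 e2, (`|e1| < n)%N & (`|e2| < n)%N].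

Lemma fs_span i : span L (fs_freq i) (fs i).
Proof.
rewrite /fs; case: (leqP i (2 * S * n)) => iS; last first.
  by apply: eq_span (span_nil _ _) => x; rewrite mul0r.
apply: spanZ; apply: span_sum => c1 _; apply: span_sum => c2 _; apply: spanZ.
apply: sub_span (spanM (bump_span1 i (c1%:R / n%:R)) (bump_span2 i (c2%:R / n%:R))).
move=> u [v [w [[e1 -> h1] [e2 -> h2] [->|->]]]]; split => //.
  by exists e1, e2; rewrite freqD addr0 add0r.
by exists e1, (- e2)%R; rewrite freqB subr0 sub0r abszN.
Qed.

Lemma fs_good i a : (Kcount i)%:R * (lam gridW (fun=> 1) / n%:R ^+ 2) <= a ->
  good gridW gridpt (L%:R ^+ 2) a 1 (fs i).
Proof.
move=> ha; split=> [x|w]; first by rewrite mul1r ger0_norm ?fs_ge0 ?fs_le.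
rewrite mul1r; apply: le_trans ha; rewrite -(lam_fs i w).
by rewrite le_eqVlt; apply/orP; left; apply/eqP/eq_lam => t; rewrite ger0_norm ?fs_ge0.
Qed.

End Grid.

(** * Quadruples of frequencies *)

(** The vertex of the parabola h (z - s)^2 - b (z - s), seen from t0. With v the vertex, the
    coefficients are h (1, 2v, v^2) up to the defect b^2/(4h) in the last one, so for small b the
    vertices govern everything. *)
Definition mid (R : realType) (t0 s h b : R) := s + b / (2 * h) - t0.
Definition okfreq (R : realType) (A D w X t0 s h b : R) :=
  [/\ A <= h <= A + D, `|b| <= 2 * A * w & `|mid t0 s h b| <= X].
Definition small3 (R : realType) (x y z : R) := [/\ `|x| < 1, `|y| < 1 & `|z| < 1].

Lemma norm_sum4 (R : realType) (x1 x2 x3 x4 c : R) : `|x1| <= c -> `|x2| <= c -> `|x3| <= c -> `|x4| <= c ->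
  `|x1 + x2 - x3 - x4| <= 4 * c.
Proof. by rewrite !ler_norml => /andP[? ?] /andP[? ?] /andP[? ?] /andP[? ?]; lra. Qed.

Lemma normM_le (R : realType) (a b c d : R) : `|a| <= c -> `|b| <= d -> `|a * b| <= c * d.
Proof. by move=> h1 h2; rewrite normrM ler_pM. Qed.

Lemma norm_le_ge0 (R : realType) (a c : R) : 0 <= a -> a <= c -> `|a| <= c.
Proof. by move=> a0 ac; rewrite ger0_norm. Qed.

(* If two pairs of numbers have almost the same sum and the same sum of squares, they almost
   coincide: [2 (m1 - m3) (m1 - m4) = E2 - E1 (m2 + m3 + m4 - m1)]. *)
Lemma two_two (R : realType) (A D w X k t0 s1 h1 b1 s2 h2 b2 s3 h3 b3 s4 h4 b4 : R) :
  1 <= A -> 0 <= D -> D <= A -> 0 < w -> 0 <= X -> 1 <= k ->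
  `|t0| <= k - 1 -> k ^+ 2 <= A * w ^+ 2 -> D * X ^+ 2 <= 3 * A * w ^+ 2 ->
  D * X <= 3 * A * w -> X <= 4 * k -> w <= 2 * k ->
  okfreq A D w X t0 s1 h1 b1 -> okfreq A D w X t0 s2 h2 b2 -> okfreq A D w X t0 s3 h3 b3 -> okfreq A D w X t0 s4 h4 b4 ->
  small3 (h1 + h2 - h3 - h4)
   ((2 * s1 * h1 + b1) + (2 * s2 * h2 + b2) - (2 * s3 * h3 + b3) - (2 * s4 * h4 + b4))
   ((s1 ^+ 2 * h1 + s1 * b1) + (s2 ^+ 2 * h2 + s2 * b2) - (s3 ^+ 2 * h3 + s3 * b3)
     - (s4 ^+ 2 * h4 + s4 * b4)) ->
  let m1 := mid t0 s1 h1 b1 in let m2 := mid t0 s2 h2 b2 in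
  let m3 := mid t0 s3 h3 b3 in let m4 := mid t0 s4 h4 b4 in
  `|m1 - m3| <= 21 * w /\ `|m2 - m4| <= 21 * w \/ `|m1 - m4| <= 21 * w /\ `|m2 - m3| <= 21 * w.
Proof.
move=> A1 D0 DA w0 X0 k1 ht0 hk hD2 hD1 hX hw.
move=> o1 o2 o3 o4 [S1 S2 S3] m1 m2 m3 m4.
have A0 : 0 < A by lra.
(* The defect left by completing the square; [|b| <= 2 * A * w] and [A <= h] keep it below A w^2. *)
pose be h b : R := b ^+ 2 / (4 * h).
have exp1 s h b : okfreq A D w X t0 s h b -> let m := mid t0 s h b in
  [/\ 2 * s * h + b = 2 * (h * m) + 2 * t0 * h,
      s ^+ 2 * h + s * b = h * m ^+ 2 + 2 * t0 * (h * m) + t0 ^+ 2 * h - be h b,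
      0 <= be h b <= A * w ^+ 2 & `|m| <= X /\ 0 <= h - A <= D].
  move=> [/andP[Ah hA] bB mX] m; have h0 : h != 0 by apply/eqP => h0; lra.
  have h00 : 0 < h by lra.
  split; [by rewrite /m /mid; field|by rewrite /m /mid /be; field| |by split; [|apply/andP; split; lra]].
  have bsq : b ^+ 2 <= (2 * A * w) ^+ 2.
    by rewrite -(@real_normK _ b) ?num_real// lerXn2r ?nnegrE// !mulr_ge0// ?ltW//; lra.
  apply/andP; split; first by rewrite /be divr_ge0 ?sqr_ge0//; lra.
  rewrite /be.
  rewrite ler_pdivrMr; last by lra.
  apply: le_trans bsq _; rewrite (_ : (2 * A * w) ^+ 2 = A * w ^+ 2 * (4 * A)); last by ring.
  by rewrite ler_wpM2l ?mulr_ge0 ?sqr_ge0//; lra.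
have [c1 q1 /andP[be1 be1'] [x1 /andP[d1 d1']]] := exp1 _ _ _ o1.
have [c2 q2 /andP[be2 be2'] [x2 /andP[d2 d2']]] := exp1 _ _ _ o2.
have [c3 q3 /andP[be3 be3'] [x3 /andP[d3 d3']]] := exp1 _ _ _ o3.
have [c4 q4 /andP[be4 be4'] [x4 /andP[d4 d4']]] := exp1 _ _ _ o4.
rewrite -/m1 -/m2 -/m3 -/m4 in c1 c2 c3 c4 q1 q2 q3 q4 x1 x2 x3 x4 *.
pose E1 := m1 + m2 - m3 - m4; pose E2 := m1 ^+ 2 + m2 ^+ 2 - m3 ^+ 2 - m4 ^+ 2.
pose P1 := h1 * m1 + h2 * m2 - h3 * m3 - h4 * m4.
pose P2 := h1 * m1 ^+ 2 + h2 * m2 ^+ 2 - h3 * m3 ^+ 2 - h4 * m4 ^+ 2.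
pose H := h1 + h2 - h3 - h4.
have tH : `|t0 * H| <= k - 1.
  by rewrite -[leRHS]mulr1; apply: normM_le => //; exact: ltW.
have P1b : `|P1| <= k.
  have e : 2 * P1 = (2 * s1 * h1 + b1) + (2 * s2 * h2 + b2) - (2 * s3 * h3 + b3)
     - (2 * s4 * h4 + b4) - 2 * (t0 * H) by rewrite c1 c2 c3 c4 /P1 /H; ring.
  move: S2 tH e; move: (t0 * H) P1 (_ - (2 * s4 * h4 + b4)); clear => tH P1 z.
  rewrite ltr_norml !ler_norml => /andP[? ?] /andP[? ?]; lra.
have Aw0 : 0 < A * w ^+ 2 by rewrite mulr_gt0 ?exprn_gt0.
have t0k : `|t0| <= k by apply: le_trans ht0 _; rewrite gerBl ler01.
have k0 : 0 < k by apply: lt_le_trans k1; exact: ltr01.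
have k21 : 1 <= k ^+ 2 by rewrite expr_ge1// ltW.
have tP : `|t0 * P1| <= k ^+ 2 by rewrite expr2; apply: normM_le.
have ttH : `|t0 * (t0 * H)| <= k ^+ 2.
  by rewrite expr2; apply: normM_le => //; apply: le_trans tH _; rewrite gerBl ler01.
have bb : `|be h1 b1 + be h2 b2 - be h3 b3 - be h4 b4| <= 4 * (A * w ^+ 2).
  by apply: norm_sum4; exact: norm_le_ge0.
have P2b : `|P2| <= 22 * (A * w ^+ 2).
  have e : P2 = ((s1 ^+ 2 * h1 + s1 * b1) + (s2 ^+ 2 * h2 + s2 * b2) - (s3 ^+ 2 * h3 + s3 * b3)
     - (s4 ^+ 2 * h4 + s4 * b4)) + (be h1 b1 + be h2 b2 - be h3 b3 - be h4 b4)
     - 2 * (t0 * P1) - t0 * (t0 * H) by rewrite q1 q2 q3 q4 /P2 /H /P1; ring.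
  rewrite e; move: S3 tP ttH bb k21 hk.
  move: (t0 * P1) (t0 * (t0 * H)) (_ - (s4 ^+ 2 * h4 + s4 * b4)) (_ - be h4 b4) (k ^+ 2) (A * w ^+ 2).
  clear => x y z u v t; rewrite ltr_norml !ler_norml => /andP[? ?] /andP[? ?] /andP[? ?] /andP[? ?]; lra.
(* Replacing all four weights h by A leaves errors of order D X and D X^2, which the thinness of the
   band makes at most of order A w and A w^2. *)
have dm : `|(h1 - A) * m1 + (h2 - A) * m2 - (h3 - A) * m3 - (h4 - A) * m4| <= 4 * (D * X).
  by apply: norm_sum4; apply: normM_le => //; exact: norm_le_ge0.
have sqX x : `|x| <= X -> `|x ^+ 2| <= X ^+ 2 by move=> xX; rewrite normrX lerXn2r ?nnegrE.
have dm2 : `|(h1 - A) * m1 ^+ 2 + (h2 - A) * m2 ^+ 2 - (h3 - A) * m3 ^+ 2 - (h4 - A) * m4 ^+ 2|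
   <= 4 * (D * X ^+ 2).
  by apply: norm_sum4; apply: normM_le; try exact: sqX; exact: norm_le_ge0.
have AE1 : `|A * E1| <= k + 4 * (D * X).
  have e : A * E1 = P1 - ((h1 - A) * m1 + (h2 - A) * m2 - (h3 - A) * m3 - (h4 - A) * m4).
    by rewrite /E1 /P1; ring.
  by rewrite e; apply: le_trans (ler_normB _ _) _; apply: lerD.
have AE2 : `|A * E2| <= 34 * (A * w ^+ 2).
  have e : A * E2 = P2 - ((h1 - A) * m1 ^+ 2 + (h2 - A) * m2 ^+ 2 - (h3 - A) * m3 ^+ 2 - (h4 - A) * m4 ^+ 2).
    by rewrite /E2 /P2; ring.
  rewrite e; apply: le_trans (ler_normB _ _) _; apply: le_trans (lerD P2b dm2) _.
  by move: hD2; rewrite -mulrA; move: (D * X ^+ 2) (A * w ^+ 2); clear => x y; lra.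
have kAw : k <= 2 * A * w.
  rewrite -(ler_pM2l k0); apply: (@le_trans _ _ (A * w * w)).
    by move: hk; rewrite !expr2 mulrA.
  have -> : k * (2 * A * w) = A * w * (2 * k) by ring.
  by apply: ler_wpM2l => //; apply/ltW/mulr_gt0.
have E1w : `|E1| <= 14 * w.
  have : A * `|E1| <= A * (14 * w).
    rewrite -{1}(gtr0_norm A0) -normrM; apply: le_trans AE1 _.
    have -> : A * (14 * w) = 14 * (A * w) by ring.
    by move: kAw hD1; rewrite -!mulrA; move: (D * X) (A * w); clear => x y *; lra.
  by rewrite ler_pM2l.
have mX : `|m2 + m3 + m4 - m1| <= 4 * X.
  have -> : m2 + m3 + m4 - m1 = m2 + m3 - (- m4) - m1 by ring.
  by apply: norm_sum4; rewrite ?normrN.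
have kX : k * X <= 4 * (A * w ^+ 2).
  apply: le_trans (ler_wpM2l (ltW k0) hX) _.
  have -> : k * (4 * k) = 4 * k ^+ 2 by ring.
  by move: hk; move: (k ^+ 2) (A * w ^+ 2); clear => x y *; lra.
have key : `|(m1 - m3) * (m1 - m4)| <= 7 * w * (7 * w).
  have : 2 * A * `|(m1 - m3) * (m1 - m4)| <= 2 * A * (7 * w * (7 * w)).
    have A20 : 0 < 2 * A by rewrite mulr_gt0.
    rewrite -{1}(gtr0_norm A20) -normrM.
    have -> : 2 * A * ((m1 - m3) * (m1 - m4)) = A * E2 - A * E1 * (m2 + m3 + m4 - m1).
      by rewrite /E1 /E2; ring.
    apply: le_trans (ler_normB _ _) _; have e1 := normM_le AE1 mX.
    apply: le_trans (lerD AE2 e1) _.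
    have -> : 2 * A * (7 * w * (7 * w)) = 98 * (A * w ^+ 2) by ring.
    have -> : (k + 4 * (D * X)) * (4 * X) = 4 * (k * X) + 16 * (D * X ^+ 2) by ring.
    move: hD2 kX; rewrite -mulrA; move: (D * X ^+ 2) (k * X) (A * w ^+ 2); clear => *; lra.
  by rewrite ler_pM2l// mulr_gt0.
(* By [key] one of the two factors is at most 7w; as m1 + m2 - m3 - m4 is at most 14w in modulus,
   the other two vertices are then within 21w. *)
have fin (a b c d : R) : `|a - c| <= 7 * w -> `|a + b - c - d| <= 14 * w ->
  `|a - c| <= 21 * w /\ `|b - d| <= 21 * w.
  move=> u1 u2; split.
    by apply: le_trans u1 _; apply: ler_wpM2r; [exact: ltW|rewrite ler_nat].
  have -> : b - d = (a + b - c - d) - (a - c) by ring.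
  apply: le_trans (ler_normB _ _) _; apply: le_trans (lerD u2 u1) _.
  by rewrite -mulrDl -natrD.
have [c|c] := leP `|m1 - m3| (7 * w); first by left; exact: fin c E1w.
have c' : `|m1 - m4| <= 7 * w.
  rewrite leNgt; apply/negP => c'; move: key; rewrite normrM leNgt => /negP; apply.
  by apply: ltr_pM => //; apply/mulr_ge0/ltW.
right; apply: fin c' _; rewrite (_ : m1 + m2 - m4 - m3 = E1)//.
by rewrite /E1; ring.
Qed.

Definition flip (R : realType) (e : bool) (x : R) := if e then x else - x.

Definition close (R : realType) (w a b : R) := `|a - b| <= 21 * w.

(** The leading coefficients lie in [A, 2A] with A at least 1, so a signed sum of four of them can
    be below 1 in modulus only with two signs of each kind. Each such choice is an instance of
    [two_two]. *)
Lemma four_signs (R : realType) (A D w X k t0 : R) (e1 e2 e3 e4 : bool)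
  (s1 h1 b1 s2 h2 b2 s3 h3 b3 s4 h4 b4 : R) :
  1 <= A -> 0 <= D -> D <= A -> 0 < w -> 0 <= X -> 1 <= k ->
  `|t0| <= k - 1 -> k ^+ 2 <= A * w ^+ 2 -> D * X ^+ 2 <= 3 * A * w ^+ 2 ->
  D * X <= 3 * A * w -> X <= 4 * k -> w <= 2 * k ->
  okfreq A D w X t0 s1 h1 b1 -> okfreq A D w X t0 s2 h2 b2 -> okfreq A D w X t0 s3 h3 b3 -> okfreq A D w X t0 s4 h4 b4 ->
  small3 (flip e1 h1 + flip e2 h2 + flip e3 h3 + flip e4 h4)
   (flip e1 (2 * s1 * h1 + b1) + flip e2 (2 * s2 * h2 + b2) + flip e3 (2 * s3 * h3 + b3)
     + flip e4 (2 * s4 * h4 + b4))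
   (flip e1 (s1 ^+ 2 * h1 + s1 * b1) + flip e2 (s2 ^+ 2 * h2 + s2 * b2) + flip e3 (s3 ^+ 2 * h3 + s3 * b3)
     + flip e4 (s4 ^+ 2 * h4 + s4 * b4)) ->
  let m1 := mid t0 s1 h1 b1 in let m2 := mid t0 s2 h2 b2 in
  let m3 := mid t0 s3 h3 b3 in let m4 := mid t0 s4 h4 b4 in
  [\/ close w m1 m2 /\ close w m3 m4, close w m1 m3 /\ close w m2 m4 | close w m1 m4 /\ close w m2 m3].
Proof.
move=> A1 D0 DA w0 X0 k1 ht0 hk hD2 hD1 hX hw.
move=> o1 o2 o3 o4 sm m1 m2 m3 m4.
have closeC a b : close w a b -> close w b a by rewrite /close distrC.
have neg (x y z : R) : small3 x y z -> small3 (- x) (- y) (- z) by move=> [? ? ?]; split; rewrite normrN.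
have eqs (x y z x' y' z' : R) : x = x' -> y = y' -> z = z' -> small3 x y z -> small3 x' y' z'.
  by move=> -> -> ->.
wlog e1T : e1 e2 e3 e4 sm / e1 = true => [H|].
  case: e1 sm => sm; first exact: (H true e2 e3 e4).
  apply: (H true (~~ e2) (~~ e3) (~~ e4)) => //.
  apply: eqs (neg _ _ _ sm); rewrite /flip; case: (e2); case: (e3); case: (e4) => /=; ring.
move: sm; rewrite e1T /= {e1 e1T}.
have [H1 _ _] := o1; have [H2 _ _] := o2; have [H3 _ _] := o3; have [H4 _ _] := o4.
case: e2; case: e3; case: e4 => /= sm;
  try (exfalso; case: sm => sm _ _; move: A1 D0 DA H1 H2 H3 H4 sm; clear;
    rewrite ltr_norml => ? ? ? /andP[? ?] /andP[? ?] /andP[? ?] /andP[? ?] /andP[? ?]; lra).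
- have [[? ?]|[? ?]] := two_two A1 D0 DA w0 X0 k1 ht0 hk hD2 hD1 hX hw o1 o2 o3 o4 sm; [apply: Or32|apply: Or33]; split=> //.
- have [|[? ?]|[? ?]] := two_two A1 D0 DA w0 X0 k1 ht0 hk hD2 hD1 hX hw o1 o3 o2 o4.
    by apply: eqs sm; ring.
  + by apply: Or31.
  + by apply: Or33; split=> //; exact: closeC.
- have [|[? ?]|[? ?]] := two_two A1 D0 DA w0 X0 k1 ht0 hk hD2 hD1 hX hw o1 o4 o2 o3.
    by apply: eqs sm; ring.
  + by apply: Or31; split=> //; exact: closeC.
  + by apply: Or32; split=> //; exact: closeC.
Qed.

Section PieceFreq.
Variables (R : realType) (L n S : nat).
Hypotheses (L0 : (0 < L)%N) (n0 : (0 < n)%N) (LS : (4 * S + 8 <= L)%N).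
Notation V := (R * R * R)%type.
Notation tmn := (@tm R n S).
Notation lamg := (lam (@gridW R L n)).
Notation gp := (@gridpt R L n).

(* As a quadratic, [freq i e1 e2] is [h (z - s)^2 - b (z - s)] with [h = e1], [b = e2 - s e1] and
   [s = tm i]; [h] and [b] are confined to bands. *)
Definition pfreq (A A' B0 B' : R) (i : nat) (u : V) := (i <= 2 * S * n)%N /\
  exists e1 e2 : int, [/\ u = @freq R n S i e1 e2, (`|e1| < n)%N /\ (`|e2| < n)%N,
    A <= `|e1%:~R : R| <= A' & B0 <= `|e2%:~R - tmn i * e1%:~R| <= B'].

Lemma pfreq_vlat A A' B0 B' i u : pfreq A A' B0 B' i u -> vlat n ((S + 1) * n * n) u.
Proof. by move=> [iS [e1 [e2 [-> [h1 h2] _ _]]]]; exact: (freq_vlat _ L0 n0 LS). Qed.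

Lemma pfreq_tri A A' B0 B' i u : pfreq A A' B0 B' i u -> exists (e : bool) (h b : R),
  [/\ A <= h <= A', B0 <= `|b| <= B' & [/\ u.1.1 = flip e h, u.1.2 = flip e (2 * tmn i * h + b)
    & u.2 = flip e (tmn i ^+ 2 * h + tmn i * b)]].
Proof.
move=> [iS [e1 [e2 [-> _ hA hB]]]].
case: (lerP 0 (e1%:~R : R)) => e10.
  exists true, e1%:~R, (e2%:~R - tmn i * e1%:~R); split => //; first by rewrite ger0_norm in hA.
  by split => /=; ring.
exists false, (- e1%:~R), (- (e2%:~R - tmn i * e1%:~R)); split => //.
- by rewrite ltr0_norm in hA.
- by rewrite normrN.
- by split => /=; ring.
Qed.

Lemma flipN e (x : R) : flip (~~ e) x = - flip e x.
Proof. by case: e; rewrite /= ?opprK. Qed.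

Lemma tm_abs i : (i <= 2 * S * n)%N -> `|tmn i| <= S%:R.
Proof.
move=> iS; have nR : (0 : R) < n%:R by rewrite ltr0n.
have h1 : (0 : R) <= i%:R / n%:R by rewrite divr_ge0.
have h2 : (i%:R / n%:R : R) <= 2 * S%:R by rewrite ler_pdivrMr// -!natrM ler_nat.
move: h1 h2; rewrite /tm ler_norml; move: (i%:R / n%:R) (S%:R) => x y *.
apply/andP; split; lra.
Qed.

Lemma tm_diff i j : tmn i - tmn j = (i%:R - j%:R) / n%:R.
Proof. by rewrite /tm; ring. Qed.

Lemma freq_room : ((S + 1) * n * n + (S + 1) * n * n + (S + 1) * n * n + (S + 1) * n * n + n
  <= L * n * n)%N.
Proof. nia. Qed.

(* Children of a block of [m ^ k.+1] consecutive times have length [w = m ^ k / n]. *)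
Lemma step_bound (A A' B0 B' : R) (m k a : nat) (g : nat -> V -> R) :
  let w : R := m%:R ^+ k / n%:R in
  (forall i, span L (pfreq A A' B0 B' i) (g i)) ->
  1 <= A -> A <= A' -> A' - A <= A -> (A' - A) * (m%:R + 1) ^+ 2 <= 3 * A ->
  B' <= 2 * A * w -> (S%:R + 1) ^+ 2 <= A * w ^+ 2 -> w <= 2 * (S%:R + 1) -> (0 < m)%N ->
  lamg (fun t => blk m (fun i t => g i (gp t)) a k.+1 t ^+ 4) <=
  (3 * 49 ^ 2)%:R * m%:R *
    \sum_(c < m) lamg (fun t => blk m (fun i t => g i (gp t)) (a + c * m ^ k) k t ^+ 4).
Proof.
move=> w sg A1 AA' DA Dm BA SA wS m0; pose f i t := g i (gp t); rewrite -/f.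
have w0 : 0 < w by rewrite divr_gt0 ?exprn_gt0 ?ltr0n.
pose F c t := blk m f (a + c * m ^ k) k t.
have -> : lamg (fun t => blk m f a k.+1 t ^+ 4) = lamg (fun t => (\sum_(c < m) F c t) ^+ 4).
  by apply: eq_lam => t; rewrite -(add1n k) blkM expn1.
(* 24 = 3/2 + 21 + 3/2 in units of w: a vertex is within 3w/2 of the middle of its child, and paired
   vertices are within 21w. *)
apply: (@quad_step _ _ _ (@gridW_ge0 R L n) 24 m F) => c1 c2 c3 c4 hc1 hc2 hc3 hc4 nadm.
pose P c u := exists2 i', (i' < m ^ k)%N & pfreq A A' B0 B' (a + c * m ^ k + i') u.
pose FV c x := \sum_(i < m ^ k) g (a + c * m ^ k + i)%N x.
have sP c : span L (P c) (FV c).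
  apply: span_sum => i _; apply: sub_span (sg (a + c * m ^ k + i)%N) => u hu.
  by exists i.
have sPP := spanM (spanM (spanM (sP c1) (sP c2)) (sP c3)) (sP c4).
have vP c u : P c u -> vlat n ((S + 1) * n * n) u by move=> [i' _ /pfreq_vlat].
apply: (lam_span0 sPP) => u hu.
have pmv := @vlat_pm R L n S L0 n0 LS.
have vl := pmv _ _ _ _ (pmv _ _ _ _ (pmv _ _ _ _ (vP c1) (vP c2)) (vP c3)) (vP c4) _ hu.
apply: (van_grid L0 n0 LS vl) => //; first exact: freq_room.
move: hu => [u123 [u4 [[u12 [u3 [[u1 [u2 [P1 P2 e12]]] P3 e123]]] P4 e1234]]].
(* The first bound, the length of the parent block plus w, keeps the error D X^2 below 3 A w^2; the
   second keeps X comparable to the range of times. *)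
pose X : R := Num.min ((m%:R + 1) * w) (4 * (S%:R + 1)).
pose t0 := tmn a.
have ok c v : (c < m)%N -> P c v -> exists (e : bool) (s h b : R),
  [/\ okfreq A (A' - A) w X t0 s h b, `|mid t0 s h b - c%:R * w| <= 2 * w,
    `|mid t0 s h b - c%:R * w - w / 2| <= 3 / 2 * w,
    `|t0| <= S%:R & [/\ v.1.1 = flip e h, v.1.2 = flip e (2 * s * h + b)
    & v.2 = flip e (s ^+ 2 * h + s * b)]].
  move=> cm [i' i'm pf]; have [iS _] := pf.
  have [e [h [b [hh /andP[_ hb] hv]]]] := pfreq_tri pf.
  exists e, (tmn (a + c * m ^ k + i')), h, b.
  have sE : tmn (a + c * m ^ k + i') - t0 = c%:R * w + i'%:R / n%:R.
    by rewrite /t0 tm_diff /w !natrD natrM natrX; ring.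
  have mE : mid t0 (tmn (a + c * m ^ k + i')) h b = c%:R * w + i'%:R / n%:R + b / (2 * h).
    by rewrite /mid addrAC sE.
  have iw : 0 <= (i'%:R / n%:R : R) <= w.
    apply/andP; split; first exact: divr_ge0.
    by rewrite /w ler_wpM2r ?invr_ge0// -natrX ler_nat; exact: ltnW.
  have h0 : 0 < h by move/andP: hh => [? _]; lra.
  have bw : `|b / (2 * h)| <= w.
    rewrite normrM normfV (gtr0_norm (_ : 0 < 2 * h)) ?mulr_gt0//.
    rewrite ler_pdivrMr ?mulr_gt0//; apply: le_trans hb _; apply: le_trans BA _.
    rewrite (_ : w * (2 * h) = 2 * h * w); last by ring.
    by apply: (ler_wpM2r (ltW w0)); apply: ler_wpM2l => //; case/andP: hh.
  have aS : (a <= 2 * S * n)%N by apply: leq_trans iS; rewrite -addnA leq_addr.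
  have t0S : `|t0| <= S%:R := tm_abs aS.
  have sS := tm_abs iS.
  have cw : 0 <= (c%:R * w : R) <= (m%:R - 1) * w.
    apply/andP; split; first by apply: mulr_ge0 => //; exact: ltW.
    by apply: (ler_wpM2r (ltW w0)); rewrite lerBrDr natr1 ler_nat.
  clearbody t0; split => //.
  - split=> //; first by move: hh; clear; move=> /andP[? ?]; apply/andP; split; lra.
      exact: le_trans hb BA.
    rewrite le_min; apply/andP; split.
      rewrite mE; move: cw iw bw w0; move: (c%:R * w) (i'%:R / n%:R) (b / (2 * h)) (m%:R : R).
      clear => x y z v.
      by rewrite !ler_norml => /andP[? ?] /andP[? ?] /andP[? ?] ?; apply/andP; split; lra.
    rewrite /mid -/t0; move: bw sS t0S wS.
    move: (b / (2 * h)) (tmn (a + c * m ^ k + i')) (t0) (S%:R); clear => x y z v.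
    by rewrite !ler_norml => /andP[? ?] /andP[? ?] /andP[? ?] ?; apply/andP; split; lra.
  - rewrite mE; move: iw bw; move: (c%:R * w) (i'%:R / n%:R) (b / (2 * h)); clear => x y z.
    by rewrite !ler_norml => /andP[? ?] /andP[? ?]; apply/andP; split; lra.
  - rewrite mE; move: iw bw; move: (c%:R * w) (i'%:R / n%:R) (b / (2 * h)); clear => x y z.
    by rewrite !ler_norml => /andP[? ?] /andP[? ?]; apply/andP; split; lra.
have [e1 [s1 [h1 [b1 [r1 _ k1 t0S [v11 v12 v13]]]]]] := ok c1 u1 hc1 P1.
have [e2 [s2 [h2 [b2 [r2 _ k2 _ [v21 v22 v23]]]]]] := ok c2 u2 hc2 P2.
have [e3 [s3 [h3 [b3 [r3 _ k3 _ [v31 v32 v33]]]]]] := ok c3 u3 hc3 P3.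
have [e4 [s4 [h4 [b4 [r4 _ k4 _ [v41 v42 v43]]]]]] := ok c4 u4 hc4 P4.
have X0 : 0 <= X by rewrite le_min !mulr_ge0 ?addr_ge0// ltW.
have D0 : 0 <= A' - A by rewrite subr_ge0.
have Xm : X <= (m%:R + 1) * w by rewrite ge_min lexx.
have XS : X <= 4 * (S%:R + 1) by rewrite ge_min lexx orbT.
have m10 : (1 : R) <= m%:R + 1 by rewrite lerDr.
have DX2 : (A' - A) * X ^+ 2 <= 3 * A * w ^+ 2.
  apply: (@le_trans _ _ ((A' - A) * ((m%:R + 1) * w) ^+ 2)).
    by rewrite ler_wpM2l// lerXn2r ?nnegrE// mulr_ge0 ?ltW// addr_ge0.
  by rewrite exprMn mulrA ler_wpM2r// sqr_ge0.
have DX : (A' - A) * X <= 3 * A * w.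
  apply: (@le_trans _ _ ((A' - A) * (m%:R + 1) ^+ 2 * w)); last exact: (ler_wpM2r (ltW w0)).
  rewrite -[leRHS]mulrA; apply: ler_wpM2l => //; apply: le_trans Xm _; apply: (ler_wpM2r (ltW w0)).
  by rewrite expr2 ler_peMl// addr_ge0.
have S1 : (1 : R) <= S%:R + 1 by rewrite lerDr.
have t0S' : `|t0| <= S%:R + 1 - 1 by rewrite addrK.
have fs4 := four_signs A1 D0 DA w0 X0 S1 t0S' SA DX2 DX XS wS.
have [sg2 E2] : exists e2' : bool, u12 = (flip e1 h1 + flip e2' h2,
   flip e1 (2 * s1 * h1 + b1) + flip e2' (2 * s2 * h2 + b2),
   flip e1 (s1 ^+ 2 * h1 + s1 * b1) + flip e2' (s2 ^+ 2 * h2 + s2 * b2)).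
  case: e12 => ->; [exists e2|exists (~~ e2)].
    by rewrite -v11 -v12 -v13 -v21 -v22 -v23.
  by rewrite !flipN -v11 -v12 -v13 -v21 -v22 -v23.
have [sg3 E3] : exists e3' : bool, u123 = (u12.1.1 + flip e3' h3,
   u12.1.2 + flip e3' (2 * s3 * h3 + b3), u12.2 + flip e3' (s3 ^+ 2 * h3 + s3 * b3)).
  case: e123 => ->; [exists e3|exists (~~ e3)].
    by rewrite -v31 -v32 -v33.
  by rewrite !flipN -v31 -v32 -v33.
have [sg4 E4] : exists e4' : bool, u = (u123.1.1 + flip e4' h4,
   u123.1.2 + flip e4' (2 * s4 * h4 + b4), u123.2 + flip e4' (s4 ^+ 2 * h4 + s4 * b4)).
  case: e1234 => ->; [exists e4|exists (~~ e4)].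
    by rewrite -v41 -v42 -v43.
  by rewrite !flipN -v41 -v42 -v43.
rewrite E4 E3 E2 => -[sm1 sm2 sm3].
have nr c c' x y : `|x - c%:R * w - w / 2| <= 3 / 2 * w -> `|y - c'%:R * w - w / 2| <= 3 / 2 * w ->
  close w x y -> near_idx 24 c c'.
  rewrite /close => hx hy hxy.
  have : `|c%:R * w - c'%:R * w| <= 24 * w.
    move: hx hy hxy; move: (c%:R * w) (c'%:R * w); clear => z v.
    rewrite !ler_norml => /andP[? ?] /andP[? ?] /andP[? ?]; apply/andP; split; lra.
  rewrite -mulrBl normrM (gtr0_norm w0) ler_pM2r//; exact: near_idx_norm.
move: nadm; rewrite /adm !negb_or => /and3P[n1 n2 n3].
have [[q1 q2]|[q1 q2]|[q1 q2]] := fs4 e1 sg2 sg3 sg4 _ _ _ _ _ _ _ _ _ _ _ _ r1 r2 r3 r4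
  (And3 sm1 sm2 sm3).
- by move/negP: n1; apply; rewrite (nr _ _ _ _ k1 k2 q1) (nr _ _ _ _ k3 k4 q2).
- by move/negP: n2; apply; rewrite (nr _ _ _ _ k1 k3 q1) (nr _ _ _ _ k2 k4 q2).
- by move/negP: n3; apply; rewrite (nr _ _ _ _ k1 k4 q1) (nr _ _ _ _ k2 k3 q2).
Qed.

End PieceFreq.

(** * Estimates for a single frequency band *)

Section Blocks.
Variables (R : realType) (T : finType) (W : T -> R).
Hypothesis W0 : forall t, 0 <= W t.
Variables (f : nat -> T -> R) (G : R) (al : nat -> R).
Hypothesis fG : forall i t, `|f i t| <= G.
Hypothesis fal : forall i, lam W (fun t => `|f i t|) <= al i.

Lemma sum_f_le N a t : `|\sum_(i < N) f (a + i)%N t| <= N%:R * G.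
Proof.
apply: le_trans (ler_norm_sum _ _ _) _.
have -> : N%:R * G = \sum_(i < N) G by rewrite sumr_const card_ord mulr_natl.
by apply: ler_sum => i _.
Qed.

Lemma block_trivial N a : 0 <= G ->
  lam W (fun t => (\sum_(i < N) f (a + i)%N t) ^+ 4) <= (N%:R * G) ^+ 3 * \sum_(i < N) al (a + i)%N.
Proof.
move=> G0; apply: (@le_trans _ _ (lam W (fun t => (N%:R * G) ^+ 3 * \sum_(i < N) `|f (a + i)%N t|))).
  apply: lam_le => // t; have h := sum_f_le N a t.
  set s := \sum_(i < N) _ in h *.
  have -> : s ^+ 4 = `|s| ^+ 3 * `|s|.
    by rewrite -exprSr -normrX ger0_norm// (exprM s 2 2) sqr_ge0.
  apply: ler_pM => //; rewrite ?exprn_ge0//; last exact: ler_norm_sum.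
  by rewrite lerXn2r// nnegrE mulr_ge0.
rewrite lamZ lam_sum ler_wpM2l ?exprn_ge0 ?mulr_ge0//.
by apply: ler_sum => i _; exact: fal.
Qed.

(** Two of the four factors are bounded in sup norm; the square that remains is almost orthogonal,
    and its diagonal is bounded by sup norm times mean. *)
Lemma block_l2 N a c : 0 <= G ->
  (forall i j, (i < N)%N -> (j < N)%N -> ~~ near_idx c i j ->
     lam W (fun t => f (a + i)%N t * f (a + j)%N t) = 0) ->
  lam W (fun t => (\sum_(i < N) f (a + i)%N t) ^+ 4) <=
    (N%:R * G) ^+ 2 * ((2 * c + 1)%:R * (G * \sum_(i < N) al (a + i)%N)).
Proof.
move=> G0 H.
apply: (@le_trans _ _ ((N%:R * G) ^+ 2 * lam W (fun t => (\sum_(i < N) f (a + i)%N t) ^+ 2))).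
  rewrite -lamZ; apply: lam_le => // t; have h := sum_f_le N a t.
  set s := \sum_(i < N) _ in h *.
  rewrite (_ : 4 = 2 + 2)%N// exprD ler_wpM2r ?sqr_ge0//.
  by rewrite -(@real_normK _ s) ?num_real// lerXn2r ?nnegrE ?mulr_ge0.
apply: ler_wpM2l; first exact: sqr_ge0.
apply: le_trans (@l2_block _ _ _ W0 c N (fun i => f (a + i)%N) H) _.
apply: ler_wpM2l => //; rewrite mulr_sumr; apply: ler_sum => i _.
apply: (@le_trans _ _ (lam W (fun t => G * `|f (a + i)%N t|))).
  apply: lam_le => // t; rewrite -(@real_normK _ (f _ t)) ?num_real// expr2.
  by rewrite ler_wpM2r.
by rewrite lamZ ler_wpM2l.
Qed.

End Blocks.

(** * Orthogonality of distant times *)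

Section Orth.
Variables (R : realType) (L n S : nat).
Hypotheses (L0 : (0 < L)%N) (n0 : (0 < n)%N) (LS : (4 * S + 8 <= L)%N).
Notation V := (R * R * R)%type.
Notation tmn := (@tm R n S).
Notation lamg := (lam (@gridW R L n)).
Notation gp := (@gridpt R L n).

Lemma freq_room2 : ((S + 1) * n * n + (S + 1) * n * n + n <= L * n * n)%N.
Proof. nia. Qed.

Lemma quad_eval_small (x y z s r : R) : `|x| < 1 -> `|y| < 1 -> `|z| < 1 -> `|s| <= r ->
  `|x * s ^+ 2 - y * s + z| <= r ^+ 2 + r + 1.
Proof.
move=> x1 y1 z1 sr.
have r0 : 0 <= r by exact: le_trans sr.
apply: le_trans (ler_normD _ _) _; apply: lerD; last exact: ltW.
apply: le_trans (ler_normB _ _) _; apply: lerD.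
  rewrite normrM normrX -[leRHS]mul1r; apply: ler_pM => //; rewrite ?exprn_ge0//; first exact: ltW.
  by rewrite lerXn2r.
by rewrite normrM -[leRHS]mul1r; apply: ler_pM => //; exact: ltW.
Qed.

(** Evaluate the quadratic of the combined frequency at z = [tm i]. The part from the time i
    vanishes there, and the part from j is, up to sign, d (h d - b) with |h d| at most B0/2, hence
    at least |d| B0/2 in modulus. A quadratic with coefficients below 1 is at most S^2 + S + 1 on
    [-S, S]. *)
Lemma orth0 (A A' B0 B' : R) i j F G :
  span L (pfreq n S A A' B0 B' i) F -> span L (pfreq n S A A' B0 B' j) G ->
  0 < A' -> `|tmn i - tmn j| <= B0 / (2 * A') ->
  2 * (S%:R ^+ 2 + S%:R + 1) < B0 * `|tmn i - tmn j| ->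
  lamg (fun t => F (gp t) * G (gp t)) = 0.
Proof.
move=> sF sG A0 d1 d2; apply: (lam_span0 (spanM sF sG)) => u hu.
have pmv := @vlat_pm R L n S L0 n0 LS.
have vl := pmv _ _ _ _ (@pfreq_vlat R L n S L0 n0 LS A A' B0 B' i) (@pfreq_vlat R L n S L0 n0 LS A A' B0 B' j) _ hu.
apply: (van_grid L0 n0 LS vl) => //; first exact: freq_room2.
move: hu => [u1 [u2 [[iS [e1 [e2 [-> _ _ _]]]] [jS [f1 [f2 [-> _ /andP[_ hA] /andP[hB _]]]]] E]]] [s1 s2 s3].
have sS := tm_abs R n0 iS.
have := quad_eval_small s1 s2 s3 sS.
set d := tmn i - tmn j in d1 d2; set h : R := f1%:~R; set b : R := f2%:~R - tmn j * f1%:~R.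
have -> : `|u.1.1 * tmn i ^+ 2 - u.1.2 * tmn i + u.2| = `|d| * `|h * d - b|.
  rewrite -normrM; case: E => ->; last rewrite -normrN; congr `|_|;
  by rewrite /= /d /h /b; ring.
rewrite -/b in hB; rewrite -/h in hA.
have h1 : B0 / 2 <= `|h * d - b|.
  have hd : `|h * d| <= B0 / 2.
    rewrite normrM; apply: (@le_trans _ _ (A' * (B0 / (2 * A')))); first exact: ler_pM.
    by rewrite le_eqVlt; apply/orP; left; apply/eqP; field; lra.
  have := lerB_dist b (h * d); rewrite distrC => h2; apply: le_trans h2.
  apply: le_trans (lerB hB hd).
  by rewrite le_eqVlt; apply/orP; left; apply/eqP; field.
have h2 := ler_wpM2l (normr_ge0 d) h1.
rewrite leNgt => /negP; apply; apply: lt_le_trans h2.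
by rewrite mulrA ltr_pdivlMr// mulrC [ltRHS]mulrC.
Qed.

Lemma block_orth (A A' B0 B' : R) (N a c : nat) (g : nat -> V -> R) :
  (forall i, span L (pfreq n S A A' B0 B' i) (g i)) ->
  0 < A' -> (N <= 1)%N || (N%:R / n%:R <= B0 / (2 * A')) -> 0 < B0 ->
  2 * (S%:R ^+ 2 + S%:R + 1) * n%:R <= c%:R * B0 ->
  forall i j, (i < N)%N -> (j < N)%N -> ~~ near_idx c i j ->
     lamg (fun t => g (a + i)%N (gp t) * g (a + j)%N (gp t)) = 0.
Proof.
move=> sg A0 hN B00 hc i j iN jN nij.
have nR : (0 : R) < n%:R by rewrite ltr0n.
have dE : `|tmn (a + i) - tmn (a + j)| = `|i%:R - j%:R| / n%:R.
  by rewrite tm_diff normrM normfV normr_nat !natrD; congr (`|_| / _); ring.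
have [cij iNj] : (c%:R : R) < `|i%:R - j%:R| /\ `|i%:R - j%:R| <= (N%:R : R) /\ ~~ (N <= 1)%N.
  have hh x y : (x < N)%N -> (y + c < x)%N ->
    (c%:R : R) < `|x%:R - y%:R| /\ `|x%:R - y%:R| <= (N%:R : R) /\ ~~ (N <= 1)%N.
    move=> xN yx; have yx' : (y <= x)%N by lia.
    rewrite -natrB// normr_nat ltr_nat ler_nat; split; [lia|split; lia].
  rewrite /near_idx negb_and -!ltnNge in nij; case/orP: nij => h; first exact: hh.
  by rewrite distrC; exact: hh.
case: iNj => iNj /negbTE N1; rewrite N1 /= in hN.
apply: (orth0 (sg _) (sg _)) => //; rewrite dE.
  by apply: le_trans hN; rewrite ler_wpM2r// invr_ge0 ltW.
rewrite mulrA ltr_pdivlMr//; apply: le_lt_trans hc _.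
by rewrite mulrC ltr_pM2l.
Qed.

End Orth.

(** Finds the scale down to which the tree can be descended without interruption; the failure just
    below it supplies the information used at the bottom. *)
Lemma last_failure (P : pred nat) K : exists2 k0, (k0 <= K)%N &
  (forall k, (k0 <= k < K)%N -> P k) /\ (k0 = 0%N \/ ~~ P k0.-1).
Proof.
elim: K => [|K [k0 k0K [h1 h2]]]; first by exists 0%N => //; split; [move=> k; lia|left].
case: (boolP (P K)) => PK; last by exists K.+1 => //; split; [move=> k; lia|right].
exists k0; first lia.
split => // k /andP[kk]; rewrite ltnS leq_eqVlt => /orP[/eqP ->//|kK].
by apply: h1; rewrite kk.
Qed.

(** * One band: descent through the good scales and the bound at the bottom *)

Section Piece.
Variables (R : realType) (L n S m K : nat).
Hypotheses (L0 : (0 < L)%N) (n0 : (0 < n)%N) (LS : (4 * S + 8 <= L)%N) (m0 : (0 < m)%N).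
Notation V := (R * R * R)%type.
Notation tmn := (@tm R n S).
Notation lamg := (lam (@gridW R L n)).
Notation gp := (@gridpt R L n).
Variables (g : nat -> V -> R) (G : R) (al : nat -> R) (A A' B0 B' : R).
Hypothesis gG : forall i x, `|g i x| <= G.
Hypothesis gal : forall i, lamg (fun t => `|g i (gp t)|) <= al i.
Hypothesis gspan : forall i, span L (pfreq n S A A' B0 B' i) (g i).
Definition C0 : R := (3 * 49 ^ 2)%:R.
Let f i t := g i (gp t).
Let wid (k : nat) : R := m%:R ^+ k / n%:R.
Definition good_scale k :=
  [&& 1 <= A, A <= A', A' - A <= A, (A' - A) * (m%:R + 1) ^+ 2 <= 3 * A,
      B' <= 2 * A * wid k, (S%:R + 1) ^+ 2 <= A * wid k ^+ 2 & wid k <= 2 * (S%:R + 1)].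

Lemma C0_ge1 : 1 <= C0. Proof. by rewrite /C0 ler1n. Qed.

Lemma piece_dec k0 : (k0 <= K)%N -> (forall k, (k0 <= k < K)%N -> good_scale k) ->
  lamg (fun t => blk m f 0 K t ^+ 4) <=
  (C0 * m%:R) ^+ (K - k0) *
    \sum_(j < m ^ (K - k0)) lamg (fun t => blk m f (j * m ^ k0) k0 t ^+ 4).
Proof.
move=> k0K hk.
have C00 : 0 <= C0 by exact: le_trans C0_ge1.
have H k a : (k0 <= k < K)%N ->
     lamg (fun t => blk m f a k.+1 t ^+ 4) <=
     C0 * m%:R * \sum_(c < m) lamg (fun t => blk m f (a + c * m ^ k) k t ^+ 4).
  by move=> /hk/and5P[h1 h2 h3 h4 /and3P[h5 h6 h7]]; exact: (step_bound L0 n0 LS a gspan).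
have h := @decouple R _ _ m C0 f k0 K C00 H (K - k0)%N 0%N.
by move: h; rewrite subnK// subnKC//; apply.
Qed.

Lemma fG i t : `|f i t| <= G. Proof. exact: gG. Qed.

Lemma sum_al_ge0 N a : 0 <= \sum_(i < N) al (a + i)%N.
Proof.
apply: sumr_ge0 => i _; apply: le_trans (gal _); apply: lam_ge0 => // t.
exact: gridW_ge0.
Qed.

Lemma piece_a k0 : 0 <= G -> (k0 <= K)%N -> (forall k, (k0 <= k < K)%N -> good_scale k) ->
  lamg (fun t => blk m f 0 K t ^+ 4) <=
  (C0 * m%:R) ^+ (K - k0) * ((m ^ k0)%:R * G) ^+ 3 * \sum_(i < m ^ K) al i.
Proof.
move=> G0 k0K hk; apply: le_trans (piece_dec k0K hk) _; rewrite -mulrA.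
apply: ler_wpM2l; first by rewrite exprn_ge0// mulr_ge0//; exact: le_trans C0_ge1.
have eK : (m ^ K = m ^ (K - k0) * m ^ k0)%N by rewrite -expnD subnK.
rewrite eK (sum_ordM _ _ al) mulr_sumr; apply: ler_sum => j _.
exact: (block_trivial (@gridW_ge0 R L n) fG gal).
Qed.

(** Orthogonality needs blocks shorter by a constant factor than those at which the pairing stops,
    namely of size m^(k0 - 2). Splitting into at most m^2 of them costs (m^2)^3 = m^6 by
    convexity. *)
Lemma piece_b k0 c : 0 <= G -> (k0 <= K)%N -> (forall k, (k0 <= k < K)%N -> good_scale k) ->
  0 < A' -> 0 < B0 ->
  (m ^ (k0 - 2) <= 1)%N || ((m ^ (k0 - 2))%:R / n%:R <= B0 / (2 * A')) ->
  2 * (S%:R ^+ 2 + S%:R + 1) * n%:R <= c%:R * B0 ->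
  lamg (fun t => blk m f 0 K t ^+ 4) <=
  (C0 * m%:R) ^+ (K - k0) * (m%:R ^+ 6 * (((m ^ k0)%:R * G) ^+ 2 * ((2 * c + 1)%:R * G))) *
     \sum_(i < m ^ K) al i.
Proof.
move=> G0 k0K hk A0 B00 hN hc; apply: le_trans (piece_dec k0K hk) _; rewrite -mulrA.
apply: ler_wpM2l; first by rewrite exprn_ge0// mulr_ge0//; exact: le_trans C0_ge1.
have eK : (m ^ K = m ^ (K - k0) * m ^ k0)%N by rewrite -expnD subnK.
rewrite eK (sum_ordM _ _ al) mulr_sumr; apply: ler_sum => j _.
set k' := (k0 - 2)%N; have kk : k0 = (k0 - k' + k')%N by rewrite /k'; lia.
set a := (j * m ^ k0)%N.
apply: (@le_trans _ _ (lamg (fun t => (m ^ (k0 - k'))%:R ^+ 3 *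
   \sum_(l < m ^ (k0 - k')) blk m f (a + l * m ^ k') k' t ^+ 4))).
  apply: lam_le; first exact: gridW_ge0.
  by move=> t; rewrite {1}kk blkM; exact: sum_pow4_le.
rewrite lamZ lam_sum.
have m1 : (1 : R) <= m%:R by rewrite ler1n.
have mk3 : ((m ^ (k0 - k'))%:R : R) ^+ 3 <= m%:R ^+ 6.
  by rewrite natrX -exprM ler_weXn2l//; rewrite /k'; lia.
have sal : \sum_(i < m ^ k0) al (a + i)%N =
   \sum_(l < m ^ (k0 - k')) \sum_(i < m ^ k') al (a + l * m ^ k' + i)%N.
  have ek : (m ^ k0 = m ^ (k0 - k') * m ^ k')%N by rewrite -expnD -kk.
  rewrite ek (sum_ordM _ _ (fun i => al (a + i)%N)).
  by apply: eq_bigr => l _; apply: eq_bigr => i _; rewrite addnA.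
rewrite -[leRHS]mulrA; apply: ler_pM => //.
  by apply: sumr_ge0 => l _; apply: lam_ge0; [exact: gridW_ge0|move=> t; rewrite (exprM _ 2 2) sqr_ge0].
rewrite sal mulr_sumr; apply: ler_sum => l _.
have orth := block_orth L0 n0 LS (a + l * m ^ k')%N gspan A0 hN B00 hc.
apply: le_trans (block_l2 (@gridW_ge0 R L n) fG gal G0 orth) _.
rewrite (mulrA (2 * c + 1)%:R) mulrA; apply: ler_wpM2r; first exact: sum_al_ge0.
apply: ler_wpM2r; first by rewrite mulr_ge0.
rewrite lerXn2r ?nnegrE ?mulr_ge0//; apply: ler_wpM2r => //.
by rewrite ler_nat leq_pexp2l// leq_subr.
Qed.

End Piece.

Ltac nonneg := repeat first [assumption | exact: ler0n | exact: ler01 | exact: normr_ge0 | exact: sqr_ge0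
  | apply: ltW; assumption | apply: mulr_ge0 | apply: addr_ge0 | apply: exprn_ge0 | rewrite invr_ge0].

(** * The four regimes of a pair of bands *)

Section PieceBound.
Variables (R : realType) (L n S m K Q : nat).
Notation V := (R * R * R)%type.
Notation lamg := (lam (@gridW R L n)).
Notation gp := (@gridpt R L n).
Let kap : R := S%:R ^+ 2 + S%:R + 1.
(** The first summand covers the lowest band of b, where B' is at most 2Q and Q at most A; the
    second is the threshold for B'^2/A between the two regimes. *)
Let E : R := 4 * Q%:R + 4 * (S%:R + 1) ^+ 2.
Let Ca1 : R := 2 * S%:R * m%:R * m%:R ^+ 2 * E * (2 + E).
Let Ca0 : R := (2 * S%:R * m%:R) ^+ 3 * (4 * Q%:R).
Let Cc : R := 4 * kap + 3 * (S%:R + 1).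
Let Cb1 : R := m%:R ^+ 6 * (2 * S%:R * m%:R) * (4 * (1 + 2 * S%:R) * m%:R) * Cc.
Let Cb0 : R := m%:R ^+ 6 * (2 * S%:R * m%:R) ^+ 2 * 6 * Cc.
Definition piece_const : R := Ca1 + Ca0 + Cb1 + Cb0.

Lemma piece_const_ge0 : 0 <= piece_const.
Proof. by rewrite /piece_const /Ca1 /Ca0 /Cb1 /Cb0 /Cc /E /kap; nonneg. Qed.

Lemma piece_const_ge : [/\ Ca1 <= piece_const, Ca0 <= piece_const, Cb1 <= piece_const
  & Cb0 <= piece_const].
Proof.
have E0 : 0 <= E by rewrite /E; nonneg.
have k0 : 0 <= kap by rewrite /kap; nonneg.
have Cc0 : 0 <= Cc by rewrite /Cc; nonneg.
have h1 : 0 <= Ca1 by rewrite /Ca1; nonneg.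
have h2 : 0 <= Ca0 by rewrite /Ca0; nonneg.
have h3 : 0 <= Cb1 by rewrite /Cb1; nonneg.
have h4 : 0 <= Cb0 by rewrite /Cb0; nonneg.
rewrite /piece_const; move: h1 h2 h3 h4; move: (Ca1) (Ca0) (Cb1) (Cb0) => a b c d *.
by split; lra.
Qed.

Lemma chain_a (Lm c0 c1 mK x Y A B N D F : R) :
  0 <= c0 -> 0 <= mK -> 0 <= Y -> 0 <= A -> 0 <= F -> 0 <= B ->
  Lm <= c0 * (mK * x ^+ 2 * Y) -> c0 <= c1 -> mK <= N -> x ^+ 2 * A <= D -> B <= F * A ->
  Lm * B <= c1 * (N * D * F * Y).
Proof.
move=> c00 mK0 Y0 A0 F0 B0 hL hc hN hD hB.
have x20 : 0 <= x ^+ 2 by exact: sqr_ge0.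
apply: le_trans (ler_wpM2r B0 hL) _.
apply: (@le_trans _ _ (c0 * (mK * x ^+ 2 * Y) * (F * A))).
  by apply: ler_wpM2l => //; nonneg.
rewrite (_ : c0 * (mK * x ^+ 2 * Y) * (F * A) = c0 * (mK * (x ^+ 2 * A) * F * Y)); last by ring.
apply: ler_pM => //; first by nonneg.
apply: ler_wpM2r => //; apply: ler_wpM2r => //; apply: ler_pM => //.
by nonneg.
Qed.

Lemma chain_b (Lm c0 c1 mm mK x c2 Y B B0 N D N2 : R) :
  0 <= c0 -> 0 <= mm -> 0 <= mK -> 0 <= x -> 0 <= c2 -> 0 <= Y -> 0 <= B -> 0 <= D -> 0 <= B0 ->
  Lm <= c0 * (mm * mK * x * c2 * Y) -> c0 <= c1 -> mK <= N -> x * B <= D * B0 -> c2 * B0 <= N2 ->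
  Lm * B <= c1 * (mm * N * D * N2 * Y).
Proof.
move=> c00 mm0 mK0 x0 c20 Y0 B0' D0 B00 hL hc hN hD h2.
apply: le_trans (ler_wpM2r B0' hL) _.
apply: (@le_trans _ _ (c0 * (mm * mK * (D * B0) * c2 * Y))).
  rewrite (_ : c0 * (mm * mK * x * c2 * Y) * B = c0 * (mm * mK * (x * B) * c2 * Y)); last by ring.
  apply: ler_wpM2l => //; do 2!apply: ler_wpM2r => //.
  by apply: ler_wpM2l => //; nonneg.
rewrite (_ : c0 * (mm * mK * (D * B0) * c2 * Y) = c0 * (mm * mK * D * (c2 * B0) * Y)); last by ring.
apply: ler_pM => //; first by nonneg.
apply: ler_wpM2r => //; apply: ler_pM => //; [by nonneg|by nonneg|].
by apply: ler_wpM2r => //; apply: ler_wpM2l.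
Qed.

Hypotheses (L0 : (0 < L)%N) (n0 : (0 < n)%N) (LS : (4 * S + 8 <= L)%N).
Hypotheses (S0 : (0 < S)%N) (m8 : (8 <= m)%N) (mS : (8 * S <= m)%N).
Hypotheses (hK : (m ^ K <= 2 * S * m * n)%N) (hK1 : (m ^ K.-1 <= 2 * S * n)%N).
Hypotheses (Q0 : (0 < Q)%N).

Variables (g : nat -> V -> R) (G : R) (al : nat -> R).
Hypothesis G0 : 0 <= G.
Hypothesis gG : forall i x, `|g i x| <= G.
Hypothesis gal : forall i, lamg (fun t => `|g i (gp t)|) <= al i.

Let f i t := g i (gp t).
Let Lm := lamg (fun t => blk m f 0 K t ^+ 4).
Let Y := G ^+ 3 * \sum_(i < m ^ K) al i.

Let m0 : (0 < m)%N. Proof. exact: leq_trans m8. Qed.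
Let nR : (0 : R) < n%:R. Proof. by rewrite ltr0n n0. Qed.

Lemma Y_ge0 : 0 <= Y.
Proof.
rewrite mulr_ge0 ?exprn_ge0//; apply: sumr_ge0 => i _; apply: le_trans (gal _).
by apply: lam_ge0 => // t; exact: gridW_ge0.
Qed.

Lemma C0pow_le k : (k <= K)%N -> C0 R ^+ (K - k) <= C0 R ^+ K.
Proof. by move=> kK; rewrite ler_weXn2l ?C0_ge1 ?leq_subr. Qed.

Lemma mK_le : ((m ^ K)%:R : R) <= 2 * S%:R * m%:R * n%:R.
Proof. by rewrite -!natrM ler_nat. Qed.

Lemma wid_le k : (k < K)%N -> (m%:R ^+ k / n%:R : R) <= 2 * (S%:R + 1).
Proof.
move=> kK; rewrite ler_pdivrMr// -natrX.
apply: (@le_trans _ _ (2 * S * n)%:R).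
  rewrite ler_nat; apply: leq_trans hK1; rewrite leq_pexp2l//; lia.
rewrite !natrM; apply: ler_wpM2r; first exact: ltW.
by apply: ler_wpM2l => //; rewrite lerDl.
Qed.

Section Positive.
Variables (A A' B0 B' : R).
Hypothesis gspan : forall i, span L (pfreq n S A A' B0 B' i) (g i).
Hypotheses (A1 : 1 <= A) (AA' : A <= A') (A2 : A' <= 2 * A)
  (Am : (A' - A) * (m%:R + 1) ^+ 2 <= 3 * A) (An : A <= (S%:R + 1) * n%:R) (B'0 : 0 <= B').

Let A0 : 0 < A. Proof. exact: lt_le_trans A1. Qed.

Lemma scale_fail k : (k < K)%N -> ~~ good_scale n S m A A' B' k ->
  2 * A * (m%:R ^+ k / n%:R) < B' \/ A * (m%:R ^+ k / n%:R) ^+ 2 < (S%:R + 1) ^+ 2.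
Proof.
move=> kK; rewrite /good_scale A1 AA' Am wid_le// andbT.
have -> : A' - A <= A by rewrite lerBlDr (_ : A + A = 2 * A)//; ring.
by rewrite /= negb_and -!ltNge => /orP.
Qed.

Lemma exists_scale : exists2 k0, (k0 <= K)%N &
  (forall k, (k0 <= k < K)%N -> good_scale n S m A A' B' k) /\
  (k0 = 0%N \/ exists w : R, [/\ (m ^ k0)%:R = m%:R * n%:R * w, (m ^ (k0 - 2) <= 1)%N \/
     ((m ^ (k0 - 2))%:R / n%:R) * m%:R = w, 0 <= w &
     2 * A * w < B' \/ A * w ^+ 2 < (S%:R + 1) ^+ 2]).
Proof.
have [k0 k0K [h1 h2]] := last_failure (good_scale n S m A A' B') K.
exists k0 => //; split => //; case: h2 => [->|h2]; first by left.
case: k0 k0K h1 h2 => [|k] kK h1 h2; first by left.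
right; exists (m%:R ^+ k / n%:R); split.
- by rewrite expnS natrM natrX; field; rewrite ?gt_eqF.
- case: k {kK h1 h2} => [|k]; first by left.
  by right; rewrite subSS subn1 /= natrX exprS; field; rewrite ?gt_eqF.
- by rewrite divr_ge0 ?exprn_ge0.
- exact: scale_fail.
Qed.

(** Whichever condition fails at the scale w, A w^2 is at most E, because B'^2 <= E A. A bottom
    block of x times thus has x^2 A of order n^2; the trivial bound m^K x^2, multiplied by A + B of
    order A, is of order n^3. *)
Lemma piece_bound_a : B' ^+ 2 <= E * A ->
  Lm * (A' + B') <= C0 R ^+ K * (piece_const * n%:R ^+ 3 * Y).
Proof.
move=> BE; have [k0 k0K [h1 h2]] := exists_scale.
have hL := piece_a L0 n0 LS m0 gG gal gspan G0 k0K h1.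
have S1 : 1 <= (S%:R : R) by rewrite ler1n.
have n1 : 1 <= (n%:R : R) by rewrite ler1n.
have m1 : 1 <= (m%:R : R) by rewrite ler1n.
have E1 : (S%:R + 1) ^+ 2 <= E.
  rewrite /E; have := sqr_ge0 (S%:R + 1 : R); have : (0 : R) <= Q%:R by [].
  by move: ((S%:R + 1) ^+ 2) (Q%:R : R) => x y *; lra.
have SE : S%:R + 1 <= E by apply: le_trans E1; rewrite expr2 ler_peMr// lerDr.
have E0 : 0 <= E by apply: le_trans SE; rewrite addr_ge0.
have E11 : 1 <= E by apply: le_trans SE; rewrite lerDr.
have xA : (m ^ k0)%:R ^+ 2 * A <= m%:R ^+ 2 * n%:R ^+ 2 * E.
  case: h2 => [->|[w [-> _ w0 hw]]].
    rewrite expn0 expr1n mul1r; apply: le_trans An _; rewrite mulrC.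
    apply: ler_pM => //.
    rewrite -[leLHS]mul1r; apply: ler_pM => //; first by rewrite expr_ge1.
    by rewrite expr2 ler_peMr.
  rewrite (_ : (m%:R * n%:R * w) ^+ 2 * A = m%:R ^+ 2 * n%:R ^+ 2 * (A * w ^+ 2)); last by ring.
  apply: ler_wpM2l; first by rewrite mulr_ge0 ?sqr_ge0.
  case: hw => hw; last exact: le_trans (ltW hw) E1.
  have : (2 * A * w) ^+ 2 <= B' ^+ 2.
    by rewrite lerXn2r ?nnegrE//; [rewrite mulr_ge0// mulr_ge0// ltW|exact: ltW].
  move=> h; have {}h := le_trans h BE.
  have : A * (4 * (A * w ^+ 2)) <= A * E by move: h; rewrite (_ : (2 * A * w) ^+ 2 = A * (4 * (A * w ^+ 2))) 1?(mulrC E)//; ring.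
  rewrite ler_pM2l// => h3; apply: le_trans h3; rewrite ler_peMl//; last by rewrite ler1n.
  by rewrite mulr_ge0 ?sqr_ge0// ltW.
have AB : A' + B' <= (2 + E) * A.
  rewrite mulrDl; apply: lerD => //.
  rewrite -(@ler_pXn2r _ 2)// ?nnegrE//; last by nonneg.
  apply: le_trans BE _; rewrite -[leLHS]mul1r expr2; apply: ler_pM => //; first by nonneg.
  by apply: (le_trans E11); rewrite ler_peMr.
have hL2 : Lm <= C0 R ^+ (K - k0) * ((m ^ K)%:R * (m ^ k0)%:R ^+ 2 * Y).
  apply: le_trans hL _; rewrite le_eqVlt; apply/orP; left; apply/eqP.
  have -> : ((m ^ K)%:R : R) = m%:R ^+ (K - k0) * (m ^ k0)%:R.
    by rewrite -natrX -natrM -expnD subnK.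
  by rewrite /Y exprMn; ring.
have Y0 := Y_ge0.
have C00 : 0 <= C0 R ^+ (K - k0) by apply: exprn_ge0; exact: le_trans (C0_ge1 R).
have AB0 : 0 <= A' + B' by apply: addr_ge0 => //; exact: le_trans (ltW A0) AA'.
have F0 : 0 <= 2 + E by nonneg.
have h := chain_a C00 (ler0n _ _) Y0 (ltW A0) F0 AB0 hL2 (C0pow_le k0K) mK_le xA AB.
apply: le_trans h _; apply: ler_wpM2l; first by apply: exprn_ge0; exact: le_trans (C0_ge1 R).
apply: ler_wpM2r => //; have [hC _ _ _] := piece_const_ge.
apply: le_trans (ler_wpM2r _ hC); last by nonneg.
by rewrite le_eqVlt /Ca1; apply/orP; left; apply/eqP; ring.
Qed.

(** Here both failures give 2 A w <= B', so x A is of order n B. Orthogonality replaces one factor x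
    by the number c of interacting times, of order n/B; then m^K x c (A + B) is again of order
    n^3. *)
Lemma piece_bound_b c : 4 * (S%:R + 1) ^+ 2 * A < B' ^+ 2 -> 0 < B0 -> B' <= 4 * B0 ->
  2 * kap * n%:R <= c%:R * B0 -> (2 * c + 1)%:R * B0 <= Cc * n%:R ->
  Lm * (A' + B') <= C0 R ^+ K * (piece_const * n%:R ^+ 3 * Y).
Proof.
move=> BE B00 B4 hc1 hc2; have [k0 k0K [h1 h2]] := exists_scale.
have A'0 : 0 < A' by exact: lt_le_trans A0 AA'.
have S1 : 1 <= (S%:R : R) by rewrite ler1n.
have n1 : 1 <= (n%:R : R) by rewrite ler1n.
have m1 : 1 <= (m%:R : R) by rewrite ler1n.
have S10 : 0 < S%:R + 1 :> R by apply: ltr_wpDl.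
have hw (w : R) : 0 <= w -> 2 * A * w < B' \/ A * w ^+ 2 < (S%:R + 1) ^+ 2 -> 2 * A * w <= B'.
  move=> w0 [/ltW//|hw]; rewrite -(@ler_pXn2r _ 2)// ?nnegrE//; last by nonneg.
  apply: (le_trans _ (ltW BE)); rewrite (_ : (2 * A * w) ^+ 2 = A * (4 * (A * w ^+ 2))); last by ring.
  rewrite [leRHS]mulrC; apply: ler_wpM2l; first exact: ltW.
  by apply: ler_wpM2l => //; exact: ltW.
have xA : (m ^ k0)%:R * (2 * A) <= m%:R * n%:R * B'.
  case: h2 => [->|[w [-> _ w0 /(hw w w0) h3]]]; last first.
    rewrite (_ : m%:R * n%:R * w * (2 * A) = m%:R * n%:R * (2 * A * w)); last by ring.
    by apply: ler_wpM2l => //; nonneg.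
  rewrite expn0 mul1r -mulrA; apply: ler_pM => //; [exact: ltW|by rewrite ler_nat; exact: leq_trans m8|].
  rewrite -(@ler_pXn2r _ 2)// ?nnegrE//; [|exact: ltW|by nonneg].
  apply: (@le_trans _ _ (A * ((S%:R + 1) * n%:R))); first by rewrite expr2; apply: ler_wpM2l => //; exact: ltW.
  apply: (@le_trans _ _ (4 * (S%:R + 1) ^+ 2 * A * n%:R ^+ 2)).
    rewrite (_ : A * ((S%:R + 1) * n%:R) = (S%:R + 1) * A * n%:R); last by ring.
    apply: ler_pM => //; [by nonneg| |by rewrite expr2 ler_peMr].
    apply: ler_wpM2r; first exact: ltW.
    rewrite expr2 mulrA; apply: ler_peMl; first exact: ltW.
    by apply: mulr_ege1; [rewrite ler1n|rewrite lerDr].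
  by rewrite exprMn mulrC; apply: ler_wpM2l; [exact: sqr_ge0|exact: ltW].
have sub : (m ^ (k0 - 2) <= 1)%N || ((m ^ (k0 - 2))%:R / n%:R <= B0 / (2 * A')).
  case: h2 => [->|[w [_ [->//|e] w0 /(hw w w0) h3]]]; first by rewrite expn0.
  apply/orP; right; set y := (_ / _) in e *.
  have y0 : 0 <= y by rewrite divr_ge0.
  rewrite ler_pdivlMr; last by rewrite mulr_gt0.
  have h4 : A * (y * m%:R) * 2 <= 4 * B0.
    by apply: (le_trans _ B4); apply: (le_trans _ h3); rewrite e mulrC mulrA.
  (* One more level down gains the factor m, at least 8, over the failing scale; this outweighs the
     constants 4 and 2 lost in B' <= 4 B0 and A' <= 2 A. *)
  have h5 : A * (y * 8) <= A * (y * m%:R).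
    by apply: ler_wpM2l; [exact: ltW|apply: ler_wpM2l => //; rewrite ler_nat].
  apply: (@le_trans _ _ (y * (2 * (2 * A)))); first by apply: ler_wpM2l => //; apply: ler_wpM2l.
  have -> : y * (2 * (2 * A)) = A * (y * 8) * 2 / 4 by field.
  by rewrite ler_pdivrMr// [leRHS]mulrC; apply: (le_trans _ h4); apply: ler_wpM2r.
have hL := piece_b L0 n0 LS m0 gG gal gspan G0 k0K h1 A'0 B00 sub hc1.
have xle : ((m ^ k0)%:R : R) <= 2 * S%:R * m%:R * n%:R.
  by apply: (le_trans _ mK_le); rewrite ler_nat leq_pexp2l.
have xB : (m ^ k0)%:R * (A' + B') <= 4 * (1 + 2 * S%:R) * m%:R * n%:R * B0.
  apply: (@le_trans _ _ ((1 + 2 * S%:R) * m%:R * n%:R * B')).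
    rewrite mulrDr (_ : (1 + 2 * S%:R) * m%:R * n%:R * B' = m%:R * n%:R * B' + 2 * S%:R * m%:R * n%:R * B'); last by ring.
    apply: lerD; last by apply: ler_wpM2r.
    by apply: (le_trans _ xA); apply: ler_wpM2l.
  rewrite (_ : 4 * (1 + 2 * S%:R) * m%:R * n%:R * B0 = (1 + 2 * S%:R) * m%:R * n%:R * (4 * B0)); last by ring.
  by apply: ler_wpM2l => //; nonneg.
have hL2 : Lm <= C0 R ^+ (K - k0) * (m%:R ^+ 6 * (m ^ K)%:R * (m ^ k0)%:R * (2 * c + 1)%:R * Y).
  apply: le_trans hL _; rewrite le_eqVlt; apply/orP; left; apply/eqP.
  have -> : ((m ^ K)%:R : R) = m%:R ^+ (K - k0) * (m ^ k0)%:R.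
    by rewrite -natrX -natrM -expnD subnK.
  by rewrite /Y !exprMn; ring.
have Y0 := Y_ge0.
have C00 : 0 <= C0 R ^+ (K - k0) by apply: exprn_ge0; exact: le_trans (C0_ge1 R).
have AB0 : 0 <= A' + B' by apply: addr_ge0 => //; exact: ltW.
have D0 : 0 <= 4 * (1 + 2 * S%:R) * m%:R * n%:R :> R by nonneg.
have m60 : 0 <= m%:R ^+ 6 :> R by nonneg.
have h := chain_b C00 m60 (ler0n _ _) (ler0n _ _) (ler0n _ _) Y0 AB0 D0 (ltW B00) hL2 (C0pow_le k0K) mK_le xB hc2.
apply: le_trans h _; apply: ler_wpM2l; first by apply: exprn_ge0; exact: le_trans (C0_ge1 R).
apply: ler_wpM2r => //; have [_ _ hC _] := piece_const_ge.
apply: le_trans (ler_wpM2r _ hC); last by nonneg.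
by rewrite le_eqVlt /Cb1; apply/orP; left; apply/eqP; ring.
Qed.

End Positive.

Section Zero.
Variables (A A' B0 B' : R).
Hypothesis gspan : forall i, span L (pfreq n S A A' B0 B' i) (g i).
Hypotheses (A'0 : 0 < A') (A'Q : A' <= 2 * Q%:R) (B'0 : 0 <= B').

(** The lowest band of h contains h = 0, where the quadratics degenerate, so the tree is not
    descended: k0 = K. *)
Let nodec k : (K <= k < K)%N -> good_scale n S m A A' B' k.
Proof. lia. Qed.

Lemma piece_bound_a0 : B' <= 2 * Q%:R ->
  Lm * (A' + B') <= C0 R ^+ K * (piece_const * n%:R ^+ 3 * Y).
Proof.
move=> BQ; have hL := piece_a L0 n0 LS m0 gG gal gspan G0 (leqnn K) nodec.
rewrite subnn expr0 mul1r in hL.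
have Y0 := Y_ge0.
have C1 : 1 <= C0 R ^+ K by rewrite exprn_ege1// C0_ge1.
have AB0 : 0 <= A' + B' by apply: addr_ge0 => //; exact: ltW.
have [_ hC _ _] := piece_const_ge.
apply: (@le_trans _ _ (Ca0 * n%:R ^+ 3 * Y)); last first.
  rewrite -[leLHS]mul1r; apply: ler_pM => //.
    by rewrite /Ca0; nonneg.
  by apply: ler_wpM2r => //; apply: ler_wpM2r => //; nonneg.
apply: le_trans (ler_wpM2r AB0 hL) _.
rewrite (_ : ((m ^ K)%:R * G) ^+ 3 * (\sum_(i < m ^ K) al i) * (A' + B') =
  (m ^ K)%:R ^+ 3 * (A' + B') * Y); last by rewrite /Y exprMn; ring.
apply: ler_wpM2r => //.
rewrite (_ : Ca0 * n%:R ^+ 3 = (2 * S%:R * m%:R * n%:R) ^+ 3 * (2 * Q%:R + 2 * Q%:R)); last by rewrite /Ca0 !exprMn; ring.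
apply: ler_pM; [by nonneg|exact: AB0| |exact: lerD].
by apply: lerXn2r; rewrite ?nnegrE; first [exact: mK_le|by nonneg].
Qed.

Lemma piece_bound_b0 c : Q%:R <= B0 -> B' <= 4 * B0 ->
  2 * kap * n%:R <= c%:R * B0 -> (2 * c + 1)%:R * B0 <= Cc * n%:R ->
  Lm * (A' + B') <= C0 R ^+ K * (piece_const * n%:R ^+ 3 * Y).
Proof.
move=> QB B4 hc1 hc2.
have B00 : 0 < B0 by apply: (lt_le_trans _ QB); rewrite ltr0n.
have sub : (m ^ (K - 2) <= 1)%N || ((m ^ (K - 2))%:R / n%:R <= B0 / (2 * A')).
  case: (leqP K 2) => K2.
    by have /eqP -> : (K - 2 == 0)%N by rewrite subn_eq0.
  apply/orP; right; rewrite ler_pdivlMr ?mulr_gt0// mulrAC ler_pdivrMr//.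
  apply: (@le_trans _ _ ((m ^ (K - 2))%:R * (4 * B0))).
    apply: ler_wpM2l => //.
    rewrite (_ : 4 * B0 = 2 * (2 * B0)); last by ring.
    by apply: ler_wpM2l => //; apply: le_trans A'Q _; apply: ler_wpM2l.
  rewrite mulrA mulrC; apply: ler_wpM2l; first exact: ltW.
  (* The hypotheses m^(K-1) <= 2 S n and 8 S <= m give 4 m^(K-2) <= n. *)
  rewrite -natrM ler_nat -(leq_pmul2r m0).
  have e : (m ^ (K - 2) * m = m ^ K.-1)%N by rewrite -expnSr -subSn ?(ltnW K2)// subSS subn1.
  rewrite mulnAC e; apply: leq_trans (leq_mul hK1 (leqnn 4)) _.
  rewrite (_ : (2 * S * n * 4 = n * (8 * S))%N); last by ring.
  by rewrite leq_mul2l mS orbT.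
have hL := piece_b L0 n0 LS m0 gG gal gspan G0 (leqnn K) nodec A'0 B00 sub hc1.
have hL2 : Lm <= 1 * (m%:R ^+ 6 * (m ^ K)%:R * (m ^ K)%:R * (2 * c + 1)%:R * Y).
  apply: le_trans hL _; rewrite le_eqVlt; apply/orP; left; apply/eqP.
  by rewrite subnn expr0 /Y !exprMn; ring.
have xB : (m ^ K)%:R * (A' + B') <= 6 * (2 * S%:R * m%:R * n%:R) * B0.
  rewrite (_ : 6 * (2 * S%:R * m%:R * n%:R) * B0 = 2 * S%:R * m%:R * n%:R * (2 * B0 + 4 * B0)); last by ring.
  apply: ler_pM => //; [by apply: addr_ge0 => //; exact: ltW|exact: mK_le|].
  by apply: lerD => //; apply: le_trans A'Q _; apply: ler_wpM2l.
have Y0 := Y_ge0.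
have C1 : 1 <= C0 R ^+ K by rewrite exprn_ege1// C0_ge1.
have AB0 : 0 <= A' + B' by apply: addr_ge0 => //; exact: ltW.
have D0 : 0 <= 6 * (2 * S%:R * m%:R * n%:R) :> R by nonneg.
have m60 : 0 <= m%:R ^+ 6 :> R by nonneg.
have h := chain_b ler01 m60 (ler0n _ _) (ler0n _ _) (ler0n _ _) Y0 AB0 D0 (ltW B00) hL2 C1 mK_le xB hc2.
apply: le_trans h _; apply: ler_wpM2l; first exact: le_trans C1.
apply: ler_wpM2r => //; have [_ _ _ hC] := piece_const_ge.
apply: le_trans (ler_wpM2r _ hC); last by nonneg.
by rewrite le_eqVlt /Cb0; apply/orP; left; apply/eqP; ring.
Qed.

End Zero.
End PieceBound.

(** * From averages to sums over lines *)

Lemma holder_weights (R : realType) (I : finType) (a b : I -> R) (A : R) :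
  (forall i, 0 <= a i) -> \sum_i a i = A -> 0 < A ->
  (\sum_i a i * b i) ^+ 4 <= A ^+ 3 * \sum_i a i * b i ^+ 4.
Proof.
move=> a0 sA A0.
have cs (c : I -> R) : (\sum_i a i * c i) ^+ 2 <= A * \sum_i a i * c i ^+ 2.
  set s := \sum_i a i * c i; set q := \sum_i a i * c i ^+ 2.
  have h : 0 <= \sum_i a i * (A * c i - s) ^+ 2.
    by apply: sumr_ge0 => i _; rewrite mulr_ge0 ?sqr_ge0.
  have e : \sum_i a i * (A * c i - s) ^+ 2 = A * (A * q - s ^+ 2).
    transitivity (\sum_i (A ^+ 2 * (a i * c i ^+ 2) - 2 * A * s * (a i * c i) + s ^+ 2 * a i)).
      by apply: eq_bigr => i _; ring.
    rewrite big_split/= sumrB -!mulr_sumr sA -/s -/q; ring.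
  by move: h; rewrite e pmulr_rge0// subr_ge0.
have h1 := cs b; have h2 := cs (fun i => b i ^+ 2).
rewrite (exprM _ 2 2); apply: (@le_trans _ _ ((A * \sum_i a i * b i ^+ 2) ^+ 2)).
  rewrite lerXn2r// ?nnegrE ?sqr_ge0// mulr_ge0//; first exact: ltW.
  by apply: sumr_ge0 => i _; rewrite mulr_ge0 ?sqr_ge0.
rewrite exprMn (_ : 3 = 2 + 1)%N// exprD expr1 -mulrA; apply: ler_wpM2l; first exact: sqr_ge0.
by apply: le_trans h2 _; under eq_bigr => i _ do rewrite -exprM.
Qed.

Lemma per_sum (R : realType) (h : int -> R) (M : nat) (z : int) :
  (forall j, h (j + M%:Z)%R = h j) -> \sum_(k < M) h (k%:Z + z)%R = \sum_(k < M) h k%:Z.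
Proof.
move=> hp.
have step (y : int) : \sum_(k < M) h (k%:Z + (y + 1))%R = \sum_(k < M) h (k%:Z + y)%R.
  rewrite -(big_mkord xpredT (fun k => h (k%:Z + (y + 1))%R)) -(big_mkord xpredT (fun k => h (k%:Z + y)%R)).
  case: M hp => [|M] hp; first by rewrite !big_geq.
  rewrite big_nat_recr//= [RHS]big_nat_recl//= addrC; congr (_ + _).
    by rewrite -[RHS]hp; congr h; lia.
  by apply: eq_bigr => k _; congr h; lia.
have nat_case (p : nat) (y : int) : \sum_(k < M) h (k%:Z + (y + p%:Z))%R = \sum_(k < M) h (k%:Z + y)%R.
  elim: p => [|p IH]; first by rewrite addr0.
  by rewrite -[RHS]IH -(step (y + p)%R); apply: eq_bigr => k _; congr h; lia.
case: z => p.
  transitivity (\sum_(k < M) h (k%:Z + (0 + p%:Z))%R); first by apply: eq_bigr => k _; congr h; lia.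
  by rewrite nat_case; apply: eq_bigr => k _; congr h; lia.
transitivity (\sum_(k < M) h (k%:Z + (Negz p + p.+1%:Z))%R); first by rewrite nat_case.
by apply: eq_bigr => k _; congr h; lia.
Qed.

(** * Reproducing formula on the grid *)

Section Lower.
Variables (R : realType) (L n S N : nat).
Hypotheses (L0 : (0 < L)%N) (n0 : (0 < n)%N) (LS : (8 * S + 8 <= L)%N) (N0 : (0 < N)%N).
Hypothesis NL : (3 * N <= L * n)%N.
Notation V := (R * R * R)%type.
Notation gp := (@gridpt R L n).
Let M := (L * n * n)%N.
Let N' := (N * n)%N.

Let MR : (M%:R : R) = L%:R * n%:R * n%:R. Proof. by rewrite !natrM. Qed.
Let nn0 : (n%:R : R) != 0. Proof. by rewrite pnatr_eq0; lia. Qed.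
Let Ln0 : (L%:R : R) != 0. Proof. by rewrite pnatr_eq0; lia. Qed.
Let Nn0 : (N%:R : R) != 0. Proof. by rewrite pnatr_eq0; lia. Qed.
Let M0 : (0 < M)%N. Proof. by rewrite /M !muln_gt0 L0 n0. Qed.
Let N'0 : (0 < N')%N. Proof. by rewrite /N' muln_gt0 N0 n0. Qed.
Let N'M : (3 * N' <= M)%N. Proof. by rewrite /N' /M; nia. Qed.

(* Dominates the kernel of [2 avg_{2N'} - avg_{N'}], which reproduces frequencies up to [N']. *)
Definition vp (j : int) : R :=
  2 * (fej (2 * N') (j%:~R * ang R M) / (M%:R * (2 * N')%:R)) + fej N' (j%:~R * ang R M) / (M%:R * N'%:R).

Lemma vp_ge0 j : 0 <= vp j.
Proof. by rewrite /vp; apply: addr_ge0; [apply: mulr_ge0 => //|]; apply: divr_ge0; rewrite ?fej_ge0 ?mulr_ge0. Qed.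

Lemma vp_per j : vp (j + M%:Z)%R = vp j.
Proof.
have Mn0 : (M%:R : R) != 0 by rewrite pnatr_eq0; lia.
have e : ((j + M%:Z)%:~R * ang R M : R) = j%:~R * ang R M + 2 * pi * (1 : int)%:~R.
  by rewrite intrD -pmulrn /ang; field.
by rewrite /vp e !fejD2pi.
Qed.

Lemma sum_vp : \sum_(k < M) vp k%:Z = 3.
Proof.
rewrite /vp big_split/= -mulr_sumr !(avg_weight _ L0); [ring|lia|lia|lia|lia].
Qed.

Definition ax (i : 'I_3) (t : R) : V :=
  if i == 0 :> nat then (t, 0, 0) else if i == 1 :> nat then (0, t, 0) else (0, 0, t).

Definition coord (i : 'I_3) (u : V) : R :=
  if i == 0 :> nat then u.1.1 else if i == 1 :> nat then u.1.2 else u.2.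

Lemma dot_ax i u t : dot u (ax i t) = t * coord i u.
Proof.
rewrite /ax /coord /dot; case: (i == 0 :> nat) => /=; first by ring.
by case: (i == 1 :> nat) => /=; ring.
Qed.

Lemma sc_ax i a t : sc a (ax i t) = ax i (a * t).
Proof.
rewrite /sc /ax; case: (i == 0 :> nat) => /=; first by rewrite !mulr0.
by case: (i == 1 :> nat) => /=; rewrite !mulr0.
Qed.

Variables (P : V -> Prop) (F : V -> R).
Hypothesis sF : span L P F.
Hypothesis PN : forall u, P u -> forall i, lat n N' (coord i u).

(** The mean that reproduces F runs over a full period of the axis, in steps of 1/n. Its kernel is
    dominated by [vp], of mass 3, and the power mean inequality costs 3^3. *)
Lemma repro i x : F x ^+ 4 <= 27 * \sum_(k < M) vp k%:Z * F (x + ax i (k%:R / n%:R)) ^+ 4.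
Proof.
pose v := ax i (L%:R * n%:R).
have id : Top N' (2 * N') M v F x = F x.
  apply: (span_op_id x (Top_linear N' (2 * N') M v) _ sF) => u phi y /PN /(_ i) [k ek kN].
  have uv : dot u v = L%:R * k%:~R by rewrite /v dot_ax ek; field.
  have h1 : (N' < 2 * N')%N by lia.
  have h2 : (`|k| + 2 * N' <= M)%N by lia.
  by rewrite (Top_atom L0 phi y N'0 h1 h2 uv) (tau1 _ L0)// mul1r.
have Fle : `|F x| <= \sum_(k < M) vp k%:Z * `|F (x + ax i (k%:R / n%:R))|.
  have N'R : (N'%:R : R) != 0 by rewrite pnatr_eq0; lia.
  rewrite -{1}id /Top.
  have -> : (2 * N')%:R - N'%:R = N'%:R :> R by rewrite natrM; ring.
  rewrite mulrBl; apply: le_trans (ler_normB _ _) _.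
  have avle Q' : (0 < Q')%N -> `|avg Q' M v F x| <=
     \sum_(k < M) fej Q' (k%:R * ang R M) / (M%:R * Q'%:R) * `|F (x + ax i (k%:R / n%:R))|.
    move=> Q0; apply: le_trans (ler_norm_sum _ _ _) _; apply: ler_sum => k _.
    rewrite normrM ger0_norm; last by rewrite divr_ge0 ?fej_ge0 ?mulr_ge0.
    rewrite /v sc_ax (_ : k%:R / M%:R * (L%:R * n%:R) = k%:R / n%:R)//.
    by rewrite MR; field; rewrite nn0 Ln0.
  rewrite (_ : (2 * N')%:R * avg (2 * N') M v F x / N'%:R = 2 * avg (2 * N') M v F x); last by rewrite natrM; field.
  rewrite (_ : N'%:R * avg N' M v F x / N'%:R = avg N' M v F x); last by field.
  rewrite normrM ger0_norm//.
  have h2N : (0 < 2 * N')%N by lia.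
  apply: le_trans (lerD (ler_wpM2l (ler0n _ 2) (avle _ h2N)) (avle _ N'0)) _.
  rewrite mulr_sumr -big_split/= le_eqVlt; apply/orP; left; apply/eqP/eq_bigr => k _.
  by rewrite /vp -pmulrn; ring.
have h := @holder_weights R 'I_M (fun k => vp k%:Z) (fun k => `|F (x + ax i (k%:R / n%:R))|) 3
  (fun k => vp_ge0 _) sum_vp (ltr0n _ 3).
have -> : F x ^+ 4 = `|F x| ^+ 4 by rewrite -normrX ger0_norm// (exprM _ 2 2) sqr_ge0.
have -> : \sum_(k < M) vp k * F (x + ax i (k%:R / n%:R)) ^+ 4 =
  \sum_(k < M) vp k * `|F (x + ax i (k%:R / n%:R))| ^+ 4.
  by apply: eq_bigr => k _; rewrite -normrX [in RHS]ger0_norm// (exprM _ 2 2) sqr_ge0.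
apply: le_trans (_ : _ <= 3 ^+ 3 * _) _; last by rewrite le_eqVlt; apply/orP; left; apply/eqP; congr (_ * _); ring.
apply: le_trans h; rewrite lerXn2r ?nnegrE//.
by apply: sumr_ge0 => k _; rewrite mulr_ge0 ?vp_ge0.
Qed.

Definition ipt (z : int * int * int) : V := (z.1.1%:~R / n%:R, z.1.2%:~R / n%:R, z.2%:~R / n%:R).

Lemma ax_per i x : F (x + ax i (L%:R * n%:R)) = F x.
Proof.
elim: sF => [//|a u phi F' Pu _ IH]; congr (_ * _ + _) => //.
have [k ek _] := PN Pu i.
rewrite /atom dotDr dot_ax ek -[RHS](cos2piz _ k); congr cos.
by rewrite /ang; field; rewrite nn0 Ln0.
Qed.

(** One coordinate at a time. By periodicity a sum centred at z becomes a sum over the fixed grid,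
    so that z enters only through the kernels. *)
Lemma repro3 z : F (ipt z) ^+ 4 <= 27 ^+ 3 *
  \sum_(k1 < M) \sum_(k2 < M) \sum_(k3 < M)
    vp (k1%:Z - z.1.1) * vp (k2%:Z - z.1.2) * vp (k3%:Z - z.2) * F (ipt (k1%:Z, k2%:Z, k3%:Z)) ^+ 4.
Proof.
pose i0 : 'I_3 := @Ordinal 3 0 isT; pose i1 : 'I_3 := @Ordinal 3 1 isT; pose i2 : 'I_3 := @Ordinal 3 2 isT.
case: z => [[z1 z2] z3] /=.
have ip a b c : ipt (a, b, c) = (a%:~R / n%:R, b%:~R / n%:R, c%:~R / n%:R) by [].
have s1 a b c : F (ipt (a, b, c)) ^+ 4 <= 27 * \sum_(k < M) vp (k%:Z - a) * F (ipt (k%:Z, b, c)) ^+ 4.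
  apply: le_trans (repro i0 _) _; apply: ler_wpM2l => //.
  pose h (j : int) := vp (j - a) * F (ipt (j, b, c)) ^+ 4.
  rewrite -(@per_sum R h M a) => [|j]; last first.
    rewrite /h (_ : (j + M%:Z - a = (j - a) + M%:Z)%R); last by ring.
    rewrite vp_per; congr (_ * _ ^+ 4); rewrite -[RHS](ax_per i0) ip /ax /=; congr F.
    congr (_, _, _) => /=; rewrite ?addr0// intrD mulrDl; congr (_ + _).
    by rewrite -pmulrn MR; field.
  rewrite le_eqVlt; apply/orP; left; apply/eqP/eq_bigr => k _; rewrite /h addrK; congr (_ * F _ ^+ 4).
  by rewrite !ip /ax /=; congr (_, _, _) => /=; rewrite ?addr0// intrD mulrDl addrC.
have s2 a b c : F (ipt (a, b, c)) ^+ 4 <= 27 * \sum_(k < M) vp (k%:Z - b) * F (ipt (a, k%:Z, c)) ^+ 4.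
  apply: le_trans (repro i1 _) _; apply: ler_wpM2l => //.
  pose h (j : int) := vp (j - b) * F (ipt (a, j, c)) ^+ 4.
  rewrite -(@per_sum R h M b) => [|j]; last first.
    rewrite /h (_ : (j + M%:Z - b = (j - b) + M%:Z)%R); last by ring.
    rewrite vp_per; congr (_ * _ ^+ 4); rewrite -[RHS](ax_per i1) ip /ax /=; congr F.
    congr (_, _, _) => /=; rewrite ?addr0// intrD mulrDl; congr (_ + _).
    by rewrite -pmulrn MR; field.
  rewrite le_eqVlt; apply/orP; left; apply/eqP/eq_bigr => k _; rewrite /h addrK; congr (_ * F _ ^+ 4).
  by rewrite !ip /ax /=; congr (_, _, _) => /=; rewrite ?addr0// intrD mulrDl addrC.
have s3 a b c : F (ipt (a, b, c)) ^+ 4 <= 27 * \sum_(k < M) vp (k%:Z - c) * F (ipt (a, b, k%:Z)) ^+ 4.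
  apply: le_trans (repro i2 _) _; apply: ler_wpM2l => //.
  pose h (j : int) := vp (j - c) * F (ipt (a, b, j)) ^+ 4.
  rewrite -(@per_sum R h M c) => [|j]; last first.
    rewrite /h (_ : (j + M%:Z - c = (j - c) + M%:Z)%R); last by ring.
    rewrite vp_per; congr (_ * _ ^+ 4); rewrite -[RHS](ax_per i2) ip /ax /=; congr F.
    congr (_, _, _) => /=; rewrite ?addr0// intrD mulrDl; congr (_ + _).
    by rewrite -pmulrn MR; field.
  rewrite le_eqVlt; apply/orP; left; apply/eqP/eq_bigr => k _; rewrite /h addrK; congr (_ * F _ ^+ 4).
  by rewrite !ip /ax /=; congr (_, _, _) => /=; rewrite ?addr0// intrD mulrDl addrC.
apply: le_trans (s1 _ _ _) _; rewrite exprS -mulrA; apply: ler_wpM2l => //.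
rewrite mulr_sumr; apply: ler_sum => k1 _.
apply: le_trans (ler_wpM2l (vp_ge0 _) (s2 _ _ _)) _; rewrite expr2 -mulrA mulrCA; apply: ler_wpM2l => //.
rewrite !mulr_sumr; apply: ler_sum => k2 _.
apply: le_trans (ler_wpM2l (vp_ge0 _) (ler_wpM2l (vp_ge0 _) (s3 _ _ _))) _.
rewrite !mulr_sumr; apply: ler_sum => k3 _.
by rewrite le_eqVlt; apply/orP; left; apply/eqP; ring.
Qed.

End Lower.

Lemma sinD_sq_le (R : realType) (a b : R) : sin (a + b) ^+ 2 <= 2 * sin a ^+ 2 + 2 * sin b ^+ 2.
Proof.
rewrite sinD; have := cos2Dsin2 a; have := cos2Dsin2 b.
have ca := sqr_ge0 (cos a); have cb := sqr_ge0 (cos b).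
have sa := sqr_ge0 (sin a); have sb := sqr_ge0 (sin b).
have e x y : (x + y) ^+ 2 <= 2 * x ^+ 2 + 2 * y ^+ 2 :> R.
  by have := sqr_ge0 (x - y); rewrite !expr2; nra.
move=> h1 h2; apply: le_trans (e _ _) _; rewrite !exprMn; apply: lerD; apply: ler_wpM2l => //.
  rewrite -[leRHS]mulr1; apply: ler_wpM2l => //; move: h1 sb; clear; lra.
rewrite -[leRHS]mul1r; apply: ler_wpM2r => //; move: h2 sa; clear; lra.
Qed.

(** Writes the decay y^(-2) as a sum of indicators of dyadic ranges, which turns sums over lines
    into counts. *)
Lemma dyadic_layer (R : realType) (y : R) J : 0 <= y -> y <= 2 ^+ J ->
  (Num.max 1 (y ^+ 2))^-1 <= 4 * \sum_(j < J.+1) (4 ^- j) * (y <= 2 ^+ j)%R%:R.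
Proof.
move=> y0; have m0 : (0 : R) < Num.max 1 (y ^+ 2) by rewrite lt_max ltr01.
have m1 : (1 : R) <= Num.max 1 (y ^+ 2) by rewrite le_max lexx.
have t0 (j : nat) : (0 : R) <= (4 ^- j) * (y <= 2 ^+ j)%R%:R by rewrite mulr_ge0// invr_ge0 exprn_ge0.
elim: J => [|J IH] yJ.
  rewrite big_ord_recl big_ord0 addr0 expr0 invr1 mul1r yJ mulr1.
  by apply: (@le_trans _ _ 1); [rewrite invf_le1|rewrite ler1n].
rewrite big_ord_recr/= mulrDr; case: (lerP y (2 ^+ J)) => [/IH h|h].
  by apply: le_trans h _; rewrite lerDl mulr_ge0.
rewrite yJ mulr1; apply: (@le_trans _ _ (4 * 4 ^- J.+1)); last first.
  by rewrite lerDr mulr_ge0// sumr_ge0.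
rewrite (exprS (4 : R) J) invfM mulrA divff ?mul1r//.
rewrite lef_pV2 ?posrE ?exprn_gt0// le_max; apply/orP; right.
have -> : (4 : R) ^+ J = (2 ^+ J) ^+ 2.
  by rewrite -exprM mulnC exprM; congr (_ ^+ _); ring.
by rewrite lerXn2r ?nnegrE ?exprn_ge0// ltW.
Qed.

(** * Comparison of the kernel with the weight of the grid *)

Section Kernel.
Variables (R : realType) (L n S N : nat).
Hypotheses (L0 : (0 < L)%N) (n0 : (0 < n)%N) (LS : (8 * S + 8 <= L)%N) (N0 : (0 < N)%N).
Hypothesis NL : (3 * N <= L * n)%N.
Notation V := (R * R * R)%type.
Let M := (L * n * n)%N.
Let N' := (N * n)%N.
Notation vpk := (vp R L n N).

Let MR : (M%:R : R) = L%:R * n%:R * n%:R. Proof. by rewrite !natrM. Qed.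
Let nn0 : (n%:R : R) != 0. Proof. by rewrite pnatr_eq0; lia. Qed.
Let Ln0 : (L%:R : R) != 0. Proof. by rewrite pnatr_eq0; lia. Qed.
Let Nn0 : (N%:R : R) != 0. Proof. by rewrite pnatr_eq0; lia. Qed.
Let nR : (0 : R) < n%:R. Proof. by rewrite ltr0n. Qed.
Let LR : (0 : R) < L%:R. Proof. by rewrite ltr0n. Qed.
Let NR : (0 : R) < N%:R. Proof. by rewrite ltr0n. Qed.
Let MR0 : (0 : R) < M%:R. Proof. by rewrite MR !mulr_gt0. Qed.
Let N'R : (0 : R) < N'%:R. Proof. by rewrite natrM mulr_gt0. Qed.

(** Half of the grid angle, the argument that [fej_sin] calls for; its sine [snd_] serves as a
    distance modulo the period. *)
Definition hang (t : int) : R := pi * t%:~R / M%:R.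
Definition snd_ (t : int) : R := `|sin (hang t)|.
Definition mu (y : R) : R := (Num.max 1 (y ^+ 2))^-1.

Lemma mu_gt0 y : 0 < mu y.
Proof. by rewrite invr_gt0 lt_max ltr01. Qed.

Lemma mu_le1 y : mu y <= 1.
Proof. by rewrite invf_le1 ?le_max ?lexx// lt_max ltr01. Qed.

Lemma mu_sq y : mu y * y ^+ 2 <= 1.
Proof. by rewrite /mu mulrC ler_pdivrMr ?lt_max ?ltr01// mul1r le_max lexx orbT. Qed.

Lemma hangE t : t%:~R * ang R M = hang t *+ 2.
Proof. by rewrite /hang /ang mulr2n; field; rewrite gt_eqF. Qed.

Lemma fej_mu K' t : (N' <= K')%N -> fej K' (t%:~R * ang R M) <= K'%:R ^+ 2 * mu (N'%:R * snd_ t).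
Proof.
move=> NK; rewrite /mu ler_pdivlMr ?lt_max ?ltr01//.
case: (lerP 1 ((N'%:R * snd_ t) ^+ 2)) => h; last by rewrite mulr1 fej_le.
rewrite exprMn mulrCA hangE /snd_ real_normK ?num_real// fej_sin.
rewrite -[leRHS]mulr1; apply: ler_pM; rewrite ?sqr_ge0//.
by rewrite lerXn2r ?nnegrE// ler_nat.
Qed.

Lemma vp_mu t : vpk t <= 6 * N'%:R / M%:R * mu (N'%:R * snd_ t).
Proof.
have m0 := mu_gt0 (N'%:R * snd_ t).
have h1 := @fej_mu N' t (leqnn _); have h2 := @fej_mu (2 * N') t _.
have {}h2 := h2 (leq_pmull _ (isT : 0 < 2)%N).
set m := mu _ in m0 h1 h2 *.
have d1 : 0 <= (M%:R * N'%:R : R)^-1 by rewrite invr_ge0 mulr_ge0// ltW.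
have d2 : 0 <= (M%:R * (2 * N')%:R : R)^-1 by rewrite invr_ge0 mulr_ge0// ltW.
rewrite /vp; apply: le_trans (lerD (ler_wpM2l (ler0n _ 2) (ler_wpM2r d2 h2)) (ler_wpM2r d1 h1)) _.
have -> : 2 * ((2 * N')%:R ^+ 2 * m * (M%:R * (2 * N')%:R)^-1) + N'%:R ^+ 2 * m / (M%:R * N'%:R)
   = 5 * N'%:R / M%:R * m.
  by rewrite natrM; field; rewrite !gt_eqF.
apply: ler_wpM2r; first exact: ltW.
by apply: ler_wpM2r; [rewrite invr_ge0 ltW|apply: ler_wpM2r; [exact: ltW|rewrite ler_nat]].
Qed.

Lemma snd_sq_shift (j z : int) (c : R) :
  sin (hang j + c) ^+ 2 <= 2 * snd_ (j - z) ^+ 2 + 2 * (hang z + c) ^+ 2.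
Proof.
have -> : hang j + c = hang (j - z) + (hang z + c).
  by rewrite /hang intrB; field; rewrite gt_eqF.
apply: le_trans (sinD_sq_le _ _) _; apply: lerD; apply: ler_wpM2l => //.
  by rewrite /snd_ real_normK ?num_real.
exact: sin_sq_le.
Qed.

Lemma pi_le4 : (pi : R) <= 4.
Proof. by have := pihalf_lt2 R; rewrite ltr_pdivrMr// -natrM => /ltW. Qed.

(** The identity cos^2 + sin^2 = 1 at the angle n [hang j], where each square is a Fejer value times
    some sin^2. As [hang z] and the shift pi/(2n) are of order 1/n, both sin^2 are bounded by the
    squared distance from j to z plus n^(-2). *)
Lemma w1_low (j : nat) (z : int) : (`|z| <= S * n)%N ->
  1 <= w1 R L n j * (4 * snd_ (j%:Z - z) ^+ 2 + 20 / n%:R ^+ 2).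
Proof.
move=> zS.
have hz : `|hang z| <= 1 / n%:R.
  rewrite /hang !normrM normfV (gtr0_norm MR0) (gtr0_norm (pi_gt0 R)) ler_pdivrMr//.
  rewrite MR (_ : 1 / n%:R * (L%:R * n%:R * n%:R) = L%:R * n%:R); last by field.
  apply: (@le_trans _ _ (4 * (S%:R * n%:R))).
    apply: ler_pM => //; [exact: pi_ge0|exact: pi_le4|].
    by rewrite -natrM -intr_norm -abszE -pmulrn ler_nat.
  by rewrite mulrA; apply: ler_wpM2r; [exact: ltW|rewrite -natrM ler_nat; lia].
have hp : `|pi / (2 * n%:R)| <= 2 / n%:R :> R.
  rewrite ger0_norm; last by rewrite divr_ge0 ?pi_ge0 ?mulr_ge0.
  rewrite ler_pdivrMr ?mulr_gt0// (_ : 2 / n%:R * (2 * n%:R) = 4); last by field.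
  exact: pi_le4.
have s1 : sin (hang j%:Z) ^+ 2 <= 2 * snd_ (j%:Z - z) ^+ 2 + 2 / n%:R ^+ 2.
  have := snd_sq_shift j%:Z z 0; rewrite !addr0 => h; apply: le_trans h _.
  rewrite lerD2l; apply: ler_wpM2l => //.
  by rewrite -(@real_normK _ (hang z)) ?num_real// -exprVn lerXn2r ?nnegrE ?invr_ge0// -[leRHS]mul1r.
have s2 : sin (hang j%:Z + pi / (2 * n%:R)) ^+ 2 <= 2 * snd_ (j%:Z - z) ^+ 2 + 18 / n%:R ^+ 2.
  apply: le_trans (snd_sq_shift j%:Z z _) _; rewrite lerD2l.
  have h : `|hang z + pi / (2 * n%:R)| <= 3 / n%:R.
    apply: le_trans (ler_normD _ _) _; apply: le_trans (lerD hz hp) _.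
    by rewrite -mulrDl (_ : 1 + 2 = 3 :> R)//; ring.
  rewrite -(@real_normK _ (hang z + _)) ?num_real//.
  rewrite (_ : 18 / n%:R ^+ 2 = 2 * (3 / n%:R) ^+ 2); last by field.
  by apply: ler_wpM2l => //; rewrite lerXn2r ?nnegrE// divr_ge0.
have F1 : fej n (j%:R * ang R M + 0) * sin (hang j%:Z) ^+ 2 = sin (n%:R * hang j%:Z) ^+ 2.
  by rewrite addr0 (_ : j%:R * ang R M = hang j%:Z *+ 2) ?fej_sin// -hangE.
have F2 : fej n (j%:R * ang R M + pi / n%:R) * sin (hang j%:Z + pi / (2 * n%:R)) ^+ 2 =
   cos (n%:R * hang j%:Z) ^+ 2.
  have -> : j%:R * ang R M + pi / n%:R = (hang j%:Z + pi / (2 * n%:R)) *+ 2.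
    by rewrite mulrnDl -hangE -pmulrn; congr (_ + _); rewrite mulr2n; field.
  rewrite fej_sin (_ : n%:R * (hang j%:Z + pi / (2 * n%:R)) = n%:R * hang j%:Z + pi / 2); last by field.
  by rewrite sinDpihalf.
have one := cos2Dsin2 (n%:R * hang j%:Z); rewrite addrC -F1 -F2 in one.
rewrite -[leLHS]one /w1 -/M; move: s1 s2; have := fej_ge0 n (j%:R * ang R M + 0); have := fej_ge0 n (j%:R * ang R M + pi / n%:R).
set a := fej _ (_ + 0); set b := fej _ _; set x := sin _ ^+ 2; set y := sin _ ^+ 2; set s := snd_ _ ^+ 2.
have x0 : 0 <= x by exact: sqr_ge0.
have y0 : 0 <= y by exact: sqr_ge0.
move=> b0 a0 s1 s2; rewrite [leRHS]mulrDl.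
have e : 4 * s + 20 / n%:R ^+ 2 = (2 * s + 2 / n%:R ^+ 2) + (2 * s + 18 / n%:R ^+ 2) by field.
apply: lerD; apply: ler_wpM2l => //; rewrite e.
  by apply: le_trans s1 _; rewrite lerDl; exact: le_trans s2.
by apply: le_trans s2 _; rewrite lerDr; exact: le_trans s1.
Qed.

(** Where [w1] is small, the point is far from z and the decay of the kernel pays for it; this
    exchange leaves the term N^(-2). *)
Lemma vp_w1 (j : nat) (z : int) : (`|z| <= S * n)%N ->
  vpk (j%:Z - z) <= 120 * N%:R / (M%:R * n%:R) * w1 R L n j *
    (N%:R ^- 2 + mu (N'%:R * snd_ (j%:Z - z))).
Proof.
move=> zS; have hw := w1_low j zS; have hv := vp_mu (j%:Z - z).
set w := w1 R L n j in hw *; set s := snd_ _ in hw hv *.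
have m0 := ltW (mu_gt0 (N'%:R * s)); have m2 := mu_sq (N'%:R * s).
have w0 : 0 <= w by exact: w1_ge0.
apply: le_trans hv _; set m := mu _ in m0 m2 *.
have c0 : 0 <= 6 * N'%:R / M%:R :> R by rewrite divr_ge0 ?mulr_ge0.
apply: (@le_trans _ _ (6 * N'%:R / M%:R * m * (w * (4 * s ^+ 2 + 20 / n%:R ^+ 2)))).
  by rewrite ler_peMr ?mulr_ge0.
have -> : 6 * N'%:R / M%:R * m * (w * (4 * s ^+ 2 + 20 / n%:R ^+ 2)) =
  6 * N'%:R / M%:R * w * (4 / N'%:R ^+ 2 * (m * (N'%:R * s) ^+ 2) + 20 / n%:R ^+ 2 * m).
  by field; rewrite !gt_eqF.
have -> : 120 * N%:R / (M%:R * n%:R) * w * (N%:R ^- 2 + m) =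
  6 * N'%:R / M%:R * w * (20 / N'%:R ^+ 2 * 1 + 20 / n%:R ^+ 2 * m).
  have -> : (N'%:R : R) = N%:R * n%:R by rewrite /N' natrM.
  by field; rewrite !gt_eqF.
apply: ler_wpM2l; first by rewrite mulr_ge0.
rewrite lerD2r; apply: ler_pM; [exact/divr_ge0/sqr_ge0|exact/mulr_ge0/sqr_ge0| |exact: m2].
by apply: ler_wpM2r; [rewrite invr_ge0 sqr_ge0|rewrite ler_nat].
Qed.

(** Only the coordinate with the largest distance is kept: quadratic decay in the distance is enough
    against a quadratic count of lines. *)
Lemma prod3_le (a x y z d : R) : 0 <= a -> a <= 1 -> 0 <= x -> x <= 1 -> 0 <= y -> y <= 1 ->
  0 <= z -> z <= 1 -> [\/ x <= d, y <= d | z <= d] ->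
  (a + x) * (a + y) * (a + z) <= 4 * (a + d).
Proof.
move=> a0 a1 x0 x1 y0 y1 z0 z1 H.
have b (u : R) : 0 <= u -> u <= 1 -> 0 <= a + u /\ a + u <= 2.
  by move=> u0 u1; split; [exact: addr_ge0|apply: le_trans (lerD a1 u1) _; rewrite -natr1].
have [ax0 ax2] := b _ x0 x1; have [ay0 ay2] := b _ y0 y1; have [az0 az2] := b _ z0 z1.
have e (u v w : R) : 0 <= u -> 0 <= v -> 0 <= w -> u <= 2 -> v <= 2 -> w <= a + d -> u * v * w <= 4 * (a + d).
  move=> u0 v0 w0 u2 v2 wd; apply: ler_pM => //; first exact: mulr_ge0.
  have -> : (4 : R) = 2 * 2 by ring.
  exact: ler_pM.
case: H => h.
- by rewrite -mulrA mulrC; apply: e => //; rewrite lerD2l.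
- by rewrite mulrAC; apply: e => //; rewrite lerD2l.
- by apply: e => //; rewrite lerD2l.
Qed.

End Kernel.

(** * Counting lines near a grid point *)

Definition ibox (r : nat) (z z' : int * int * int) : bool :=
  [&& (`|(z'.1.1 - z.1.1)%R| <= r)%N, (`|(z'.1.2 - z.1.2)%R| <= r)%N & (`|(z'.2 - z.2)%R| <= r)%N].

(** Unlike the ball condition, r has no upper limit: large boxes are dealt with by a cover in
    [zof_box]. *)
Definition boxcond (C1 : nat) (Z : seq (int * int * int)) :=
  forall z r, z \in Z -> (0 < r)%N -> (count (ibox r z) Z <= C1 * r ^ 2)%N.

Section LowerBound.
Variables (R : realType) (L n S N J C1 : nat).
Hypotheses (L0 : (0 < L)%N) (n0 : (0 < n)%N) (LS : (8 * S + 8 <= L)%N) (N0 : (0 < N)%N).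
Hypothesis NL : (3 * N <= L * n)%N.
Hypothesis S0 : (0 < S)%N.
Let M := (L * n * n)%N.
Let N' := (N * n)%N.
Hypothesis NJ : (N' <= 2 ^ J)%N.
Variable Z : seq (int * int * int).
Hypothesis ZS : forall z, z \in Z -> [/\ (`|z.1.1| <= S * n)%N, (`|z.1.2| <= S * n)%N & (`|z.2| <= S * n)%N].
Hypothesis Zbox : boxcond C1 Z.
Notation snd := (snd_ R L n).
Notation hangR := (hang R L n).

Let MR : (M%:R : R) = L%:R * n%:R * n%:R. Proof. by rewrite !natrM. Qed.
Let N'E : (N'%:R : R) = N%:R * n%:R. Proof. by rewrite natrM. Qed.
Let nR : (0 : R) < n%:R. Proof. by rewrite ltr0n. Qed.
Let LR : (0 : R) < L%:R. Proof. by rewrite ltr0n. Qed.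
Let NR : (0 : R) < N%:R. Proof. by rewrite ltr0n. Qed.
Let MR0 : (0 : R) < M%:R. Proof. by rewrite MR !mulr_gt0. Qed.
Let N'R : (0 : R) < N'%:R. Proof. by rewrite natrM mulr_gt0. Qed.

Lemma snd_ge0 t : 0 <= snd t. Proof. exact: normr_ge0. Qed.

(** Points of modulus at most S n fill so small a part of the period that the half angle of a
    difference is at most 1; there the sine controls the difference itself. *)
Lemma sin_close (x z z0 : int) (j : nat) : (`|z| <= S * n)%N -> (`|z0| <= S * n)%N ->
  N'%:R * snd (x - z) <= 2 ^+ j -> N'%:R * snd (x - z0) <= 2 ^+ j ->
  (`|(z - z0)%R| <= (2 * L * n * 2 ^ j) %/ N)%N.
Proof.
move=> hz hz0 h1 h2.
have tS : (`|(z - z0)%R| <= 2 * S * n)%N by lia.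
set t := (z - z0)%R in tS *.
have hs : N'%:R * snd t <= 2 * 2 ^+ j.
  have e : hangR t = hangR (x - z0) - hangR (x - z).
    by rewrite /hang /t !intrB -/M; field; rewrite gt_eqF.
  have : snd t <= snd (x - z0) + snd (x - z).
    rewrite /snd_ e sinB; apply: le_trans (ler_normB _ _) _; rewrite !normrM.
    apply: lerD; first by rewrite ler_piMr// cos_max.
    by rewrite ler_piMl// cos_max.
  move=> /(ler_wpM2l (ltW N'R)) h; apply: le_trans h _.
  by rewrite mulrDr; move: h1 h2; rewrite (_ : 2 * 2 ^+ j = 2 ^+ j + 2 ^+ j :> R); [move=> *; exact: lerD|ring].
have hE : `|hangR t| = pi * `|t|%:R / M%:R.
  rewrite /hang -/M !normrM normfV (gtr0_norm MR0) (gtr0_norm (pi_gt0 R)).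
  by rewrite -intr_norm -abszE -pmulrn.
have h1' : `|hangR t| <= 1.
  rewrite hE ler_pdivrMr// mul1r MR.
  apply: (@le_trans _ _ (4 * (2 * S * n)%:R)).
    by apply: ler_pM => //; [exact: pi_ge0|exact: pi_le4|rewrite ler_nat].
  by rewrite -!natrM ler_nat; nia.
have hh : `|hangR t| <= 2 * snd t.
  rewrite -(@ler_pXn2r _ 2)// ?nnegrE ?mulr_ge0 ?snd_ge0//.
  have h := sin_sq_ge h1'; rewrite ler_pdivrMr// in h.
  rewrite exprMn /snd_ !real_normK ?num_real//; apply: le_trans h _.
  by rewrite le_eqVlt; apply/orP; left; apply/eqP; ring.
rewrite leq_divRL// -(ler_nat R) !natrM natrX.
have : N'%:R * `|hangR t| <= 4 * 2 ^+ j.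
  apply: le_trans (ler_wpM2l (ltW N'R) hh) _; rewrite mulrCA.
  by rewrite (_ : 4 * 2 ^+ j = 2 * (2 * 2 ^+ j) :> R); [exact: ler_wpM2l|ring].
rewrite hE => h.
have h3 : N'%:R * (2 * `|t|%:R / M%:R) <= 4 * 2 ^+ j :> R.
  apply: le_trans h; apply: ler_wpM2l; first exact: ltW.
  by apply: ler_wpM2r; [rewrite invr_ge0 ltW|apply: ler_wpM2r => //; exact: pi_ge2].
have := ler_wpM2r (ltW (mulr_gt0 LR nR)) h3.
rewrite (_ : N'%:R * (2 * `|t|%:R / M%:R) * (L%:R * n%:R) = 2 * (`|t|%:R * N%:R)); last first.
  by rewrite N'E MR; field; rewrite !gt_eqF.
rewrite (_ : 4 * 2 ^+ j * (L%:R * n%:R) = 2 * (2 * L%:R * n%:R * 2 ^+ j)); last by ring.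
by rewrite ler_pM2l.
Qed.

Variables x1 x2 x3 : int.
Definition dist3 (z : int * int * int) : R :=
  Num.max (snd (x1 - z.1.1)) (Num.max (snd (x2 - z.1.2)) (snd (x3 - z.2))).

Lemma count_layer j : (count (fun z => N'%:R * dist3 z <= 2 ^+ j)%R Z)%:R <=
  C1%:R * (2 * L%:R * n%:R * 2 ^+ j / N%:R) ^+ 2 :> R.
Proof.
set p := fun z => _.
have pE z : p z -> [/\ N'%:R * snd (x1 - z.1.1) <= 2 ^+ j, N'%:R * snd (x2 - z.1.2) <= 2 ^+ j
   & N'%:R * snd (x3 - z.2) <= 2 ^+ j].
  by rewrite /p => h; split; apply: le_trans h; apply: ler_wpM2l; rewrite ?(ltW N'R)// /dist3 !le_max lexx ?orbT.
(* The point x need not belong to Z, so the box is centred at some element of the layer. *)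
case: (boolP (has p Z)) => [/hasP[z0 z0Z pz0]|]; last first.
  rewrite has_count -leqNgt leqn0 => /eqP ->.
  by rewrite mulr_ge0 ?sqr_ge0.
pose r := ((2 * L * n * 2 ^ j) %/ N)%N.
have r0 : (0 < r)%N.
  rewrite divn_gt0//; apply: (@leq_trans (L * n)); first by lia.
  rewrite (_ : (2 * L * n * 2 ^ j = L * n * (2 * 2 ^ j))%N); last by ring.
  by rewrite leq_pmulr// muln_gt0 expn_gt0.
have le1 : (count p Z <= count (ibox r z0) Z)%N.
  rewrite (@eq_in_count _ p [pred z | (z \in Z) && p z]); last by move=> z zZ; rewrite /= zZ.
  apply: sub_count => z /= /andP[zZ pz].
  have [a1 a2 a3] := pE z pz; have [b1 b2 b3] := pE z0 pz0.
  have [? ? ?] := ZS zZ; have [? ? ?] := ZS z0Z.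
  by apply/and3P; split; [apply: sin_close a1 b1|apply: sin_close a2 b2|apply: sin_close a3 b3].
have le2 := leq_trans le1 (Zbox z0Z r0).
apply: (@le_trans _ _ (C1 * r ^ 2)%:R); first by rewrite ler_nat.
rewrite natrM natrX; apply: ler_wpM2l => //.
rewrite lerXn2r ?nnegrE ?divr_ge0 ?mulr_ge0 ?exprn_ge0//.
by rewrite ler_pdivlMr// -natrX -!natrM ler_nat leq_trunc_div.
Qed.

Lemma snd_le1 t : snd t <= 1. Proof. by rewrite /snd_ sin_max. Qed.

Lemma size_le : (size Z <= C1 * (2 * S * n) ^ 2)%N.
Proof.
case: Z ZS Zbox => // z0 Z' ZS' Zbox'.
have r0 : (0 < 2 * S * n)%N by nia.
have h := Zbox' z0 _ (mem_head _ _) r0.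
apply: leq_trans h; rewrite -[leqLHS]count_predT.
rewrite leq_eqVlt; apply/orP; left; apply/eqP/eq_in_count => z zZ.
have [? ? ?] := ZS' _ zZ; have [? ? ?] := ZS' _ (mem_head _ _).
have ab (a b : int) k : (`|a| <= k)%N -> (`|b| <= k)%N -> (`|(a - b)%R| <= 2 * k)%N by lia.
by rewrite /ibox; symmetry; apply/and3P; split; rewrite -mulnA; exact: ab.
Qed.

(** The layer j has weight 4^(-j) and at most a multiple of (2^j n/N)^2 points, so all layers
    contribute alike and the loss is one logarithm. *)
Lemma sum_mu : \sum_(z <- Z) (N%:R ^- 2 + mu (N'%:R * dist3 z)) <=
  20 * C1%:R * L%:R ^+ 2 * J.+1%:R * (n%:R / N%:R) ^+ 2.
Proof.
have d0 z : 0 <= dist3 z by rewrite /dist3 le_max snd_ge0.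
have d1 z : dist3 z <= 1 by rewrite /dist3 !ge_max !snd_le1.
rewrite big_split/=.
have h1 : \sum_(z <- Z) N%:R ^- 2 <= 4 * C1%:R * L%:R ^+ 2 * J.+1%:R * (n%:R / N%:R) ^+ 2 :> R.
  have -> : \sum_(z <- Z) N%:R ^- 2 = (size Z)%:R * N%:R ^- 2 :> R.
    by rewrite big_const_seq count_predT iter_addr_0 mulr_natl.
  rewrite expr_div_n mulrA; apply: ler_wpM2r; first by rewrite invr_ge0 sqr_ge0.
  rewrite -!natrX -!natrM ler_nat; apply: leq_trans size_le _.
  have SL : (S <= L)%N by lia.
  have : (S ^ 2 <= L ^ 2 * J.+1)%N by apply: leq_trans (leq_pmulr _ _) => //; rewrite leq_exp2r.
  rewrite (_ : (C1 * (2 * S * n) ^ 2 = 4 * C1 * (S ^ 2) * n ^ 2)%N); last by rewrite !expnMn; lia.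
  by move=> h; rewrite leq_mul2r -[X in (_ <= X)%N]mulnA leq_mul2l h !orbT.
have h2 : \sum_(z <- Z) mu (N'%:R * dist3 z) <= 16 * C1%:R * L%:R ^+ 2 * J.+1%:R * (n%:R / N%:R) ^+ 2.
  apply: (@le_trans _ _ (\sum_(z <- Z) 4 * \sum_(j < J.+1) (4 ^- j) * (N'%:R * dist3 z <= 2 ^+ j)%R%:R)).
    apply: ler_sum => z _; apply: dyadic_layer; first by rewrite mulr_ge0// ltW.
    apply: (@le_trans _ _ (N'%:R * 1)); first by apply: ler_wpM2l; rewrite ?(ltW N'R).
    by rewrite mulr1 -natrX ler_nat.
  rewrite -mulr_sumr exchange_big/=.
  apply: (@le_trans _ _ (4 * \sum_(j < J.+1) 4 * C1%:R * L%:R ^+ 2 * (n%:R / N%:R) ^+ 2)).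
    apply: ler_wpM2l => //; apply: ler_sum => j _; rewrite -mulr_sumr.
    have -> : \sum_(z <- Z) (N'%:R * dist3 z <= 2 ^+ j)%R%:R =
      (count (fun z => N'%:R * dist3 z <= 2 ^+ j)%R Z)%:R :> R.
      by rewrite -sum1_count natr_sum [RHS]big_mkcond; apply: eq_bigr => z _; case: ifP.
    apply: le_trans (ler_wpM2l _ (count_layer j)) _; first by rewrite invr_ge0 exprn_ge0.
    rewrite le_eqVlt; apply/orP; left; apply/eqP.
    rewrite (_ : (4 : R) ^- j = (2 ^+ j) ^- 2).
      have t0 : (2 ^+ j : R) != 0 by rewrite expf_neq0// pnatr_eq0.
      move: (2 ^+ j : R) t0 => y t0; field; rewrite t0 gt_eqF//.
    by rewrite -exprM mulnC exprM; congr (_ ^+ _)^-1; ring.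
  rewrite sumr_const card_ord -[_ *+ J.+1]mulr_natr le_eqVlt; apply/orP; left; apply/eqP; ring.
apply: le_trans (lerD h1 h2) _.
by rewrite le_eqVlt; apply/orP; left; apply/eqP; ring.
Qed.

End LowerBound.

Section LowerFinal.
Variables (R : realType) (L n S N J C1 : nat).
Hypotheses (L0 : (0 < L)%N) (n0 : (0 < n)%N) (LS : (8 * S + 8 <= L)%N) (N0 : (0 < N)%N).
Hypothesis NL : (3 * N <= L * n)%N.
Hypothesis S0 : (0 < S)%N.
Hypothesis NJ : (N * n <= 2 ^ J)%N.
Notation V := (R * R * R)%type.
Let M := (L * n * n)%N.
Variable Z : seq (int * int * int).
Hypothesis ZS : forall z, z \in Z -> [/\ (`|z.1.1| <= S * n)%N, (`|z.1.2| <= S * n)%N & (`|z.2| <= S * n)%N].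
Hypothesis Zbox : boxcond C1 Z.
Variables (P : V -> Prop) (F : V -> R).
Hypothesis sF : span L P F.
Hypothesis PN : forall u, P u -> forall i, lat n (N * n) (coord i u).

Lemma lower_bound : \sum_(z <- Z) F (ipt R n z) ^+ 4 <=
  27 ^+ 3 * ((120 * N%:R / (M%:R * n%:R)) ^+ 3 * (4 * (20 * C1%:R * L%:R ^+ 2 * J.+1%:R * (n%:R / N%:R) ^+ 2)))
    * lam (@gridW R L n) (fun t => F (@gridpt R L n t) ^+ 4).
Proof.
set B := _ ^+ 3 * (4 * _).
apply: (@le_trans _ _ (\sum_(z <- Z) 27 ^+ 3 *
  \sum_(k1 < M) \sum_(k2 < M) \sum_(k3 < M)
    vp R L n N (k1%:Z - z.1.1) * vp R L n N (k2%:Z - z.1.2) * vp R L n N (k3%:Z - z.2) *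
      F (ipt R n (k1%:Z, k2%:Z, k3%:Z)) ^+ 4)).
  by apply: ler_sum => z _; exact: (repro3 L0 n0 LS N0 NL sF PN).
rewrite -mulr_sumr -mulrA; apply: ler_wpM2l; first by rewrite exprn_ge0.
rewrite exchange_big /lam mulr_sumr.
pose H (k1 k2 k3 : nat) := B * (w1 R L n k1 * w1 R L n k2 * w1 R L n k3 *
  F (k1%:R / n%:R, k2%:R / n%:R, k3%:R / n%:R) ^+ 4).
rewrite [leRHS](_ : _ = \sum_(t : 'I_M * 'I_M * 'I_M) H t.1.1 t.1.2 t.2); last exact: eq_bigr.
rewrite (sum_grid L n H); apply: ler_sum => k1 _.
rewrite exchange_big; apply: ler_sum => k2 _; rewrite exchange_big; apply: ler_sum => k3 _.
rewrite -mulr_suml /H [leRHS]mulrA; apply: ler_wpM2r.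
  by rewrite (exprM _ 2 2) sqr_ge0.
set w := w1 R L n k1 * w1 R L n k2 * w1 R L n k3.
have w0 : 0 <= w by rewrite !mulr_ge0 ?w1_ge0.
pose c : R := 120 * N%:R / (M%:R * n%:R).
have c0 : 0 <= c by rewrite divr_ge0 ?mulr_ge0.
apply: (@le_trans _ _ (c ^+ 3 * w * (\sum_(z <- Z) 4 * (N%:R ^- 2 +
  mu ((N * n)%:R * dist3 R L n k1%:Z k2%:Z k3%:Z z))))); last first.
  rewrite -mulr_sumr (_ : B * w = c ^+ 3 * w * (4 * (20 * C1%:R * L%:R ^+ 2 * J.+1%:R * (n%:R / N%:R) ^+ 2))); last by rewrite /B -/c; ring.
  apply: ler_wpM2l; first by rewrite mulr_ge0 ?exprn_ge0.
  by apply: ler_wpM2l => //; exact: (sum_mu R L0 n0 LS N0 NL S0 NJ ZS Zbox).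
rewrite mulr_sumr big_seq [leRHS]big_seq; apply: ler_sum => z zZ.
have [h1 h2 h3] := ZS zZ.
have v1 := vp_w1 R L0 n0 LS N0 NL k1 h1; have v2 := vp_w1 R L0 n0 LS N0 NL k2 h2.
have v3 := vp_w1 R L0 n0 LS N0 NL k3 h3.
set a := N%:R ^- 2 in v1 v2 v3 *.
have a0 : 0 <= a :> R by rewrite invr_ge0 sqr_ge0.
have a1 : a <= 1 :> R by rewrite invf_le1 ?exprn_gt0 ?ltr0n// expr_ge1// ler1n.
set m1 := mu _ in v1; set m2 := mu _ in v2; set m3 := mu _ in v3.
apply: le_trans (ler_pM _ _ (ler_pM _ _ v1 v2) v3) _; rewrite ?mulr_ge0 ?vp_ge0//.
rewrite [leLHS](_ : _ = c ^+ 3 * w * ((a + m1) * (a + m2) * (a + m3))); last by rewrite /w -/c; ring.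
apply: ler_wpM2l; first by rewrite mulr_ge0 ?exprn_ge0.
apply: prod3_le => //; try exact: (ltW (mu_gt0 _)); try exact: mu_le1.
rewrite /dist3; set s1 := snd_ _ _ _ _; set s2 := snd_ _ _ _ _; set s3 := snd_ _ _ _ _.
have ms u v : u = v -> mu u <= mu v :> R by move=> ->.
case: (lerP s1 (Num.max s2 s3)) => [_|_]; last by apply: Or31; apply: ms.
by case: (lerP s2 s3) => _; [apply: Or33|apply: Or32]; apply: ms.
Qed.

End LowerFinal.

(** * Geometric nodes and logarithms *)

Section Nodes.
Variable Q : nat.
Hypothesis Q0 : (0 < Q)%N.

(** Ratio about 1 + 1/Q; starting at Q keeps every increment positive in spite of the rounding. *)
Fixpoint node j := if j is j'.+1 then (node j' + node j' %/ Q)%N else Q.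

Lemma node_geQ j : (Q <= node j)%N.
Proof. by elim: j => //= j IH; apply: leq_trans IH (leq_addr _ _). Qed.

Lemma node_gt0 j : (0 < node j)%N.
Proof. exact: leq_trans (node_geQ j). Qed.

Lemma node_lt j : (node j < node j.+1)%N.
Proof. by rewrite /= -{1}(addn0 (node j)) ltn_add2l divn_gt0// node_geQ. Qed.

Lemma node_mono i j : (i <= j)%N -> (node i <= node j)%N.
Proof. by apply: (@homo_leq _ node leq leqnn leq_trans) => k; exact: ltnW (node_lt k). Qed.

Lemma node_le2 j : (node j.+1 <= 2 * node j)%N.
Proof. by rewrite /= mul2n -addnn leq_add2l leq_div. Qed.

Lemma node_step j : (node j <= 2 * Q * (node j.+1 - node j))%N.
Proof.
rewrite /= addKn; set d := (node j %/ Q)%N.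
have h3 : (Q <= Q * d)%N by rewrite leq_pmulr// divn_gt0// node_geQ.
rewrite [leqLHS](divn_eq _ Q) -/d; have := ltn_pmod (node j) Q0.
by move: (node j %% Q)%N => r rQ; rewrite -mulnA mul2n -addnn mulnC leq_add2l; apply: leq_trans (ltnW rQ) _.
Qed.

Lemma node_ratio (R : realType) j :
  ((node j.+1 + node j)%:R <= (4 * Q + 1)%:R * (node j.+1 - node j)%:R :> R).
Proof.
rewrite -natrM ler_nat; have := node_step j; have := ltnW (node_lt j); lia.
Qed.

Lemma node_double j : (2 * node j <= node (j + 2 * Q))%N.
Proof.
have H k : (k <= 2 * Q)%N -> (2 * Q * node j + k * node j <= 2 * Q * node (j + k))%N.
  elim: k => [|k IH] kQ; first by rewrite addn0 mul0n addn0.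
  rewrite mulSn addnCA addnS; apply: leq_trans (leq_add (leqnn _) (IH (ltnW kQ))) _.
  have h1 := node_step (j + k); have h2 := node_mono (leq_addr k j).
  have h3 := ltnW (node_lt (j + k)).
  have : (2 * Q * (node (j + k).+1 - node (j + k)) = 2 * Q * node (j + k).+1 - 2 * Q * node (j + k))%N.
    by rewrite mulnBr.
  have h4 : (2 * Q * node (j + k) <= 2 * Q * node (j + k).+1)%N by rewrite leq_mul2l h3 orbT.
  lia.
have := H (2 * Q)%N (leqnn _); rewrite -mulnDr leq_pmul2l; [lia|lia].
Qed.

Lemma node_exp i : (2 ^ i <= node (2 * Q * i))%N.
Proof.
elim: i => [|i IH]; first by rewrite muln0 expn0.
rewrite expnS; apply: (@leq_trans (2 * node (2 * Q * i))); first by rewrite leq_mul2l.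
by rewrite mulnS addnC node_double.
Qed.

Lemma node_reach x : (0 < x)%N -> exists J, [/\ (x <= node J)%N, (node J <= 2 * (Q + x))%N,
  (forall p, (p < J)%N -> (node p <= x)%N) & (J <= 2 * Q * (trunc_log 2 x).+1)%N].
Proof.
move=> x0.
have ex : exists j, (x <= node j)%N.
  exists (2 * Q * (trunc_log 2 x).+1)%N; apply: leq_trans (node_exp _).
  by apply: ltnW; apply: trunc_log_ltn.
case: (ex_minnP ex) => J hJ minJ; exists J; split => //.
- case: J hJ minJ => [|J] hJ minJ; first by rewrite /=; lia.
  apply: leq_trans (node_le2 J) _; rewrite leq_mul2l; apply/orP; right.
  have : ~~ (x <= node J)%N by apply/negP => /minJ; rewrite ltnn.
  by rewrite -ltnNge => /ltnW h; apply: leq_trans h (leq_addl _ _).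
- by move=> p pJ; apply: ltnW; rewrite ltnNge; apply/negP => /minJ; rewrite leqNgt pJ.
- apply: minJ; apply: leq_trans (node_exp _).
  by apply: ltnW; apply: trunc_log_ltn.
Qed.

End Nodes.

Section LogBound.
Variable R : realType.

(** For k > 0, an exponential with base 2^(eps/k) > 1 dominates t + 1 up to a constant; its k-th
    power is (2^t)^eps, and 2^t <= x. *)
Lemma trunc_log_powR (eps : R) k : 0 < eps -> exists2 C : R, 0 < C &
  forall x, (0 < x)%N -> ((trunc_log 2 x).+1%:R : R) ^+ k <= C * x%:R `^ eps.
Proof.
move=> e0.
case: k => [|k].
  exists 1 => // x x0; rewrite expr0 mul1r.
  have h : (x%:R : R) `^ 0 <= x%:R `^ eps by apply: ler_powR; [rewrite ler1n|exact: ltW].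
  by rewrite powRr0 in h.
pose y : R := 2 `^ (eps / k.+1%:R).
have y1 : 1 < y.
  have a0 : 0 < eps / k.+1%:R by rewrite divr_gt0.
  have h := @gt0_ltr_powR R _ a0 1 2; rewrite powR1 in h.
  by apply: h; rewrite ?nnegrE// ltr1n.
pose d := y - 1; have d0 : 0 < d by rewrite subr_gt0.
pose c : R := 1 + d^-1; have c0 : 0 < c by rewrite addr_gt0 ?invr_gt0.
have c1 : 1 <= c by rewrite lerDl invr_ge0 ltW.
have cd : 1 <= c * d by rewrite mulrDl mul1r mulVf ?gt_eqF// lerDr ltW.
exists (c ^+ k.+1); first by rewrite exprn_gt0.
move=> x x0; set t := trunc_log 2 x.
have h1 : (t.+1%:R : R) <= c * y ^+ t.
  elim: t => [|t IH]; first by rewrite expr0 mulr1.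
  rewrite -natr1 exprS (_ : y * y ^+ t = y ^+ t + d * y ^+ t); last by rewrite /d; ring.
  rewrite mulrDr; apply: lerD => //; rewrite mulrA; apply: mulr_ege1 => //.
  by rewrite exprn_ege1// ltW.
have y0 : 0 <= y by rewrite ltW// (lt_trans ltr01).
apply: (@le_trans _ _ ((c * y ^+ t) ^+ k.+1)).
  by rewrite lerXn2r ?nnegrE// mulr_ge0 ?exprn_ge0// ltW.
rewrite exprMn; apply: ler_wpM2l; first by rewrite exprn_ge0// ltW.
rewrite -exprM mulnC exprM.
have -> : y ^+ k.+1 = 2 `^ eps.
  by rewrite -powR_mulrn// /y -powRrM mulrVK ?unitfE ?pnatr_eq0.
rewrite -powR_mulrn ?powR_ge0// -powRrM mulrC powRrM powR_mulrn ?ler0n//.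
apply: ge0_ler_powR; rewrite ?nnegrE ?exprn_ge0//; first exact: ltW.
by rewrite -natrX ler_nat trunc_logP.
Qed.

(** Supplies the branching number of the tree, for which the constant of one step is at most
    m^eps. *)
Lemma powR_nat_bound (eps : R) (c : R) : 0 < eps -> exists m : nat, c <= m%:R `^ eps.
Proof.
move=> e0; case: (lerP c 1) => c1.
  by exists 1%N; rewrite powR1.
have c0 : 0 < c by exact: lt_trans c1.
exists (Num.truncn (c `^ eps^-1)).+1.
have h : c `^ eps^-1 <= (Num.truncn (c `^ eps^-1)).+1%:R.
  by apply: ltW; exact: truncnS_gt.
have e : c = (c `^ eps^-1) `^ eps by rewrite -powRrM mulVf ?gt_eqF// powRr1// ltW.
rewrite [leLHS]e.
by apply: ge0_ler_powR; rewrite ?nnegrE ?powR_ge0//; apply: ltW.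
Qed.

End LogBound.

(** * The estimate for all frequencies *)

Lemma freq_bounds (R : realFieldType) (t e1 e2 A B s : R) : 0 <= s -> `|t| <= s -> `|e1| <= A ->
  `|e2 - t * e1| <= B -> [/\ `|e1| <= (s + 1) ^+ 2 * (A + B), `|e2 + t * e1| <= (s + 1) ^+ 2 * (A + B) &
  `|t * e2| <= (s + 1) ^+ 2 * (A + B)].
Proof.
move=> s0 ts eA eB; have A0 : 0 <= A by exact: le_trans eA. 
have B0 : 0 <= B by exact: le_trans eB.
have te : `|t * e1| <= s * A by rewrite normrM ler_pM.
have h2 : `|e2| <= B + s * A.
  by rewrite -(subrK (t * e1) e2); apply: le_trans (ler_normD _ _) (lerD eB te).
have h3 : `|t * e2| <= s * (B + s * A) by rewrite normrM ler_pM.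
have sA : 0 <= s * A by exact: mulr_ge0.
have sB : 0 <= s * B by exact: mulr_ge0.
have ssA : 0 <= s * (s * A) by exact: mulr_ge0.
have ssB : 0 <= s * (s * B) by exact: mulr_ge0.
have e : (s + 1) ^+ 2 * (A + B) = s * (s * A) + s * (s * B) + 2 * (s * A) + 2 * (s * B) + A + B by ring.
have h4 := ler_normD e2 (t * e1).
by rewrite e; split; lra.
Qed.

Lemma two_steps (R : realFieldType) (a b c q : R) : q * (b - a) <= a -> q * (c - b) <= b -> 1 <= a ->
  a <= b -> b <= c -> 3 <= q -> [/\ 1 <= a, a <= c, c <= 2 * a & (c - a) * q <= 3 * a].
Proof.
move=> s1 s2 a0 h01 h12 q3.
have d1 : b - a <= a by apply: le_trans s1; apply: ler_peMl; lra.
have k : (c - a) * q <= 3 * a by lra.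
have d2 : 3 * (c - a) <= 3 * a by apply: le_trans k; rewrite mulrC; apply: ler_wpM2l; lra.
split => //; lra.
Qed.

Section Core.
Variables (R : realType) (L n S m K J Jb C1 : nat).
(** With this ratio two consecutive increments of nodes satisfy the thinness condition of
    [step_bound]; see [two_steps]. *)
Let Q := ((m + 1) ^ 2)%N.
Hypotheses (S0 : (0 < S)%N) (n0 : (0 < n)%N) (m8 : (8 <= m)%N) (mS : (8 * S <= m)%N).
Hypothesis HL : (24 * (S + 1) ^ 2 * (Q + S + 1) <= L)%N.
Hypotheses (hK : (m ^ K <= 2 * S * m * n)%N) (hK1 : (m ^ K.-1 <= 2 * S * n)%N)
  (hK2 : (2 * S * n < m ^ K)%N).
Hypotheses (hJ : ((S + 1) * n <= node Q J)%N) (hJ1 : (node Q J <= 2 * (Q + (S + 1) * n))%N)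
  (hJ2 : forall p, (p < J)%N -> (node Q p <= (S + 1) * n)%N).
Hypothesis hJb : (L * n * n <= 2 ^ Jb)%N.
Variable Kp : nat -> nat -> nat -> bool.
Notation V := (R * R * R)%type.
Notation nd := (node Q).
Notation gp := (@gridpt R L n).
Notation W := (@gridW R L n).
Let M := (L * n * n)%N.

Let Q0 : (0 < Q)%N. Proof. by rewrite expn_gt0 addn1. Qed.
Let Q3 : (3 <= Q)%N. Proof. by rewrite /Q -mulnn; nia. Qed.
Let LS8 : (8 * S + 8 <= L)%N.
Proof.
apply: leq_trans HL; have -> : (24 * (S + 1) ^ 2 * (Q + S + 1) = (8 * S + 8) * (3 * (S + 1) * (Q + S + 1)))%N by ring.
by rewrite leq_pmulr// !addn1 !muln_gt0.
Qed.
Let LS : (4 * S + 8 <= L)%N. Proof. by apply: leq_trans LS8; lia. Qed.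
Let L0 : (0 < L)%N. Proof. by apply: leq_trans LS; lia. Qed.
Let nn0 : (n%:R : R) != 0. Proof. by rewrite pnatr_eq0; lia. Qed.
Let Ln0 : (L%:R : R) != 0. Proof. by rewrite pnatr_eq0; lia. Qed.

(** [vh] and [vb i] are dual to the coefficients h and b at the time i. The extra n in [vb] makes
    the products integral multiples of L, since b lies in (1/n)Z. *)
Definition vh : V := (L%:R, 0, 0).
Definition vb (i : nat) : V := (- 2 * tm R n S i * (L%:R * n%:R), L%:R * n%:R, 0).
(** Largest frequency plus largest node, the number of samples that excludes aliasing in [avg_atom];
    likewise for [Mb]. *)
Definition Mh := (n + nd J.+1)%N.
Definition Mb := ((S + 1) * n * n + n * nd J.+1)%N.
Definition fsb i := HH nd n Mb (vb i).
Definition gpq p q i := HH nd 1 Mh vh p (fsb i q (fs L n S Kp i)).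
Definition lowend p : R := if p is p'.+1 then (nd p')%:R else 0.

Lemma dot_vh i e1 e2 : dot (freq R n S i e1 e2) vh = L%:R * e1%:~R.
Proof. by rewrite /dot /=; ring. Qed.

Lemma dot_vb i e1 e2 : dot (freq R n S i e1 e2) (vb i) = L%:R * (n%:R * (e2%:~R - tm R n S i * e1%:~R)).
Proof. by rewrite /dot /=; ring. Qed.

Lemma band_int i e1 e2 : (i <= 2 * S * n)%N -> (`|e1| < n)%N -> (`|e2| < n)%N ->
  exists2 k : int, n%:R * (e2%:~R - tm R n S i * e1%:~R) = k%:~R & (`|k| <= (S + 1) * n * n)%N.
Proof.
move=> iS h1 h2; rewrite (tm_int R L0 n0 LS); set z : int := (i%:Z - _)%R.
have zS : (`|z| <= S * n)%N by rewrite /z; lia.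
clearbody z; exists (e2 * n%:Z - z * e1)%R; first by rewrite intrB !intrM -!pmulrn; field.
have : (`|(z * e1)%R| <= S * n * n)%N by rewrite abszM leq_mul// ltnW.
have : (`|(e2 * n%:Z)%R| <= n * n)%N by rewrite abszM leq_mul// ltnW.
lia.
Qed.

Lemma fs_dot_vb i q u : (q <= J)%N -> fs_freq n S i u ->
  exists2 k : int, dot u (vb i) = L%:R * k%:~R :> R & (`|k| <= (S + 1) * n * n)%N && (`|k| + n * nd q.+1 <= Mb)%N.
Proof.
move=> qJ [iS [e1 [e2 [-> h1 h2]]]]; have [k ek kb] := band_int iS h1 h2.
exists k; first by rewrite dot_vb ek.
rewrite kb andTb /Mb.
apply: leq_add => //; rewrite leq_mul2l.
by rewrite node_mono ?orbT.
Qed.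

Lemma fs_dot_vh i p u : (p <= J)%N -> fs_freq n S i u ->
  exists2 k : int, dot u vh = L%:R * k%:~R :> R & (`|k| < n)%N && (`|k| + 1 * nd p.+1 <= Mh)%N.
Proof.
move=> pJ [iS [e1 [e2 [-> h1 h2]]]].
exists e1; first by rewrite dot_vh.
by rewrite h1 andTb mul1n /Mh; apply: leq_add; [exact: ltnW|exact: node_mono].
Qed.

Lemma fsb_span i q : (q <= J)%N -> span L (fun u => fs_freq n S i u /\ exists k : int,
   [/\ dot u (vb i) = L%:R * k%:~R, (`|k| < n * nd q.+1)%N & (q == 0)%N || (n * nd q.-1 < `|k|)%N])
   (fsb i q (fs L n S Kp i)).
Proof.
move=> qJ; apply: (HH_span L0 n0 (node_gt0 Q0) (node_lt Q0) (fs_span R L0 n0 LS Kp i)) => u hu.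
by have [k e /andP[_ h]] := fs_dot_vb qJ hu; exists k.
Qed.

Lemma lowend_le p (k : nat) : (p == 0)%N || (nd p.-1 < k)%N -> lowend p <= k%:R.
Proof. by case: p => [|p] /= h; [|rewrite ler_nat ltnW]. Qed.

Lemma gpq_span p q i : (p <= J)%N -> (q <= J)%N ->
  span L (pfreq n S (lowend p) (nd p.+1)%:R (lowend q) (nd q.+1)%:R i) (gpq p q i).
Proof.
move=> pJ qJ.
have h : forall u, (fs_freq n S i u /\ exists k : int,
   [/\ dot u (vb i) = L%:R * k%:~R, (`|k| < n * nd q.+1)%N & (q == 0)%N || (n * nd q.-1 < `|k|)%N]) ->
   exists2 k : int, dot u vh = L%:R * k%:~R & (`|k| + 1 * nd p.+1 <= Mh)%N.
  by move=> u [hu _]; have [k e /andP[_ hk]] := fs_dot_vh pJ hu; exists k.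
apply: sub_span (HH_span L0 (ltn0Sn 0) (node_gt0 Q0) (node_lt Q0) (fsb_span i qJ) h) => u.
move=> [[[iS [e1 [e2 [-> h1 h2]]]] [kb [eb b1 b2]]] [ka [ea a1 a2]]].
have Lcancel (x y : R) : L%:R * x = L%:R * y -> x = y by exact: mulfI.
move: ea eb; rewrite dot_vh dot_vb => /Lcancel ea /Lcancel eb.
have nR : (0 : R) < n%:R by rewrite ltr0n.
have normE (k : int) : `|k%:~R : R| = `|k|%:R by rewrite -intr_norm -abszE -pmulrn.
split => //; exists e1, e2; split => //.
  rewrite ea normE; apply/andP; split; first by apply: lowend_le; rewrite !mul1n in a2.
  by rewrite ler_nat ltnW// -(mul1n (nd _)).
have bE : e2%:~R - tm R n S i * e1%:~R = kb%:~R / n%:R by rewrite -eb; field.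
rewrite bE normrM normE normfV normr_nat; apply/andP; split.
  rewrite ler_pdivlMr//; case: (q) b2 => [|q'] /= b2; first by rewrite mul0r.
  by rewrite -natrM ler_nat mulnC ltnW.
by rewrite ler_pdivrMr// -natrM ler_nat mulnC ltnW.
Qed.

Lemma sum_gpq i x : \sum_(p < J.+1) \sum_(q < J.+1) gpq p q i x = fs L n S Kp i x.
Proof.
rewrite exchange_big /=.
have -> : fs L n S Kp i x = \sum_(q < J.+1) fsb i q (fs L n S Kp i) x.
  symmetry; apply: (sum_HH_id L0 n0 (node_gt0 Q0) (node_lt Q0) x (fs_span R L0 n0 LS Kp i)) => u hu.
  have [k e /andP[h1 h2]] := fs_dot_vb (leqnn J) hu; exists k => //.
  by rewrite h2 andbT; apply: leq_trans h1 _; rewrite mulnC leq_mul2l hJ orbT.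
apply: eq_bigr => q _; have qJ : (q <= J)%N by rewrite -ltnS.
apply: (sum_HH_id L0 (ltn0Sn 0) (node_gt0 Q0) (node_lt Q0) x (fsb_span i qJ)) => u [hu _].
have [k e /andP[h1 h2]] := fs_dot_vh (leqnn J) hu; exists k => //.
rewrite h2 andbT mul1n; apply: leq_trans (ltnW h1) _; apply: leq_trans hJ.
by rewrite leq_pmull// addn1.
Qed.

Let r : R := (4 * Q + 1)%:R.
Definition Gc : R := (2 * r) * ((2 * r) * 1).
Definition al0 i : R := (Kcount L n S Kp i)%:R * (lam W (fun=> 1) / n%:R ^+ 2).

Lemma al0_ge0 i : 0 <= al0 i.
Proof. by rewrite mulr_ge0// divr_ge0 ?sqr_ge0// lam_ge0// => t; exact: gridW_ge0. Qed.

Lemma gpq_good p q i : (p <= J)%N -> (q <= J)%N -> good W gp (L%:R ^+ 2) (al0 i) Gc (gpq p q i).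
Proof.
move=> pJ qJ; have r0 : 0 <= r by [].
have b0 : 0 <= L%:R ^+ 2 :> R by exact: sqr_ge0.
have a0 := al0_ge0 i.
apply: (good_HH L0 (@gridW_ge0 R L n) vh (ltn0Sn 0) (node_gt0 Q0) (node_lt Q0)
  (node_ratio Q0 R)) => //; first by rewrite mul1n /Mh; apply: leq_trans (leq_addl _ _); exact: node_mono.
  by rewrite !mulr_ge0.
apply: (good_HH L0 (@gridW_ge0 R L n) (vb i) n0 (node_gt0 Q0) (node_lt Q0)
  (node_ratio Q0 R)) => //.
  by rewrite /Mb; apply: leq_trans (leq_addl _ _); rewrite leq_mul2l node_mono ?orbT.
exact: (fs_good L0 n0 LS).
Qed.

Definition FV p q (x : V) : R := \sum_(i < m ^ K) gpq p q i x.

Let kap : nat := (S ^ 2 + S + 1)%N.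

Lemma choose_c q : (q < J)%N -> exists c : nat,
  2 * (S%:R ^+ 2 + S%:R + 1) * n%:R <= c%:R * (nd q)%:R :> R /\
  (2 * c + 1)%:R * (nd q)%:R <= (4 * (S%:R ^+ 2 + S%:R + 1) + 3 * (S%:R + 1)) * n%:R :> R.
Proof.
move=> qJ; have d0 := node_gt0 Q0 q; have dn := hJ2 qJ.
exists ((2 * kap * n) %/ nd q).+1.
have h1 := ltnW (ltn_ceil (2 * kap * n) d0); have h2 := leq_trunc_div (2 * kap * n) (nd q).
have kE : (S%:R ^+ 2 + S%:R + 1 : R) = kap%:R by rewrite /kap !natrD natrX.
rewrite kE natr1 -!natrM -!natrD -!natrM !ler_nat; split => //.
move: h2; move: (_ %/ _)%N => d h2.
rewrite (_ : (2 * d.+1 + 1) * nd q = 2 * (d * nd q) + 3 * nd q)%N; last by ring.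
rewrite mulnDl; apply: leq_add; last by rewrite -mulnA leq_mul2l; move: dn; rewrite addn1.
by rewrite (_ : 4 * kap * n = 2 * (2 * kap * n))%N ?leq_mul2l//; ring.
Qed.

Lemma node_ge_le4 q : ((nd q.+2)%:R <= 4 * (nd q)%:R :> R).
Proof.
rewrite -natrM ler_nat; apply: leq_trans (node_le2 Q _) _.
by rewrite (_ : 4 = 2 * 2)%N// -mulnA leq_mul2l node_le2.
Qed.

Lemma node_two p : [/\ 1 <= (nd p)%:R :> R, (nd p)%:R <= (nd p.+2)%:R :> R,
  (nd p.+2)%:R <= 2 * (nd p)%:R :> R & ((nd p.+2)%:R - (nd p)%:R) * (m%:R + 1) ^+ 2 <= 3 * (nd p)%:R :> R].
Proof.
have QR : (m%:R + 1 : R) ^+ 2 = Q%:R by rewrite natrX natrD.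
have Q3R : (3 : R) <= Q%:R by rewrite ler_nat.
have st j : Q%:R * ((nd j.+1)%:R - (nd j)%:R) <= (nd j)%:R :> R.
  by rewrite -natrB ?(ltnW (node_lt Q0 j))// -natrM ler_nat /= addKn mulnC leq_trunc_div.
have s1 := st p; have s2 := st p.+1.
have a0 : 1 <= (nd p)%:R :> R by rewrite ler1n node_gt0.
have h01 : (nd p)%:R <= (nd p.+1)%:R :> R by rewrite ler_nat ltnW// node_lt.
have h12 : (nd p.+1)%:R <= (nd p.+2)%:R :> R by rewrite ler_nat ltnW// node_lt.
rewrite QR; exact: two_steps s1 s2 a0 h01 h12 Q3R.
Qed.

Definition Lpc := piece_const R S m Q.
Definition Ysum : R := (Gc * L%:R ^+ 2) ^+ 3 * \sum_(i < m ^ K) Gc * al0 i.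

(** For p = 0 the band contains h = 0. For p > 0 the comparison of B'^2 with 4 (S + 1)^2 A decides,
    except that q = 0 always falls into the first regime, B' being at most 2Q and A at least Q. *)
Lemma L4pq p q : (p <= J)%N -> (q <= J)%N ->
  lam W (fun t => FV p q (gp t) ^+ 4) * ((nd p.+1)%:R + (nd q.+1)%:R) <=
  C0 R ^+ K * (Lpc * n%:R ^+ 3 * Ysum).
Proof.
move=> pJ qJ.
have e : lam W (fun t => FV p q (gp t) ^+ 4) =
  lam W (fun t => blk m (fun i t => gpq p q i (gp t)) 0 K t ^+ 4) by exact: eq_lam.
have gS i := gpq_span i pJ qJ.
have Gc0 : 0 <= Gc by rewrite /Gc; nonneg.
have G0 : 0 <= Gc * L%:R ^+ 2 by nonneg.
have gG i x : `|gpq p q i x| <= Gc * L%:R ^+ 2 by have [h _] := gpq_good i pJ qJ.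
have ga i : lam W (fun t => `|gpq p q i (gp t)|) <= Gc * al0 i.
  have [_ h] := gpq_good i pJ qJ; apply: le_trans (h 0).
  by rewrite le_eqVlt; apply/orP; left; apply/eqP/eq_lam => t; rewrite addr0.
have nd2 : (nd 1)%:R <= 2 * Q%:R :> R by rewrite -natrM ler_nat; exact: (node_le2 Q 0).
have S1n x : (x <= (S + 1) * n)%N -> x%:R <= (S%:R + 1) * n%:R :> R.
  by move=> h; rewrite natr1 -natrM ler_nat -addn1.
rewrite e; case: p pJ gS gG ga {e} => [|p] pJ gS gG ga.
  have A'0 : 0 < (nd 1)%:R :> R by rewrite ltr0n node_gt0.
  case: q qJ gS gG ga => [|q] qJ gS gG ga.
    exact: (piece_bound_a0 L0 n0 LS S0 m8 mS hK hK1 Q0 G0 gG ga gS A'0 nd2 (ler0n _ _) nd2).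
  have [c [c1 c2]] := choose_c qJ.
  apply: (piece_bound_b0 L0 n0 LS S0 m8 mS hK hK1 Q0 G0 gG ga gS A'0 nd2 (ler0n _ _) _ _ c1 c2).
    by rewrite ler_nat node_geQ.
  exact: node_ge_le4.
have [a1 a2 a3 a4] := node_two p; have an := S1n _ (hJ2 pJ).
case: q qJ gS gG ga => [|q] qJ gS gG ga.
  apply: (piece_bound_a L0 n0 LS S0 m8 mS hK hK1 Q0 G0 gG ga gS a1 a2 a3 a4 an (ler0n _ _)).
  apply: (@le_trans _ _ (4 * Q%:R * (nd p)%:R)); last first.
    by apply: ler_wpM2r => //; rewrite lerDl; nonneg.
  apply: (@le_trans _ _ ((2 * Q%:R) ^+ 2)); first by rewrite lerXn2r ?nnegrE//; nonneg.
  rewrite exprMn expr2 -expr2 (_ : 2 ^+ 2 * Q%:R ^+ 2 = 4 * Q%:R * Q%:R :> R); last by ring.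
  by apply: ler_wpM2l; [nonneg|rewrite ler_nat node_geQ].
case: (lerP ((nd q.+2)%:R ^+ 2 : R) (4 * (S%:R + 1) ^+ 2 * (nd p)%:R)) => hb.
  apply: (piece_bound_a L0 n0 LS S0 m8 mS hK hK1 Q0 G0 gG ga gS a1 a2 a3 a4 an (ler0n _ _)).
  by apply: le_trans hb _; apply: ler_wpM2r => //; rewrite lerDr; nonneg.
have [c [c1 c2]] := choose_c qJ.
have b0 : 0 < lowend q.+1 by rewrite ltr0n node_gt0.
exact: (piece_bound_b L0 n0 LS S0 m8 mS hK hK1 Q0 G0 gG ga gS a1 a2 a3 a4 an (ler0n _ _) hb b0 (node_ge_le4 q) c1 c2).
Qed.

Definition NN p q := ((S + 1) ^ 2 * (nd p.+1 + nd q.+1))%N.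

Lemma pfreq_coord p q i u : pfreq n S (lowend p) (nd p.+1)%:R (lowend q) (nd q.+1)%:R i u ->
  forall k, lat n (NN p q * n) (coord (R := R) k u).
Proof.
move=> pu k; have [v1 v2 v3] := pfreq_vlat L0 n0 LS pu.
have [iS [e1 [e2 [ue _ /andP[_ hA] /andP[_ hB]]]]] := pu.
have ht := tm_abs R n0 iS.
have nR : (0 : R) < n%:R by rewrite ltr0n.
suff [] : [/\ `|u.1.1| <= (NN p q)%:R, `|u.1.2| <= (NN p q)%:R & `|u.2| <= (NN p q)%:R].
  have st B a : lat n B a -> `|a| <= (NN p q)%:R -> lat n (NN p q * n) a.
    move=> [j -> _] h; exists j => //; move: h.
    rewrite normrM normfV normr_nat ler_pdivrMr ?ltr0n//.
    by rewrite -intr_norm -abszE -pmulrn -natrM ler_nat.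
  by move=> b1 b2 b3; rewrite /coord; case: ifP => _; [exact: st v1 _|case: ifP => _; [exact: st v2 _|exact: st v3 _]].
rewrite ue /freq [_.1.1]/= [_.1.2]/= [_.2]/= /NN natrM natrX (natrD _ S) (natrD _ (nd _)).
move: (tm R n S i) (e1%:~R : R) (e2%:~R : R) (nd p.+1)%:R (nd q.+1)%:R (S%:R : R) (ler0n R S) ht hA hB.
exact: freq_bounds.
Qed.

Lemma FV_span p q : (p <= J)%N -> (q <= J)%N -> span L (fun u => exists i,
  pfreq n S (lowend p) (nd p.+1)%:R (lowend q) (nd q.+1)%:R i u) (FV p q).
Proof.
move=> pJ qJ; apply: span_sum => i _; apply: sub_span (gpq_span i pJ qJ) => u hu.
by exists i.
Qed.

Definition Ctot : R := 27 ^+ 3 * 120 ^+ 3 * 80 * 8 * C1%:R * L%:R ^+ 2 * (S%:R + 1) ^+ 2 * Lpc *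
  ((Gc * L%:R ^+ 2) ^+ 3 * Gc).

Variable Z : seq (int * int * int).
Hypothesis ZS : forall z, z \in Z -> [/\ (`|z.1.1| <= S * n)%N, (`|z.1.2| <= S * n)%N & (`|z.2| <= S * n)%N].
Hypothesis Zbox : boxcond C1 Z.

Lemma core_piece p q : (p <= J)%N -> (q <= J)%N -> \sum_(z <- Z) FV p q (ipt R n z) ^+ 4 <=
  Ctot * Jb.+1%:R * C0 R ^+ K * n%:R ^+ 3 * (\sum_(i < m ^ K) Kcount L n S Kp i)%:R.
Proof.
move=> pJ qJ.
have NN0 : (0 < NN p q)%N by rewrite /NN muln_gt0 expn_gt0 addn1 addn_gt0 node_gt0.
have NL : (3 * NN p q <= L * n)%N.
  apply: (@leq_trans (24 * (S + 1) ^ 2 * (Q + S + 1) * n)); last by rewrite leq_mul2r HL orbT.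
  have hp : (nd p.+1 <= 2 * nd J)%N by apply: leq_trans (node_mono Q0 _) (node_le2 Q J).
  have hq : (nd q.+1 <= 2 * nd J)%N by apply: leq_trans (node_mono Q0 _) (node_le2 Q J).
  apply: (@leq_trans (3 * ((S + 1) ^ 2 * (4 * nd J)))).
    by rewrite leq_mul2l leq_mul2l; apply/orP; right; apply/orP; right; move: hp hq; lia.
  apply: (@leq_trans (3 * ((S + 1) ^ 2 * (8 * (Q + (S + 1) * n))))).
    by rewrite leq_mul2l leq_mul2l; apply/orP; right; apply/orP; right; move: hJ1; lia.
  rewrite (_ : 24 * _ * _ * n = 3 * ((S + 1) ^ 2 * (8 * ((Q + S + 1) * n))))%N; last by ring.
  rewrite !leq_mul2l; apply/orP; right; apply/orP; right.
  by rewrite -addnA [leqRHS]mulnDl leq_add2r leq_pmulr.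
have NJ : (NN p q * n <= 2 ^ Jb)%N.
  by apply: leq_trans hJb; rewrite leq_mul2r; apply/orP; right; apply: leq_trans NL; lia.
apply: le_trans (lower_bound L0 n0 LS8 NN0 NL S0 NJ ZS Zbox (FV_span pJ qJ) _) _.
  by move=> u [i hu]; exact: pfreq_coord hu.
have h := L4pq pJ qJ; have NR : (0 : R) < (NN p q)%:R by rewrite ltr0n.
have NE : (NN p q)%:R = (S%:R + 1) ^+ 2 * ((nd p.+1)%:R + (nd q.+1)%:R) :> R.
  by rewrite natrM natrX !natrD.
have MR : (M%:R : R) = L%:R * n%:R * n%:R by rewrite !natrM.
have Mn : (M%:R * n%:R : R) != 0 by rewrite MR !mulf_neq0.
(* In [lower_bound], N^3 from the kernels and N^(-2) from the count leave one factor N, which is (S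
   + 1)^2 times the sum of the two band ends that [L4pq] controls. *)
pose c : R := 27 ^+ 3 * 120 ^+ 3 * 80 * C1%:R * L%:R ^+ 2 * Jb.+1%:R * (S%:R + 1) ^+ 2 * n%:R ^+ 2 / (M%:R * n%:R) ^+ 3.
have c0 : 0 <= c by rewrite /c; nonneg.
apply: le_trans (_ : c * (lam W (fun t => FV p q (gp t) ^+ 4) * ((nd p.+1)%:R + (nd q.+1)%:R)) <= _).
  rewrite le_eqVlt; apply/orP; left; apply/eqP; rewrite /c.
  move: NE (gt_eqF NR) => /[dup] NE1; move: ((nd p.+1)%:R + _) NE1 => w NE1 _ Nn.
  have N2 : ((NN p q)%:R : R) != 0 by rewrite Nn.
  have -> : forall x : R, c * x = x * c by move=> x; rewrite mulrC.
  rewrite /c; move: N2; rewrite NE1; move: (lam _ _) (M%:R : R) Mn => l M' Mn.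
  rewrite mulf_eq0 negb_or => /andP[s2 w0].
  by field; rewrite w0 -[X in _ && X]andbT; move: Mn s2; rewrite mulf_eq0 negb_or sqrf_eq0 => /andP[-> ->] ->.
apply: le_trans (ler_wpM2l c0 h) _.
rewrite /Ysum -mulr_sumr /al0 -mulr_suml -natr_sum (lam_gridW1 R L0 n0 LS) -/M /c /Ctot.
rewrite le_eqVlt; apply/orP; left; apply/eqP.
move: (M%:R : R) Mn => M' Mn; move: Mn; rewrite mulf_eq0 negb_or => /andP[M1 N1].
by field; rewrite M1 N1.
Qed.

(** Of the eight logarithms, six come from convexity of the fourth power over two indices and two
    from adding up the bounds for all pairs of bands. *)
Lemma core_ineq : \sum_(z <- Z) (\sum_(i < m ^ K) fs L n S Kp i (ipt R n z)) ^+ 4 <=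
  J.+1%:R ^+ 8 * (Ctot * Jb.+1%:R * C0 R ^+ K * n%:R ^+ 3 * (\sum_(i < m ^ K) Kcount L n S Kp i)%:R).
Proof.
set B := Ctot * _ * _ * _ * _.
have e z : \sum_(i < m ^ K) fs L n S Kp i (ipt R n z) =
    \sum_(p < J.+1) \sum_(q < J.+1) FV p q (ipt R n z).
  under eq_bigr => i _ do rewrite -sum_gpq.
  rewrite /FV exchange_big; apply: eq_bigr => p _.
  by rewrite exchange_big.
apply: (@le_trans _ _ (\sum_(z <- Z) J.+1%:R ^+ 6 * \sum_(p < J.+1) \sum_(q < J.+1) FV p q (ipt R n z) ^+ 4)).
  apply: ler_sum => z _; rewrite e; apply: le_trans (sum_pow4_le _) _.
  rewrite (exprD _ 3 3) -mulrA; apply: ler_wpM2l; first exact: exprn_ge0.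
  by rewrite mulr_sumr; apply: ler_sum => p _; exact: sum_pow4_le.
rewrite -mulr_sumr (exprD _ 6 2) -mulrA; apply: ler_wpM2l; first exact: exprn_ge0.
rewrite exchange_big (eq_bigr (fun p : 'I_J.+1 => \sum_(q < J.+1) \sum_(z <- Z) FV p q (ipt R n z) ^+ 4)); last first.
  by move=> p _; rewrite exchange_big.
apply: (@le_trans _ _ (\sum_(p < J.+1) \sum_(q < J.+1) B)).
  by apply: ler_sum => p _; apply: ler_sum => q _; apply: core_piece; rewrite -ltnS.
by rewrite !sumr_const !card_ord -[_ *+ _ *+ _]mulr_natl -[B *+ _]mulr_natl mulrA.
Qed.

End Core.

(** * From incidences to values of the bumps *)

Lemma bump_near (R : realType) (L n C2 : nat) (y : R) (j : int) : (0 < L)%N -> (0 < n)%N -> (8 * C2 <= L)%N ->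
  `|y - j%:~R * L%:R| <= C2%:R / n%:R -> 4^-1 <= bump L n y.
Proof.
move=> L0 n0 LC hy; have LR : (0 : R) < L%:R by rewrite ltr0n.
have nR : (0 : R) < n%:R by rewrite ltr0n.
rewrite /bump -(subrK (j%:~R * L%:R) y) mulrDr.
have -> : ang R L * (j%:~R * L%:R) = 2 * pi * j%:~R by rewrite /ang; field; rewrite gt_eqF.
rewrite fejD2pi ler_pdivlMr ?exprn_gt0// mulrC; apply: fej_ge.
rewrite normrM ger0_norm; last by rewrite /ang; rewrite divr_ge0 ?mulr_ge0 ?pi_ge0.
apply: (@le_trans _ _ (n%:R * (ang R L * (C2%:R / n%:R)))).
  apply: ler_wpM2l => //; apply: ler_wpM2l => //; by rewrite /ang divr_ge0 ?mulr_ge0 ?pi_ge0.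
rewrite (_ : _ * _ = 2 * pi * C2%:R / L%:R); last by rewrite /ang; field; rewrite !gt_eqF.
rewrite ler_pdivrMr// mul1r; apply: (@le_trans _ _ (8 * C2%:R)).
  by apply: ler_wpM2r => //; have := pi_le4 R; lra.
by rewrite -natrM ler_nat.
Qed.

Lemma fs_hit (R : realType) (L n S C2 i : nat) (Kp : nat -> nat -> nat -> bool) (x : R * R * R) c1 c2 (j1 j2 : int) :
  (0 < L)%N -> (0 < n)%N -> (8 * C2 <= L)%N -> (i <= 2 * S * n)%N -> (c1 < L * n)%N -> (c2 < L * n)%N -> Kp i c1 c2 ->
  `|(prj n S i x).1 - c1%:R / n%:R - j1%:~R * L%:R| <= C2%:R / n%:R ->
  `|(prj n S i x).2 - c2%:R / n%:R - j2%:~R * L%:R| <= C2%:R / n%:R ->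
  16^-1 <= fs L n S Kp i x.
Proof.
move=> L0 n0 LC iS h1 h2 kp b1 b2; rewrite /fs iS mul1r (bigD1 (Ordinal h1)) //= (bigD1 (Ordinal h2)) //= kp mul1r.
have s1 := bump_near L0 n0 LC b1; have s2 := bump_near L0 n0 LC b2.
have q0 : (0 : R) <= 4^-1 by [].
have hh := ler_pM q0 q0 s1 s2.
apply: (@le_trans _ _ (4^-1 * 4^-1)); first by lra.
apply: le_trans hh _; rewrite -[leRHS]addrA lerDl addr_ge0//; first by apply: sumr_ge0 => ? _; rewrite mulr_ge0// mulr_ge0// bump_ge0.
by apply: sumr_ge0 => ? _; apply: sumr_ge0 => ? _; rewrite mulr_ge0// mulr_ge0// bump_ge0.
Qed.

Lemma core_absorb (R : realFieldType) (d Ct X1 X2 X3 e N k a b c : R) : 0 <= d -> 0 <= Ct -> 0 <= N -> 0 <= k ->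
  0 <= e -> 0 <= X1 -> 0 <= X2 -> 0 <= X3 -> 0 <= a -> 0 <= b -> 0 <= c ->
  a <= X1 * e -> b <= X2 * (e * e) -> c <= X3 * e ->
  d * (a * (Ct * b * c * N * k)) <= d * (X1 * (Ct * X2 * X3)) * N * (e * (e * e) * e) * k.
Proof.
move=> d0 Ct0 N0 k0 e0 x1 x2 x3 a0 b0 c0 ha hb hc.
rewrite (_ : d * (a * _) = d * Ct * N * k * (a * (b * c))); last by ring.
rewrite (_ : d * _ * N * _ * k = d * Ct * N * k * (X1 * e * (X2 * (e * e) * (X3 * e)))); last by ring.
apply: ler_wpM2l; first by nonneg.
by apply: ler_pM => //; [exact: mulr_ge0|exact: ler_pM].
Qed.

(* [z] encodes n (A, B, D), [i] a time, and [(c1, c2)] a cell of side 1/n of the plane modulo L;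
   [Kp] lists the cells that are occupied at the time [i]. *)
Theorem core (R : realType) (eps : R) (S C1 C2 : nat) : 0 < eps -> (0 < S)%N ->
  exists (C : R) (L : nat), [/\ 0 <= C, (0 < L)%N & forall (n : nat) (Z : seq (int * int * int)) (Kp : nat -> nat -> nat -> bool)
    (h : int * int * int -> nat -> bool), (0 < n)%N ->
    (forall z, z \in Z -> [/\ (`|z.1.1| <= S * n)%N, (`|z.1.2| <= S * n)%N & (`|z.2| <= S * n)%N]) ->
    boxcond C1 Z ->
    (forall z i, z \in Z -> (i <= 2 * S * n)%N -> h z i -> exists c1 c2, [/\ (c1 < L * n)%N, (c2 < L * n)%N, Kp i c1 c2 &
      exists j1 j2 : int, `|(prj n S i (ipt R n z)).1 - c1%:R / n%:R - j1%:~R * L%:R| <= C2%:R / n%:R /\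
        `|(prj n S i (ipt R n z)).2 - c2%:R / n%:R - j2%:~R * L%:R| <= C2%:R / n%:R]) ->
    \sum_(z <- Z) (\sum_(i < (2 * S * n).+1) h z i)%:R ^+ 4 <=
      C * n%:R ^+ 3 * n%:R `^ eps * (\sum_(i < (2 * S * n).+1) \sum_(c1 < L * n) \sum_(c2 < L * n) Kp i c1 c2)%:R].
Proof.
(* Four losses n^e: one from the logarithms in J, two from the logarithm of L n^2, one from the
   powers of [C0]. *)
move=> e0 S0; pose e := eps / 4; have e'0 : 0 < e by rewrite divr_gt0.
have [m0 hm0] := powR_nat_bound (C0 R) e'0.
pose m := (m0 + 8 * S + 8)%N.
have m8 : (8 <= m)%N by rewrite leq_addl.
have mS : (8 * S <= m)%N by rewrite /m; lia.
have hm : C0 R <= m%:R `^ e.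
  by apply: le_trans hm0 _; apply: ge0_ler_powR; rewrite ?nnegrE ?ler0n ?ler_nat ?ltW// /m -addnA leq_addr.
(* The first summand leaves room for all frequencies in one period; the second keeps a bump above
   1/4 at distance C2/n from its centre. *)
pose Q := ((m + 1) ^ 2)%N; pose L := (24 * (S + 1) ^ 2 * (Q + S + 1) + 8 * C2)%N.
have HL : (24 * (S + 1) ^ 2 * (Q + S + 1) <= L)%N by rewrite leq_addr.
have LC : (8 * C2 <= L)%N by rewrite leq_addl.
have Q0 : (0 < Q)%N by rewrite expn_gt0 addn1.
have L0 : (0 < L)%N by apply: leq_trans HL; rewrite !addn1 muln_gt0 muln_gt0 expn_gt0.
have [Ca Ca0 hCa] := trunc_log_powR 8 e'0.
have [Cb Cb0 hCb] := trunc_log_powR 1 e'0.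
pose X1 : R := (2 * Q + 1)%:R ^+ 8 * (Ca * (S + 1)%:R `^ e).
pose X2 : R := 2 * (Cb * L%:R `^ e).
pose X3 : R := (2 * S * m)%:R `^ e.
exists (16 ^+ 4 * (X1 * (Ctot R L S m C1 * X2 * X3))), L.
have Ct0 : 0 <= Ctot R L S m C1.
  rewrite /Ctot /Lpc; have := piece_const_ge0 R S m Q; rewrite -/Q => pc.
  by rewrite /Gc; nonneg.
have X10 : 0 <= X1 by rewrite /X1 !mulr_ge0 ?powR_ge0 ?ltW ?exprn_ge0.
have X20 : 0 <= X2 by rewrite /X2 !mulr_ge0 ?powR_ge0 ?ltW.
have X30 : 0 <= X3 by exact: powR_ge0.
split => //; first by nonneg.
move=> n Z Kp h n0 ZS Zb hh.
have Sn0 : (0 < (S + 1) * n)%N by rewrite muln_gt0 addn1.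
have [J [hJ hJ1 hJ2 hJ3]] := node_reach Q0 Sn0.
have Ln0 : (0 < L * n * n)%N by rewrite !muln_gt0 L0 n0.
pose Jb := (trunc_log 2 (L * n * n)).+1.
have hJb : (L * n * n <= 2 ^ Jb)%N by apply: ltnW; exact: trunc_log_ltn.
have exK : exists k, (2 * S * n < m ^ k)%N.
  by exists (2 * S * n)%N; apply: ltn_expl; apply: leq_trans m8.
(* Minimality gives m^K <= 2 S m n, so rounding the number of times up to m^K costs only a constant
   factor, and [C0 R ^+ K] is at most (2 S m n)^e. *)
case: (ex_minnP exK) => K hK2 hKmin.
have K0 : (0 < K)%N by case: (K) hK2 => //; rewrite expn0 ltnS leqn0 !muln_eq0 (gtn_eqF S0) (gtn_eqF n0).
have hK1 : (m ^ K.-1 <= 2 * S * n)%N.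
  by rewrite leqNgt; apply/negP => /hKmin; rewrite -{1}(prednK K0) ltnn.
have hK : (m ^ K <= 2 * S * m * n)%N.
  by rewrite -(prednK K0) expnS (_ : 2 * S * m * n = m * (2 * S * n))%N ?leq_mul2l ?hK1 ?orbT//; ring.
have hI := core_ineq R S0 n0 m8 mS HL hK hK1 hK2 hJ hJ1 hJ2 hJb Kp ZS Zb.
have b1 : J.+1%:R ^+ 8 <= X1 * n%:R `^ e.
  have h1 : (J.+1 <= (2 * Q + 1) * (trunc_log 2 ((S + 1) * n)).+1)%N.
    by rewrite mulnDl mul1n -addn1 leq_add.
  apply: (@le_trans _ _ (((2 * Q + 1) * (trunc_log 2 ((S + 1) * n)).+1)%:R ^+ 8)).
    by rewrite lerXn2r ?nnegrE ?ler0n// ler_nat.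
  rewrite natrM exprMn /X1 -mulrA; apply: ler_wpM2l; first exact: exprn_ge0.
  by apply: le_trans (hCa _ Sn0) _; rewrite natrM powRM ?ler0n// mulrA.
have b2 : Jb.+1%:R <= X2 * (n%:R `^ e * n%:R `^ e).
  have h1 : (Jb.+1 <= 2 * (trunc_log 2 (L * n * n)).+1)%N.
    by rewrite /Jb mul2n -addnn addSn ltnS leq_addl.
  apply: (@le_trans _ _ ((2 * (trunc_log 2 (L * n * n)).+1)%:R)); first by rewrite ler_nat.
  rewrite natrM /X2 -mulrA; apply: ler_wpM2l => //.
  apply: le_trans (_ : _ <= _ ^+ 1) (le_trans (hCb _ Ln0) _); first by rewrite expr1.
  by rewrite !natrM !powRM ?mulr_ge0 ?ler0n// !mulrA.
have b3 : C0 R ^+ K <= X3 * n%:R `^ e.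
  apply: (@le_trans _ _ ((m%:R `^ e) ^+ K)).
    by rewrite lerXn2r ?nnegrE ?powR_ge0// /C0.
  rewrite -powR_mulrn ?powR_ge0// -powRrM mulrC powRrM powR_mulrn// -natrX /X3 -powRM ?ler0n// -natrM.
  by apply: ge0_ler_powR; rewrite ?nnegrE ?ler0n ?ler_nat ?ltW.
have ee : n%:R `^ eps = n%:R `^ e * (n%:R `^ e * n%:R `^ e) * n%:R `^ e.
  have nz : (n%:R : R) != 0 by rewrite pnatr_eq0 -lt0n.
  have nE x y : n%:R `^ x * n%:R `^ y = n%:R `^ (x + y) :> R by rewrite powRD// nz implybT.
  by rewrite !nE /e; congr (_ `^ _); field.
have sumK : (\sum_(i < m ^ K) Kcount L n S Kp i =
    \sum_(i < (2 * S * n).+1) \sum_(c1 < L * n) \sum_(c2 < L * n) Kp i c1 c2)%N.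
  pose g i := (\sum_(c1 < L * n) \sum_(c2 < L * n) Kp i c1 c2)%N.
  rewrite -[RHS]/(\sum_(i < (2 * S * n).+1) g i)%N (big_ord_widen (m ^ K) g hK2) [RHS]big_mkcond; apply: eq_bigr => i _.
  by rewrite /Kcount ltnS; case: (_ <= _)%N; rewrite ?mul1n ?mul0n.
rewrite -sumK; set KK : R := (\sum_(i < m ^ K) _)%:R in hI *.
apply: (@le_trans _ _ (16 ^+ 4 * (J.+1%:R ^+ 8 * (Ctot R L S m C1 * Jb.+1%:R * C0 R ^+ K * n%:R ^+ 3 * KK)))).
  apply: (@le_trans _ _ (16 ^+ 4 * \sum_(z <- Z) (\sum_(i < m ^ K) fs L n S Kp i (ipt R n z)) ^+ 4)); last first.
    by apply: ler_wpM2l hI; exact: exprn_ge0.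
  rewrite mulr_sumr big_seq [leRHS]big_seq; apply: ler_sum => z zZ.
  rewrite -exprMn lerXn2r ?nnegrE ?ler0n ?mulr_ge0 ?sumr_ge0// => [i _|]; first exact: fs_ge0.
  rewrite natr_sum (big_ord_widen (m ^ K) (fun i => (h z i)%:R : R) hK2) big_mkcond mulr_sumr.
  apply: ler_sum => i _; have f0 := fs_ge0 L n S Kp i (ipt R n z).
  case: ifP => iS; last by rewrite mulr_ge0.
  case hz : (h z i); last by rewrite mulr_ge0.
  have [c1 [c2 [lc1 lc2 kp [j1 [j2 [p1 p2]]]]]] := hh z i zZ iS hz.
  have := fs_hit L0 n0 LC iS lc1 lc2 kp p1 p2.
  move: (fs _ _ _ _ _ _) f0 => f f0 hf.
  suff : 1 <= 16 * f by [].
  lra.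
rewrite ee; set en : R := n%:R `^ e in b1 b2 b3 *; have en0 : 0 <= en by exact: powR_ge0.
have KK0 : 0 <= KK by exact: ler0n.
move: (Ctot _ _ _ _ _) Ct0 => Ct Ct0.
have CK : 0 <= C0 R ^+ K by rewrite exprn_ge0// /C0.
have N0 : 0 <= n%:R ^+ 3 :> R by exact: exprn_ge0.
apply: core_absorb => //; exact: ler0n.
Qed.

(** * Discretisation of the lines *)

Section Param.
Variable R : realType.
Implicit Types (p q : pt4 R) (r x y : R).

Lemma norm4_coord (a b c d r : R) : norm4 (a, b, c, d) < r -> [/\ `|a| < r, `|b| < r, `|c| < r & `|d| < r].
Proof.
rewrite /norm4 => h; have s x y z w : `|x| <= Num.sqrt (x ^+ 2 + y ^+ 2 + z ^+ 2 + w ^+ 2).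
  rewrite -sqrtr_sqr ler_wsqrtr// -!addrA lerDl !addr_ge0 ?sqr_ge0//.
split; apply: le_lt_trans h; first exact: s.
- by rewrite (_ : a ^+ 2 + b ^+ 2 + c ^+ 2 + d ^+ 2 = b ^+ 2 + a ^+ 2 + c ^+ 2 + d ^+ 2)//; ring.
- by rewrite (_ : a ^+ 2 + b ^+ 2 + c ^+ 2 + d ^+ 2 = c ^+ 2 + b ^+ 2 + a ^+ 2 + d ^+ 2)//; ring.
- by rewrite (_ : a ^+ 2 + b ^+ 2 + c ^+ 2 + d ^+ 2 = d ^+ 2 + b ^+ 2 + c ^+ 2 + a ^+ 2)//; ring.
Qed.

Lemma norm4_le (a b c d e : R) : `|a| <= e -> `|b| <= e -> `|c| <= e -> `|d| <= e -> norm4 (a, b, c, d) <= 2 * e.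
Proof.
move=> ha hb hc hd; have e0 : 0 <= e by exact: le_trans ha.
have sq x : `|x| <= e -> x ^+ 2 <= e ^+ 2.
  by move=> h; rewrite -real_normK ?num_real// lerXn2r ?nnegrE.
have e2 : 0 <= 2 * e by rewrite mulr_ge0.
rewrite /norm4 -(ger0_norm e2) -sqrtr_sqr ler_wsqrtr//.
have := sq _ ha; have := sq _ hb; have := sq _ hc; have := sq _ hd.
rewrite exprMn; move: (a ^+ 2) (b ^+ 2) (c ^+ 2) (d ^+ 2) (e ^+ 2) => a2 b2 c2 d2 e3 *; lra.
Qed.

Lemma floor_near x : `|(Num.floor x)%:~R - x| <= 1.
Proof.
have /andP[h1 h2] := floor_itv x; rewrite intrD in h2.
by rewrite ler_norml; move: ((Num.floor x)%:~R : R) h1 h2 => f h1 h2; apply/andP; split; lra.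
Qed.

Lemma normD_le x y X Y : `|x| <= X -> `|y| <= Y -> `|x + y| <= X + Y.
Proof. by move=> hx hy; apply: le_trans (ler_normD _ _) (lerD hx hy). Qed.

(* A line of the family is recovered from (A, B, D) = (-a/c, 1/c, -d/c) by
   c = 1/B, a = -Ac, d = -Dc and b = (ad - 1)/c = ADc - B. *)
Lemma param_lipschitz (T h A B D c A0 B0 D0 c0 : R) : 1 <= T -> c * B = 1 -> c0 * B0 = 1 ->
  `|D| <= T -> `|c| <= T -> `|A0| <= T -> `|D0| <= T -> `|c0| <= T ->
  `|A - A0| <= h -> `|B - B0| <= h -> `|D - D0| <= h ->
  [/\ `|- A * c - - A0 * c0| <= 4 * T ^+ 4 * h, `|(A * D * c - B) - (A0 * D0 * c0 - B0)| <= 4 * T ^+ 4 * h,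
      `|c - c0| <= 4 * T ^+ 4 * h & `|- D * c - - D0 * c0| <= 4 * T ^+ 4 * h].
Proof.
move=> T1 cB cB0 hD hc hA0 hD0 hc0 hA hB hDD.
have h0 : 0 <= h by exact: le_trans hA.
have T0 : 0 <= T by apply: le_trans T1.
have nn x y : `|x - y| = `|- (x - y)| by rewrite normrN.
have ec : c - c0 = - (B - B0) * (c * c0).
  rewrite (_ : - (B - B0) * (c * c0) = (c0 * B0) * c - (c * B) * c0); last by ring.
  by rewrite cB cB0 !mul1r.
have hcc : `|c - c0| <= T ^+ 2 * h.
  by rewrite ec mulrC mulrN normrN; apply: normM_le => //; rewrite expr2; exact: normM_le.
have P k : T ^+ k * h <= T ^+ k.+1 * h.
  by apply: ler_wpM2r => //; rewrite exprS ler_peMl// exprn_ge0.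
have P0 := P 0; have P1 := P 1; have P2 := P 2; have P3 := P 3.
rewrite expr0 mul1r in P0.
have [h1 h2 h3] : [/\ h <= T ^+ 4 * h, T ^+ 2 * h <= T ^+ 4 * h & T ^+ 3 * h <= T ^+ 4 * h].
  by split; lra.
have hT : T * h <= T ^+ 4 * h by move: P1 P2 P3; rewrite expr1; lra.
have Ah : 0 <= T ^+ 4 * h by rewrite mulr_ge0// exprn_ge0.
have pr X X0 : `|X0| <= T -> `|X - X0| <= h -> `|- X * c - - X0 * c0| <= 2 * (T ^+ 4 * h).
  move=> hX hXX; rewrite (_ : - X * c - - X0 * c0 = - ((X - X0) * c + X0 * (c - c0))); last by ring.
  rewrite normrN; apply: le_trans (normD_le (normM_le hXX hc) (normM_le hX hcc)) _.
  rewrite (_ : T * (T ^+ 2 * h) = T ^+ 3 * h); last by ring.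
  lra.
have hAD : `|(A - A0) * (D * c)| <= h * (T * T) by do 2?apply: normM_le.
have hAD2 : `|(D - D0) * (A0 * c)| <= h * (T * T) by do 2?apply: normM_le.
have hAD3 : `|(c - c0) * (A0 * D0)| <= T ^+ 2 * h * (T * T) by do 2?apply: normM_le.
have e1 : h * (T * T) = T ^+ 2 * h by ring.
have e2 : T ^+ 2 * h * (T * T) = T ^+ 4 * h by ring.
have e4 : 4 * T ^+ 4 * h = 4 * (T ^+ 4 * h) by ring.
rewrite e4; split.
- by apply: le_trans (pr _ _ hA0 hA) _; lra.
- rewrite (_ : _ - _ = (A - A0) * (D * c) + (D - D0) * (A0 * c) + (c - c0) * (A0 * D0) + - (B - B0)); last by ring.
  have hBn : `|- (B - B0)| <= h by rewrite normrN.
  apply: le_trans (normD_le (normD_le (normD_le hAD hAD2) hAD3) hBn) _.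
  rewrite e1 e2; lra.
- by apply: le_trans hcc _; lra.
- by apply: le_trans (pr _ _ hD0 hDD) _; lra.
Qed.

Lemma sum_bool_ord (N : nat) (f : nat -> bool) : (\sum_(i < N) f i)%N = size [seq i <- iota 0 N | f i].
Proof.
rewrite size_filter -sum1_count -(big_mkord xpredT (fun i => nat_of_bool (f i))) /index_iota subn0.
by rewrite [RHS]big_mkcond; apply: eq_bigr => i _; case: (f i).
Qed.

Lemma sum_eq_ord (N : nat) (v : int) : (\sum_(i < N) (i%:Z == v) <= 1)%N.
Proof.
rewrite (sum_bool_ord N (fun i => i%:Z == v)); apply: (@leq_trans (size [:: `|v|%N])) => //.
apply: uniq_leq_size; first by rewrite filter_uniq// iota_uniq.
by move=> i; rewrite mem_filter inE => /andP[/eqP <- _].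
Qed.

Lemma sum_has_le (T : Type) (s : seq T) (N1 N2 N3 : nat) (f1 f2 f3 : T -> int) :
  (\sum_(i < N1) \sum_(c1 < N2) \sum_(c2 < N3)
     has (fun k => [&& i%:Z == f1 k, c1%:Z == f2 k & c2%:Z == f3 k]) s <= size s)%N.
Proof.
elim: s => [|k s IH] /=.
  by rewrite big1// => i _; rewrite big1// => j _; rewrite big1.
apply: (@leq_trans ((\sum_(i < N1) \sum_(c1 < N2) \sum_(c2 < N3)
     ((i%:Z == f1 k) * ((c1%:Z == f2 k) * (c2%:Z == f3 k)))) + \sum_(i < N1) \sum_(c1 < N2) \sum_(c2 < N3)
     has (fun k => [&& i%:Z == f1 k, c1%:Z == f2 k & c2%:Z == f3 k]) s)%N).
  rewrite -big_split; apply: leq_sum => i _; rewrite -big_split; apply: leq_sum => c1 _.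
  rewrite -big_split; apply: leq_sum => c2 _.
  by rewrite !mulnb; move: [&& _, _ & _] (has _ _) => [] [].
rewrite -[in leqRHS]add1n leq_add//.
under eq_bigr => i _ do under eq_bigr => j _ do rewrite -big_distrr /= -big_distrr /=.
under eq_bigr => i _ do rewrite -big_distrr -big_distrl.
rewrite -big_distrl /= -[leqRHS]/(1 * (1 * 1))%N.
by rewrite !leq_mul// sum_eq_ord.
Qed.

End Param.

(** In units of 1/N, rounding costs 1 for A, S for B, 3T for the time, 1 for the cell, and the size
    of the cube adds 2. *)
Lemma affine_close (R : realFieldType) (N delta A B t x y fA fB g k T S : R) : 0 < N -> N * delta <= 2 ->
  y = A + x * B -> `|fA - N * A| <= 1 -> `|fB - N * B| <= 1 -> `|N * (t - x)| <= 3 -> `|t| <= S -> `|B| <= T ->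
  `|g - N * k| <= 1 -> `|k - y| <= delta -> `|fA / N + t * (fB / N) - g / N| <= (S + 3 * T + 4) / N.
Proof.
move=> N0 Nd ey hA hB ht tS BT hg hk.
set E := fA / N + _ - _; rewrite ler_pdivlMr// -{1}(gtr0_norm N0) -normrM.
rewrite (_ : E * N = (fA - N * A) + t * (fB - N * B) + (N * (t - x)) * B - (g - N * k) - N * (k - y)); last first.
  by rewrite /E ey; field; rewrite gt_eqF.
have h1 : `|t * (fB - N * B)| <= S * 1 by rewrite normrM ler_pM.
have h2 : `|N * (t - x) * B| <= 3 * T by rewrite normrM ler_pM.
have h3 : `|N * (k - y)| <= 2.
  by rewrite normrM gtr0_norm//; apply: le_trans Nd; rewrite ler_pM2l.
move: h1 h2 h3 hA hg; rewrite mulr1 !ler_norml.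
by move=> /andP[? ?] /andP[? ?] /andP[? ?] /andP[? ?] /andP[? ?]; apply/andP; split; lra.
Qed.

Lemma absz_shift (f : int) (N : nat) : (`|f| <= N)%N -> 0 <= f + N%:Z /\ (`|(f + N%:Z)%R| <= 2 * N)%N.
Proof. by move=> h; split; lia. Qed.

(** * Lines and cubes as integer data *)

Section Incidence.
Variables (R : realType) (T n : nat) (delta : R).
Hypotheses (T1 : (1 <= T)%N) (n0 : (0 < n)%N) (d0 : 0 < delta) (d1 : delta <= 1)
  (nd1 : 1 <= n%:R * delta) (nd2 : n%:R * delta <= 2).
Let nR : (0 : R) < n%:R. Proof. by rewrite ltr0n. Qed.
Let TR : (1 : R) <= T%:R. Proof. by rewrite ler1n. Qed.
Let S := (T + 2)%N.

Definition okp (p : pt4 R) : Prop := let: (a, b, c, d) := p in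
  [/\ a * d - b * c = 1, [/\ `|a| < T%:R, `|b| < T%:R, `|c| < T%:R & `|d| < T%:R], c != 0 &
   [/\ `|a / c| <= T%:R, `|c^-1| <= T%:R & `|d / c| <= T%:R]].

Definition zof (p : pt4 R) : int * int * int := let: (a, b, c, d) := p in
  (Num.floor (n%:R * - (a / c)), Num.floor (n%:R * c^-1), Num.floor (n%:R * - (d / c))).

Variable Ls : seq (pt4 R).
Hypothesis Lok : forall p, p \in Ls -> okp p.
Hypothesis Lball : forall (z : pt4 R) (r : R), delta <= r -> r <= 1 ->
  (count (in_ball4 z r) Ls)%:R <= (r / delta) ^+ 2.


(** Coordinates are approximated by multiples of 1/4 up to an error of 1/4, so a parameter is within
    1/2 of a centre and inside its open unit ball. *)
Lemma size_le_cover : (size Ls)%:R <= ((8 * T) ^ 4)%:R * (1 / delta) ^+ 2 :> R.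
Proof.
pose m := (8 * T)%N.
pose ct (i : 'I_m) : R := (i%:Z - (4 * T)%:Z)%:~R / 4.
pose ctr (t : 'I_m * 'I_m * 'I_m * 'I_m) : pt4 R := (ct t.1.1.1, ct t.1.1.2, ct t.1.2, ct t.2).
have hct x : `|x| < T%:R -> exists i, `|x - ct i| <= 4^-1.
  move=> hx; pose g := (Num.floor (4 * x) + (4 * T)%:Z)%R.
  have /andP[x1 x2] : - T%:R < x < T%:R by rewrite -ltr_norml.
  have g0 : 0 <= g.
    rewrite /g -lerBlDr sub0r floor_ge_int mulrNz -pmulrn natrM; lra.
  have gm : g < m%:Z.
    rewrite /g -ltrBrDr floor_lt_int /m intrB -!pmulrn !natrM; lra.
  have im : (`|g| < m)%N by rewrite -ltz_nat gez0_abs.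
  exists (Ordinal im); rewrite /ct /= gez0_abs// /g addrK.
  have := floor_near (4 * x); rewrite !ler_norml.
  by move: ((Num.floor (4 * x))%:~R : R) => f /andP[h1 h2]; apply/andP; split; lra.
have hp p : p \in Ls -> (1 <= \sum_t in_ball4 (ctr t) 1 p)%N.
  move=> /Lok; case: p => [[[a b] c] d] [_ [ha hb hc hd] _ _].
  have [i1 h1] := hct _ ha; have [i2 h2] := hct _ hb.
  have [i3 h3] := hct _ hc; have [i4 h4] := hct _ hd.
  rewrite (bigD1 (i1, i2, i3, i4)) //= (_ : _ < 1) //.
  by apply: le_lt_trans (norm4_le h1 h2 h3 h4) _; lra.
have h1 : (size Ls <= \sum_t count (in_ball4 (ctr t) 1) Ls)%N.
  under eq_bigr => t _ do rewrite -sum1_count big_mkcond.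
  rewrite exchange_big -sum1_size big_seq [leqRHS]big_seq; apply: leq_sum => p pL.
  by apply: leq_trans (hp p pL) _; apply: leq_sum => t _; case: in_ball4.
apply: (@le_trans _ _ (\sum_t (count (in_ball4 (ctr t) 1) Ls)%:R)).
  by rewrite -natr_sum ler_nat.
apply: (@le_trans _ _ (\sum_(t : 'I_m * 'I_m * 'I_m * 'I_m) (1 / delta) ^+ 2)).
  by apply: ler_sum => t _; exact: Lball.
rewrite sumr_const -[_ *+ _]mulr_natl !card_prod card_ord /m.
by rewrite !expnS expn0 muln1 !mulnA.
Qed.

Definition boxC : nat := ((8 * T) ^ 4 * (25 * T ^ 4) ^ 2)%N.

Lemma zof_box : boxcond boxC (map zof Ls).
Proof.
move=> _ r /mapP[p0 p0L ->] r0; rewrite count_map.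
(* Codes at distance r mean (A, B, D) within 3 r delta, hence parameters within 2 * 4 T^4 * 3 r
   delta by [param_lipschitz]; 25 instead of 24 makes the inequality strict. *)
rewrite -(ler_nat R); pose rho : R := 25 * T%:R ^+ 4 * (r%:R * delta).
have rR : 1 <= r%:R :> R by rewrite ler1n.
have rd : delta <= r%:R * delta by rewrite ler_peMl// ltW.
have T4 : 1 <= T%:R ^+ 4 :> R by exact: exprn_ege1.
have rd0 : 0 < r%:R * delta by exact: lt_le_trans rd.
have rhoE : rho / delta = (25 * T ^ 4)%:R * r%:R.
  by rewrite /rho natrM natrX; field; rewrite gt_eqF.
have rho1 : delta <= rho.
  apply: le_trans rd _; rewrite /rho ler_peMl ?(ltW rd0)//; lra.
have -> : (boxC * r ^ 2)%N%:R = (8 * T)%:R ^+ 4 * (rho / delta) ^+ 2 :> R.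
  by rewrite rhoE /boxC natrM natrM (natrX _ (8 * T)) (natrX _ (25 * _)) (natrX _ r) exprMn -mulrA.
have B1 : 1 <= (8 * T)%:R ^+ 4 :> R by rewrite exprn_ege1// ler1n muln_gt0.
(* Above radius 1 the ball condition says nothing, and the bound on all of [Ls] takes its place. *)
case: (lerP rho 1) => hrho; last first.
  apply: (@le_trans _ _ (size Ls)%:R); first by rewrite ler_nat count_size.
  apply: le_trans size_le_cover _; rewrite natrX; apply: ler_wpM2l; first by rewrite exprn_ge0.
  rewrite lerXn2r ?nnegrE ?divr_ge0 ?(ltW d0)//; first by apply: le_trans rho1; exact: ltW.
  by rewrite ler_pM2r ?invr_gt0// ltW.
apply: le_trans (_ : _ <= (rho / delta) ^+ 2) _; last by rewrite ler_peMl// sqr_ge0.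
apply: le_trans (Lball p0 rho1 hrho); rewrite ler_nat.
rewrite (@eq_in_count _ _ [pred p | (p \in Ls) && ibox r (zof p0) (zof p)]); last by move=> p pL /=; rewrite pL.
apply: sub_count => p /= /andP[pL]; move: (Lok pL) (Lok p0L); clear p0L pL.
case: p p0 => [[[a b] c] d] [[[a0 b0] c0] d0'] /= [det [_ _ hc _] cn [hA hB hD]] [det0 [_ _ hc0 _] cn0 [hA0 hB0 hD0]].
move=> /and3P[/= b1 b2 b3].
pose h : R := 3 * (r%:R * delta).
have near x y : (`|Num.floor (n%:R * x) - Num.floor (n%:R * y)| <= r)%N -> `|x - y| <= h.
  move=> hr; have h1 := floor_near (n%:R * x); have h2 := floor_near (n%:R * y).
  have h3 : `|(Num.floor (n%:R * x) - Num.floor (n%:R * y))%:~R : R| <= r%:R.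
    by rewrite -intr_norm -abszE -pmulrn ler_nat.
  rewrite intrB in h3; have h4 : `|n%:R * x - n%:R * y| <= r%:R + 2.
    move: h1 h2 h3; rewrite !ler_norml.
    move: ((Num.floor (n%:R * x))%:~R : R) ((Num.floor (n%:R * y))%:~R : R) (n%:R * x) (n%:R * y) (r%:R : R).
    by move=> u v X Y r' /andP[? ?] /andP[? ?] /andP[? ?]; apply/andP; split; lra.
  have h5 : n%:R * `|x - y| <= n%:R * h.
    rewrite -{1}(ger0_norm (ltW nR)) -normrM mulrBr; apply: le_trans h4 _.
    apply: (@le_trans _ _ (3 * r%:R)); first by move: rR; lra.
    rewrite (_ : n%:R * h = (3 * r%:R) * (n%:R * delta)); last by rewrite /h; ring.
    by rewrite ler_peMr// mulr_ge0.
  by rewrite -(ler_pM2l nR).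
have cB (x : R) : x != 0 -> x * x^-1 = 1 by move=> ?; rewrite divff.
have abE (x y z w : R) : z != 0 -> x * w - y * z = 1 ->
    [/\ x = - - (x / z) * z, y = - (x / z) * - (w / z) * z - z^-1 & w = - - (w / z) * z].
  move=> z0 dt; split; [by field| |by field].
  by apply: (mulIf z0); rewrite mulrBl mulVf// mulrAC -dt; field.
have [a1 bb1 d1'] := abE _ _ _ _ cn det; have [a2 bb2 d2'] := abE _ _ _ _ cn0 det0.
have [pa pb pc pd] := @param_lipschitz R T%:R h (- (a / c)) c^-1 (- (d / c)) c (- (a0 / c0)) c0^-1 (- (d0' / c0)) c0
  TR (cB _ cn) (cB _ cn0) ltac:(by rewrite normrN) (ltW hc) ltac:(by rewrite normrN) ltac:(by rewrite normrN) (ltW hc0)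
  (near _ _ b1) (near _ _ b2) (near _ _ b3).
rewrite -a1 -a2 in pa; rewrite -bb1 -bb2 in pb; rewrite -d1' -d2' in pd.
apply: le_lt_trans (norm4_le pa pb pc pd) _; rewrite /h /rho.
have : 0 < T%:R ^+ 4 * (r%:R * delta) by rewrite mulr_gt0// (lt_le_trans _ T4).
by move: (T%:R ^+ 4) (r%:R * delta) => t4 x; lra.
Qed.

Definition hitc (k : int * int * int) (p : pt4 R) := exists s, dcube delta k (line_pt p s).
Definition fl (k : int) : int := Num.floor (n%:R * (delta * k%:~R)).
Definition hC : nat := (S + 3 * T + 4)%N.

Lemma fl_near k x : delta * k%:~R <= x <= delta * (k + 1)%:~R -> `|n%:R * ((fl k)%:~R / n%:R - x)| <= 3.
Proof.
move=> /andP[x1 x2]; have h1 := floor_near (n%:R * (delta * k%:~R)).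
rewrite intrD mulrDr mulr1 in x2.
have h2 : n%:R * (delta * k%:~R) <= n%:R * x by rewrite ler_pM2l.
have h3 : n%:R * x <= n%:R * (delta * k%:~R) + 2.
  apply: (@le_trans _ _ (n%:R * (delta * k%:~R + delta))); first by rewrite ler_pM2l.
  by rewrite mulrDr lerD2l.
rewrite mulrBr mulrCA divff ?gt_eqF// mulr1; move: h1; rewrite -/(fl k) !ler_norml.
move: ((fl k)%:~R : R) (n%:R * x) (n%:R * (delta * _)) h2 h3 => f y z h2 h3 /andP[? ?].
by apply/andP; split; lra.
Qed.

Lemma hit_close p k i : okp p -> hitc k p -> i%:Z = fl k.1.1 + (S * n)%:Z -> (i <= 2 * S * n)%N ->
  `|(prj n S i (ipt R n (zof p))).1 - (fl k.2)%:~R / n%:R| <= hC%:R / n%:R /\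
  `|(prj n S i (ipt R n (zof p))).2 - (Num.floor (n%:R * - (delta * k.1.2%:~R)))%:~R / n%:R| <= hC%:R / n%:R.
Proof.
case: p k => [[[a b] c] d] [[k1 k2] k3] /= [det _ cn [hA hB hD]] [s [hx hy hs]] ei iS.
have tE : tm R n S i = (fl k1)%:~R / n%:R.
  by rewrite /tm pmulrn ei intrD -pmulrn natrM; field; rewrite gt_eqF.
have tS := tm_abs R n0 iS; rewrite !tE in tS *; have ht := fl_near hx.
have cube u (l : int) : delta * l%:~R <= u <= delta * (l + 1)%:~R -> `|delta * l%:~R - u| <= delta.
  rewrite intrD mulrDr mulr1 => /andP[? ?]; rewrite ler_norml.
  by have := d0; move=> ?; apply/andP; split; lra.
have CE : (hC%:R : R) = S%:R + 3 * T%:R + 4 by rewrite /hC natrD natrD natrM.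
rewrite CE; split.
  apply: (affine_close nR nd2 _ (floor_near _) (floor_near _) ht tS hB (floor_near _) (cube _ _ hs)).
  by field.
have ey : - (b + s * d) = c^-1 + (a + s * c) * - (d / c).
  by apply: (mulIf cn); rewrite [RHS]mulrDl mulVf// -det; field.
have hk : `|- (delta * k2%:~R) - - (b + s * d)| <= delta by rewrite -opprD normrN; exact: cube.
by apply: (affine_close nR nd2 ey (floor_near _) (floor_near _) ht tS _ (floor_near _) hk); rewrite normrN.
Qed.

Lemma floor_bound (x : R) : `|x| <= T%:R -> (`|Num.floor (n%:R * x)| <= S * n)%N.
Proof.
move=> hx; rewrite -(ler_nat R).
have -> : (`|Num.floor (n%:R * x)|%N%:R : R) = `|(Num.floor (n%:R * x))%:~R| by rewrite -intr_norm -abszE -pmulrn.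
rewrite -(subrK (n%:R * x) (_%:~R)); apply: le_trans (normD_le (floor_near _) (normM_le (lexx _) hx)) _.
rewrite normr_nat natrM natrD mulrDl mulrC [leLHS]addrC lerD2l.
have : 1 <= n%:R :> R by rewrite ler1n.
by lra.
Qed.

(** Since n delta is at least 1, the scaled faces of different slabs are at least 1 apart, so
    different slabs are assigned different times. *)
Lemma fl_inj : injective fl.
Proof.
move=> j j' e; apply/eqP; rewrite -subr_eq0 -absz_eq0 -leqn0 -ltnS -(ltr_nat R).
have /andP[a1 a2] := floor_itv (n%:R * (delta * j%:~R)).
have /andP[b1 b2] := floor_itv (n%:R * (delta * j'%:~R)).
rewrite -/(fl j) -/(fl j') -e !intrD in a1 a2 b1 b2.
have h : `|n%:R * delta * (j - j')%:~R| < 1.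
  rewrite intrB mulrBr -!mulrA ltr_norml.
  by move: ((fl j)%:~R : R) a1 a2 b1 b2 => f *; apply/andP; split; lra.
have -> : (`|(j - j')%R|%N%:R : R) = `|(j - j')%:~R| by rewrite -intr_norm -abszE -pmulrn.
apply: le_lt_trans h; rewrite normrM ler_peMl// ger0_norm//.
by rewrite mulr_ge0// ltW.
Qed.

Lemma residue (L : nat) (g : int) : (0 < L)%N -> exists c (j : int), [/\ (c < L * n)%N, c%:Z = (g %% (L * n)%:Z)%Z &
  g%:~R / n%:R = c%:R / n%:R + j%:~R * L%:R :> R].
Proof.
move=> L0; have Ln : (0 < (L * n)%:Z)%R by rewrite ltz_nat muln_gt0 L0.
have r0 := modz_ge0 g (lt0r_neq0 Ln); have r1 := ltz_pmod g Ln.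
exists `|(g %% (L * n)%:Z)%Z|%N, (g %/ (L * n)%:Z)%Z; split.
- by rewrite -ltz_nat gez0_abs.
- by rewrite gez0_abs.
have -> : (`|(g %% (L * n)%:Z)%Z|%N%:R : R) = (g %% (L * n)%:Z)%Z%:~R by rewrite pmulrn gez0_abs.
rewrite {1}(divz_eq g (L * n)%:Z) intrD intrM -pmulrn natrM.
by field; rewrite gt_eqF.
Qed.

Lemma incidence_at (L : nat) (X : R) : (0 < L)%N -> 0 <= X ->
  (forall (Z : seq (int * int * int)) (Kp : nat -> nat -> nat -> bool) (h : int * int * int -> nat -> bool),
    (forall z, z \in Z -> [/\ (`|z.1.1| <= S * n)%N, (`|z.1.2| <= S * n)%N & (`|z.2| <= S * n)%N]) ->
    boxcond boxC Z ->
    (forall z i, z \in Z -> (i <= 2 * S * n)%N -> h z i -> exists c1 c2, [/\ (c1 < L * n)%N, (c2 < L * n)%N, Kp i c1 c2 &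
      exists j1 j2 : int, `|(prj n S i (ipt R n z)).1 - c1%:R / n%:R - j1%:~R * L%:R| <= hC%:R / n%:R /\
        `|(prj n S i (ipt R n z)).2 - c2%:R / n%:R - j2%:~R * L%:R| <= hC%:R / n%:R]) ->
    \sum_(z <- Z) (\sum_(i < (2 * S * n).+1) h z i)%:R ^+ 4 <=
      X * (\sum_(i < (2 * S * n).+1) \sum_(c1 < L * n) \sum_(c2 < L * n) Kp i c1 c2)%:R) ->
  forall (Ks : seq (int * int * int)) (N : R), (forall k, k \in Ks -> `|delta * k.1.1%:~R| <= T%:R) -> 0 <= N ->
  (forall p, p \in Ls -> exists J : seq int, [/\ uniq J, N <= (size J)%:R &
     forall j, j \in J -> exists2 k, k \in Ks & k.1.1 = j /\ hitc k p]) ->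
  (size Ls)%:R * N ^+ 4 <= X * (size Ks)%:R.
Proof.
move=> L0 X0 hcore Ks N KsT N0 hJ.
pose idx (k : int * int * int) : int := (fl k.1.1 + (S * n)%:Z)%R.
pose g2 (k : int * int * int) : int := Num.floor (n%:R * - (delta * k.1.2%:~R)).
pose Kp (i c1 c2 : nat) := has (fun k => [&& i%:Z == idx k, c1%:Z == (fl k.2 %% (L * n)%:Z)%Z & c2%:Z == (g2 k %% (L * n)%:Z)%Z]) Ks.
(* Lines may share a code. The list of codes keeps multiplicities, and [h z] collects the times of
   all lines with the code z, which can only enlarge the left side. *)
pose h (z : int * int * int) (i : nat) := `[< exists p k, [/\ p \in Ls, zof p = z, k \in Ks, hitc k p & i%:Z = idx k] >].
have H := hcore (map zof Ls) Kp h _ zof_box.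
apply: le_trans (_ : _ <= \sum_(z <- map zof Ls) (\sum_(i < (2 * S * n).+1) h z i)%:R ^+ 4) _.
  rewrite big_map mulr_natl -sum1_size -sumrMnr big_seq [leRHS]big_seq; apply: ler_sum => p pL.
  rewrite mulr1n; have [J [uJ NJ hits]] := hJ p pL.
  rewrite lerXn2r ?nnegrE//; apply: le_trans NJ _; rewrite ler_nat sum_bool_ord.
  have idx0 j : j \in J -> 0 <= fl j + (S * n)%:Z /\ (`|(fl j + (S * n)%:Z)%R| <= 2 * S * n)%N.
    move=> /hits[k kK [<- _]]; have := @floor_bound (delta * k.1.1%:~R) (KsT k kK); rewrite -/(fl _).
    by rewrite -mulnA; exact: absz_shift.
  rewrite -(size_map (fun j => `|(fl j + (S * n)%:Z)%R|%N)); apply: uniq_leq_size.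
    rewrite map_inj_in_uniq// => j j' /idx0[p1 _] /idx0[p2 _] e; apply: fl_inj.
    by apply: (addIr (S * n)%:Z); rewrite -(gez0_abs p1) e gez0_abs.
  move=> i /mapP[j jJ ->]; have [p1 p2] := idx0 _ jJ.
  rewrite mem_filter mem_iota /= add0n ltnS p2 andbT; apply/asboolP.
  have [k kK [kj hk]] := hits _ jJ; exists p, k; split => //.
  by rewrite gez0_abs// /idx kj.
apply: le_trans (H _ _) _.
- move=> z /mapP[p pL ->]; move: (Lok pL); case: p {pL} => [[[a b] c] d] [_ _ _ [hA hB hD]] /=.
  have f x : `|x| <= T%:R -> (`|Num.floor (n%:R * x)| <= S * n)%N := @floor_bound x.
  by split; [apply: (f (- (a / c)))|apply: (f c^-1)|apply: (f (- (d / c)))]; rewrite ?normrN.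
- move=> z i _ iS /asboolP[p [k [pL <- kK hk ei]]].
  have [b1 b2] := hit_close (Lok pL) hk ei iS.
  have [c1 [j1 [l1 e1 f1]]] := residue (fl k.2) L0; have [c2 [j2 [l2 e2 f2]]] := residue (g2 k) L0.
  exists c1, c2; split => //; first by apply/hasP; exists k => //; rewrite ei e1 e2 !eqxx.
  exists j1, j2; rewrite f1 in b1; rewrite f2 in b2.
  have e x y w : x - y - w = x - (y + w) :> R by ring.
  by rewrite !e.
by apply: ler_wpM2l => //; rewrite ler_nat; exact: sum_has_le.
Qed.

End Incidence.

Theorem incidence (R : realType) (eps : R) (T : nat) : 0 < eps -> (0 < T)%N -> exists2 C : R, 0 <= C &
  forall (delta : R) (Ls : seq (pt4 R)), 0 < delta -> delta <= 1 -> (forall p, p \in Ls -> okp T p) ->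
    (forall (z : pt4 R) (r : R), delta <= r -> r <= 1 -> (count (in_ball4 z r) Ls)%:R <= (r / delta) ^+ 2) ->
  forall (Ks : seq (int * int * int)) (N : R), (forall k, k \in Ks -> `|delta * k.1.1%:~R| <= T%:R) -> 0 <= N ->
  (forall p, p \in Ls -> exists J : seq int, [/\ uniq J, N <= (size J)%:R &
     forall j, j \in J -> exists2 k, k \in Ks & k.1.1 = j /\ hitc delta k p]) ->
  (size Ls)%:R * N ^+ 4 <= C * (delta^-1 ^+ 3 * delta^-1 `^ eps) * (size Ks)%:R.
Proof.
move=> e0 T0; have S0 : (0 < T + 2)%N by rewrite addn2.
have [C [L [C0 L0 hC]]] := core (boxC T) (hC T) e0 S0.
exists (C * (2 ^+ 3 * 2 `^ eps)); first by rewrite !mulr_ge0 ?powR_ge0// exprn_ge0.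
move=> delta Ls d0 d1 Lok Lball Ks N KsT N0 hJ.
have di : 0 < delta^-1 by rewrite invr_gt0.
have di1 : 1 <= delta^-1 by rewrite invf_ge1.
pose n := (Num.trunc (delta^-1)).+1.
have n1 : n%:R <= 2 * delta^-1.
  have : (Num.trunc delta^-1)%:R <= delta^-1 by rewrite truncn_le ltW.
  by rewrite /n -natr1; lra.
have nd1 : 1 <= n%:R * delta.
  by rewrite -ler_pdivrMr// mul1r ltW// truncnS_gt.
have nd2 : n%:R * delta <= 2 by rewrite -ler_pdivlMr.
apply: le_trans (incidence_at T0 (ltn0Sn _ : 0 < n)%N d0 d1 nd1 nd2 Lok Lball L0 _ (fun Z Kp h a b c => hC n Z Kp h isT a b c) KsT N0 hJ) _.
  by rewrite !mulr_ge0 ?powR_ge0 ?exprn_ge0.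
apply: ler_wpM2r => //; rewrite -[leLHS]mulrA -[leRHS]mulrA; apply: ler_wpM2l => //.
rewrite [leRHS](_ : _ = (2 * delta^-1) ^+ 3 * (2 `^ eps * delta^-1 `^ eps)); last by ring.
rewrite -powRM ?(ltW di)//; apply: ler_pM; rewrite ?exprn_ge0 ?powR_ge0//.
  by rewrite lerXn2r ?nnegrE// mulr_ge0 ?ltW.
by apply: ge0_ler_powR; rewrite ?nnegrE ?(ltW e0)// mulr_ge0 ?ltW.
Qed.

(** * Measures *)

Section Measure.
Variable R : realType.
Implicit Types (p : pt4 R) (delta : R) (k : int * int * int) (Ks : seq (int * int * int)).

Lemma measurable_slab (a c u v : R) : measurable [set s : R | u <= a + s * c <= v].
Proof.
have mf : measurable_fun [set: R] (fun s : R => a + s * c).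
  by apply: measurable_realfun.measurable_funD => //; apply: measurable_realfun.measurable_funM => //; exact: measurable_id.
have := mf measurableT `[u, v]%classic (measurable_itv _).
by rewrite setTI; congr measurable; apply/seteqP; split => s /=; rewrite in_itv.
Qed.

Lemma slab_measure (a c u d : R) : c != 0 -> 0 <= d ->
  (lebesgue_measure [set s : R | (u <= a + s * c <= u + d)%R] <= (d / `|c|)%:E)%E.
Proof.
move=> c0 d0; have cn : 0 < `|c| by rewrite normr_gt0.
pose l : R := if 0 < c then (u - a) / c else (u + d - a) / c.
have dc : 0 <= d / `|c| by rewrite divr_ge0.
apply: (@le_trans _ _ (lebesgue_measure `[l, l + d / `|c|]%classic)).
  apply: le_measure; rewrite ?inE; [exact: measurable_slab|exact: measurable_itv|].
  move=> s /= /andP[h1 h2]; rewrite in_itv /= /l.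
  case: ltP => hc.
    rewrite (gtr0_norm hc) -mulrDl ler_pdivrMr// ler_pdivlMr//.
    by apply/andP; split; lra.
  have hc' : c < 0 by rewrite lt_neqAle c0.
  rewrite (ltr0_norm hc') invrN mulrN -mulNr -mulrDl ler_ndivrMr// ler_ndivlMr//.
  by apply/andP; split; lra.
rewrite lebesgue_measure_itv /= lte_fin; case: ifP => _ //.
by rewrite -EFinB lee_fin addrC addKr.
Qed.

Lemma measurable_cube_line p delta k : measurable [set s | dcube delta k (line_pt p s)].
Proof.
case: p k => [[[a b] c] d] [[k1 k2] k3].
rewrite (_ : [set s | _] = [set s | delta * k1%:~R <= a + s * c <= delta * (k1 + 1)%:~R] `&`
  [set s | delta * k2%:~R <= b + s * d <= delta * (k2 + 1)%:~R] `&`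
  [set s | delta * k3%:~R <= 0 + s * 1 <= delta * (k3 + 1)%:~R]); last first.
  by apply/seteqP; split => s /=; rewrite add0r mulr1; [move=> []|move=> [[]]].
by apply: measurableI; [apply: measurableI|]; exact: measurable_slab.
Qed.

Lemma bigsetU_slab (a c delta : R) (J : seq int) : c != 0 -> 0 <= delta ->
  (lebesgue_measure (\big[setU/set0]_(j <- J) [set s : R | (delta * j%:~R <= a + s * c <= delta * (j + 1)%:~R)%R])
    <= ((size J)%:R * (delta / `|c|))%:E)%E.
Proof.
move=> c0 d0; elim: J => [|j J IH]; first by rewrite big_nil measure0 mul0r.
rewrite big_cons; apply: le_trans (measureU2 _ _ _) _.
- exact: measurable_slab.
- by apply: bigsetU_measurable => i _; exact: measurable_slab.
rewrite /= -natr1 mulrDl mul1r EFinD [leRHS]addeC leeD//.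
have -> : delta * (j + 1)%:~R = delta * j%:~R + delta by rewrite intrD mulrDr mulr1.
exact: slab_measure.
Qed.

(** Counts slabs instead of cubes: one coordinate already confines s to an interval of length
    delta/|c|, and distinct slabs are what provides distinct times. *)
Lemma line_hits p delta Ks (f : int * int * int -> int) (a c : R) : 0 <= delta -> c != 0 ->
  (forall k s, dcube delta k (line_pt p s) -> delta * (f k)%:~R <= a + s * c <= delta * (f k + 1)%:~R) ->
  (lebesgue_measure [set s | (\bigcup_(k in [set` Ks]) dcube delta k) (line_pt p s)] <=
    ((size (undup [seq f k | k <- Ks & `[< hitc delta k p >]]))%:R * (delta / `|c|))%:E)%E.
Proof.
move=> d0 c0 hf; set J := undup _; apply: le_trans (bigsetU_slab a J c0 d0).
apply: le_measure; rewrite ?inE.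
- rewrite (_ : [set s | _] = \bigcup_(k in [set` Ks]) [set s | dcube delta k (line_pt p s)]).
    by rewrite bigcup_seq; apply: bigsetU_measurable => k _; exact: measurable_cube_line.
  by apply/seteqP; split => s [k kK hk]; exists k.
- by apply: bigsetU_measurable => i _; exact: measurable_slab.
move=> s [k kK hk]; rewrite -bigcup_seq; exists (f k) => /=; last exact: hf.
rewrite mem_undup; apply: map_f; rewrite mem_filter; apply/andP; split => //.
by apply/asboolP; exists s.
Qed.

(** Closed cubes share faces; their half-open versions are disjoint, so their volumes add up. *)
Let hcube delta k : set (pt3 R) :=
  (`[delta * k.1.1%:~R, delta * (k.1.1 + 1)%:~R[ `*` `[delta * k.1.2%:~R, delta * (k.1.2 + 1)%:~R[) `*`
    `[delta * k.2%:~R, delta * (k.2 + 1)%:~R[.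

Lemma measurable_hcube delta k : measurable (hcube delta k).
Proof. by do 2?apply: measurableX; exact: measurable_itv. Qed.

Lemma leb3_box (A B C : set R) : measurable A -> measurable B -> measurable C ->
  leb3 ((A `*` B) `*` C) = (lebesgue_measure A * lebesgue_measure B * lebesgue_measure C)%E.
Proof.
move=> mA mB mC; have mAB : measurable (A `*` B) by exact: measurableX.
have h1 := @product_measure1E _ _ _ _ R (@lebesgue_measure R) (@lebesgue_measure R) A B mA mB.
have h2 := @product_measure1E _ _ _ _ R (@lebesgue_measure R \x @lebesgue_measure R)%E (@lebesgue_measure R)
  (A `*` B) C mAB mC.
by rewrite -h1; exact: h2.
Qed.

Lemma leb3_hcube delta k : 0 < delta -> leb3 (hcube delta k) = (delta ^+ 3)%:E.
Proof.
move=> d0; have I (j : int) : lebesgue_measure (`[delta * j%:~R, delta * (j + 1)%:~R[%classic : set R) = delta%:E.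
  rewrite lebesgue_measure_itv /= lte_fin intrD mulrDr mulr1 ltrDl d0 -EFinB.
  by rewrite addrC addKr.
rewrite /hcube leb3_box; [|exact: measurable_itv..].
by rewrite !I -!EFinM !exprS expr0 mulr1 mulrA.
Qed.

Lemma hcube_inj delta k k' x : 0 < delta -> hcube delta k x -> hcube delta k' x -> k = k'.
Proof.
move=> d0; have I (j j' : int) (y : R) : `[delta * j%:~R, delta * (j + 1)%:~R[%classic y ->
    `[delta * j'%:~R, delta * (j' + 1)%:~R[%classic y -> j = j'.
  have F (i : int) : `[delta * i%:~R, delta * (i + 1)%:~R[%classic y -> Num.floor (y / delta) = i.
    rewrite /= in_itv /= => /andP[h1 h2]; apply: floor_def.
    by rewrite ler_pdivlMr// ltr_pdivrMr// mulrC h1 mulrC.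
  by move=> /F <- /F.
case: k k' x => [[k1 k2] k3] [[l1 l2] l3] [[x1 x2] x3] [[/= h1 h2] h3] [[/= g1 g2] g3].
by rewrite (I _ _ _ h1 g1) (I _ _ _ h2 g2) (I _ _ _ h3 g3).
Qed.

Lemma leb3U (A B : set (pt3 R)) : measurable A -> measurable B -> A `&` B = set0 ->
  leb3 (A `|` B) = (leb3 A + leb3 B)%E.
Proof.
move=> mA mB AB.
exact: (measureU ((@lebesgue_measure R \x @lebesgue_measure R) \x @lebesgue_measure R)%E mA mB AB).
Qed.

Lemma leb3_bigsetU delta Ks : 0 < delta -> uniq Ks ->
  leb3 (\big[setU/set0]_(k <- Ks) hcube delta k) = ((size Ks)%:R * delta ^+ 3)%:E.
Proof.
move=> d0; elim: Ks => [|k Ks IH] /=; first by rewrite big_nil /leb3 measure0 mul0r.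
move=> /andP[kK uK]; rewrite big_cons leb3U.
- by rewrite leb3_hcube// IH// -EFinD -natr1 mulrDl mul1r addrC.
- exact: measurable_hcube.
- by apply: bigsetU_measurable => i _; exact: measurable_hcube.
apply/seteqP; split => // x [h1]; rewrite -bigcup_seq => -[l /= lK h2].
by move: kK; rewrite (hcube_inj d0 h1 h2) lK.
Qed.

Lemma measurable_dcube delta k : measurable (dcube delta k).
Proof.
case: k => [[k1 k2] k3].
rewrite (_ : dcube _ _ = (`[delta * k1%:~R, delta * (k1 + 1)%:~R] `*` `[delta * k2%:~R, delta * (k2 + 1)%:~R]) `*`
    `[delta * k3%:~R, delta * (k3 + 1)%:~R]).
  by do 2?apply: measurableX; exact: measurable_itv.
apply/seteqP; split => -[[x1 x2] x3] /=; rewrite !in_itv /=; first by move=> [].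
by move=> [[]].
Qed.

Lemma leb3_cubes_ge delta Ks : 0 < delta -> uniq Ks ->
  (((size Ks)%:R * delta ^+ 3)%:E <= leb3 (\bigcup_(k in [set` Ks]) dcube delta k))%E.
Proof.
move=> d0 uK; rewrite -leb3_bigsetU//; apply: le_measure; rewrite ?inE.
- by apply: bigsetU_measurable => i _; exact: measurable_hcube.
- by rewrite bigcup_seq; apply: bigsetU_measurable => i _; exact: measurable_dcube.
rewrite -bigcup_seq => x [[[k1 k2] k3] kK h]; exists (k1, k2, k3) => //.
case: x h => [[x1 x2] x3] [[/=]]; rewrite !in_itv /= => /andP[a1 a2] /andP[b1 b2] /andP[c1 c2].
by split; apply/andP; split => //; exact: ltW.
Qed.

End Measure.

(** * Conclusion *)

Section Final.
Variable R : realType.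

(* The rotation (x, y, s) -> (y, -x, s) of the ambient space exchanges the roles of c and d. *)
Definition rot (p : pt4 R) : pt4 R := let: (a, b, c, d) := p in (b, - a, d, - c).
(** A reflection maps [k, k + 1] to [-k - 1, -k], hence the shift by one. *)
Definition rotc (k : int * int * int) : int * int * int := (k.1.2, (- k.1.1 - 1)%R, k.2).

Lemma hitc_rot delta k p : hitc delta k p -> hitc delta (rotc k) (rot p).
Proof.
case: p k => [[[a b] c] d] [[k1 k2] k3] [s /= [h1 h2 h3]]; exists s; split => //=.
rewrite subrK intrD !intrN; move: h1; rewrite intrD !mulrDr !mulrN => /andP[h1 h1'].
by apply/andP; split; lra.
Qed.

Lemma in_ball4_rot (a b c d r : R) p : in_ball4 (a, b, c, d) r (rot p) = in_ball4 (- b, a, - d, c) r p.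
Proof.
case: p => [[[a' b'] c'] d'] /=; congr (Num.sqrt _ < _); ring.
Qed.

Lemma sl2_okp (Rad : R) (T : nat) (a b c d : R) : 0 < Rad -> 2 * Rad ^+ 2 + 2 * Rad <= T%:R ->
  a * d - b * c = 1 -> norm4 (a, b, c, d) < Rad -> 1 <= 2 * Rad * `|c| -> okp T (a, b, c, d).
Proof.
move=> R0 hT det hn hc; have [ha hb hc' hd] := norm4_coord hn.
have c0 : c != 0 by apply: contraTneq hc => ->; rewrite normr0 mulr0 -ltNge.
have cn : 0 < `|c| by rewrite normr_gt0.
have R2 : 0 <= Rad ^+ 2 by exact: sqr_ge0.
have RT : Rad <= T%:R by lra.
have ci : `|c^-1| <= 2 * Rad by rewrite normfV -[leLHS]mul1r ler_pdivrMr.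
have q x : `|x| < Rad -> `|x / c| <= T%:R.
  move=> hx; apply: le_trans (normM_le (ltW hx) ci) _; rewrite mulrCA -expr2; lra.
split => //; first by split; apply: lt_le_trans RT.
by split; [exact: q|lra|exact: q].
Qed.

Lemma cd_large (Rad a b c d : R) : a * d - b * c = 1 -> norm4 (a, b, c, d) < Rad ->
  1 <= 2 * Rad * `|c| \/ 1 <= 2 * Rad * `|d|.
Proof.
move=> det /norm4_coord[ha hb _ _]; apply/orP; rewrite -[_ || _]negbK negb_or -!ltNge; apply/negP => /andP[h1 h2].
have : `|a * d - b * c| <= Rad * `|d| + Rad * `|c|.
  by apply: normD_le; rewrite ?normrN normrM ler_wpM2r// ltW.
by rewrite det normr1; lra.
Qed.

(** A closed cube contains its lower corner, so this corner lies in the ball and bounds the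
    indices. *)
Lemma cubes_finite (delta Rad : R) (K : set (int * int * int)) : 0 < delta ->
  \bigcup_(k in K) dcube delta k `<=` ball3_0 Rad ->
  exists Ks, [/\ uniq Ks, K = [set` Ks] & forall k, k \in Ks -> `|delta * k.1.1%:~R| <= Rad /\ `|delta * k.1.2%:~R| <= Rad].
Proof.
move=> d0 KR.
have hK k : K k -> [/\ `|delta * k.1.1%:~R| < Rad, `|delta * k.1.2%:~R| < Rad & `|delta * k.2%:~R| < Rad].
  case: k => [[k1 k2] k3] Kk.
  have : ball3_0 Rad (delta * k1%:~R, delta * k2%:~R, delta * k3%:~R).
    apply: KR; exists (k1, k2, k3) => //=.
    have h (i : int) : delta * i%:~R <= delta * i%:~R <= delta * (i + 1)%:~R.
      by rewrite lexx /= ler_pM2l// ler_int lerDl.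
    by split.
  rewrite /ball3_0 /= => h.
  have h4 : norm4 (delta * k1%:~R, delta * k2%:~R, delta * k3%:~R, 0) < Rad by rewrite /norm4 expr0n addr0.
  by have [? ? ? _] := norm4_coord h4.
pose B := (Num.trunc (Rad / delta)).+1; pose m := (2 * B + 1)%N.
pose f (t : 'I_m * 'I_m * 'I_m) : int * int * int := ((t.1.1%:Z - B%:Z)%R, (t.1.2%:Z - B%:Z)%R, (t.2%:Z - B%:Z)%R).
have bd (i : int) : `|delta * i%:~R| < Rad -> exists j : 'I_m, i = (j%:Z - B%:Z)%R.
  move=> h; have hi : (`|i| <= B)%N.
    rewrite ltnW// -(ltr_nat R); apply: lt_trans (truncnS_gt (Rad / delta)).
    rewrite ltr_pdivlMr// mulrC -{1}(gtr0_norm d0).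
    have -> : (`|i|%N%:R : R) = `|i%:~R| by rewrite -intr_norm -abszE -pmulrn.
    by rewrite -normrM.
  have jm : (`|(i + B%:Z)%R| < m)%N by rewrite /m; lia.
  by exists (Ordinal jm) => /=; lia.
have Kf : finite_set K.
  apply: (@sub_finite_set _ _ (range f)); last exact: finite_image.
  move=> [[k1 k2] k3] /hK[/= /bd[j1 e1] /bd[j2 e2] /bd[j3 e3]].
  by exists (j1, j2, j3) => //; rewrite /f /= e1 e2 e3.
move/finite_seqP: Kf => [s Ks]; exists (undup s); split; first exact: undup_uniq.
  by rewrite Ks; apply/seteqP; split => k /=; rewrite mem_undup.
move=> k; rewrite mem_undup => ks; have Kk : K k by rewrite Ks.
by have [h1 h2 _] := hK k Kk; split; exact: ltW.
Qed.
(** The first factor bounds the speed of the parametrisation, the second the inverse of the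
    component of the direction that is not small. *)
Definition lineV (Rad : R) : R := Num.sqrt (2 * Rad ^+ 2 + 1) * (2 * Rad).

Lemma lineV_gt0 (Rad : R) : 0 < Rad -> 0 < lineV Rad.
Proof.
by move=> R0; rewrite mulr_gt0 ?mulr_gt0// sqrtr_gt0 ltr_wpDl// mulr_ge0// sqr_ge0.
Qed.

Lemma hits_lower (Rad delta lam : R) (a b c d : R) (Ks : seq (int * int * int)) (f : int * int * int -> int) (x y : R) :
  0 < Rad -> 0 < delta -> norm4 (a, b, c, d) < Rad -> 1 <= 2 * Rad * `|y| ->
  (forall k s, dcube delta k (line_pt (a, b, c, d) s) -> delta * (f k)%:~R <= x + s * y <= delta * (f k + 1)%:~R) ->
  (lam%:E <= line_meas (a, b, c, d) (\bigcup_(k in [set` Ks]) dcube delta k))%E ->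
  lam / (lineV Rad * delta) <= (size (undup [seq f k | k <- Ks & `[< hitc delta k (a, b, c, d) >]]))%:R.
Proof.
move=> R0 d0 hn hy hf hl; have [_ _ hc hd] := norm4_coord hn.
have y0 : y != 0 by apply: contraTneq hy => ->; rewrite normr0 mulr0 -ltNge.
have yn : 0 < `|y| by rewrite normr_gt0.
have V0 := lineV_gt0 R0.
rewrite ler_pdivrMr; last by rewrite mulr_gt0.
set J := undup _.
have := line_hits Ks (ltW d0) y0 hf; rewrite -/J => hJ.
have w0 : 0 <= Num.sqrt (c ^+ 2 + d ^+ 2 + 1) by exact: sqrtr_ge0.
have h := le_trans hl (lee_wpmul2l _ hJ); rewrite lee_fin in h.
have {}h := h w0; rewrite -EFinM lee_fin in h.
apply: le_trans h _.
have sq z : `|z| < Rad -> z ^+ 2 <= Rad ^+ 2.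
  by move=> /ltW hz; rewrite -real_normK ?num_real// lerXn2r ?nnegrE// ltW.
have hs : Num.sqrt (c ^+ 2 + d ^+ 2 + 1) <= Num.sqrt (2 * Rad ^+ 2 + 1).
  by rewrite ler_wsqrtr// lerD2r; have := sq _ hc; have := sq _ hd; lra.
have hy' : delta / `|y| <= delta * (2 * Rad) by rewrite ler_pM2l// -[leLHS]mul1r ler_pdivrMr.
rewrite /lineV (_ : _ * (_ * _ * delta) = Num.sqrt (2 * Rad ^+ 2 + 1) * ((size J)%:R * (delta * (2 * Rad)))); last by ring.
apply: ler_pM => //; first by rewrite mulr_ge0// divr_ge0// ltW.
by apply: ler_wpM2l.
Qed.

Lemma class_bound (eps Rad : R) : 0 < eps -> 0 < Rad -> exists2 C : R, 0 <= C &
  forall (delta lam : R) (Ls : seq (pt4 R)) (Ks : seq (int * int * int)), 0 < delta -> delta <= 1 -> 0 < lam ->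
    (forall p, p \in Ls -> SL2param p /\ norm4 p < Rad) ->
    (forall (z : pt4 R) (r : R), delta <= r -> r <= 1 -> (count (in_ball4 z r) Ls)%:R <= (r / delta) ^+ 2) ->
    (forall k, k \in Ks -> `|delta * k.1.1%:~R| <= Rad /\ `|delta * k.1.2%:~R| <= Rad) ->
    (forall p, p \in Ls -> (lam%:E <= line_meas p (\bigcup_(k in [set` Ks]) dcube delta k))%E) ->
    lam ^+ 4 * (delta ^+ 2 * (size Ls)%:R) <= C * delta^-1 `^ eps * ((size Ks)%:R * delta ^+ 3).
Proof.
move=> e0 R0; pose T := (Num.trunc (2 * Rad ^+ 2 + 2 * Rad)).+1.
have hT : 2 * Rad ^+ 2 + 2 * Rad <= T%:R by rewrite ltW// truncnS_gt.
have RT : Rad <= T%:R by have := sqr_ge0 Rad; lra.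
have [C C0 hC] := incidence (T := T) e0 (ltn0Sn _).
have V0 := lineV_gt0 R0; set V := lineV Rad in V0.
exists (2 * (C * V ^+ 4)); first by nonneg.
move=> delta lam Ls Ks d0 d1 l0 hL ball hK hE.
have N0 : 0 <= lam / (V * delta) by rewrite divr_ge0 ?ltW// mulr_gt0.
have filt q (z : pt4 R) (r : R) : delta <= r -> r <= 1 -> (count (in_ball4 z r) [seq p <- Ls | q p])%:R <= (r / delta) ^+ 2.
  move=> h1 h2; apply: le_trans (ball z r h1 h2); rewrite ler_nat count_filter.
  by apply: sub_count => p /= /andP[].
have fin s : s%:R * (lam / (V * delta)) ^+ 4 <= C * (delta^-1 ^+ 3 * delta^-1 `^ eps) * (size Ks)%:R ->
    lam ^+ 4 * (delta ^+ 2 * s%:R) <= C * V ^+ 4 * delta^-1 `^ eps * ((size Ks)%:R * delta ^+ 3).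
  (* This factor turns the fourth power of the number of slabs into lam^4 delta^2, and delta^(-3)
     times the number of cubes into their total volume. *)
  have c0 : 0 <= V ^+ 4 * delta ^+ 6 by rewrite mulr_ge0// exprn_ge0// ltW.
  move=> /(ler_wpM2l c0); rewrite (_ : _ * (s%:R * _) = lam ^+ 4 * (delta ^+ 2 * s%:R)).
    move=> h; apply: le_trans h _; rewrite le_eqVlt; apply/orP; left; apply/eqP.
    by field; rewrite gt_eqF.
  by field; rewrite !gt_eqF.
pose Lc := [seq p <- Ls | 1 <= 2 * Rad * `|p.1.2|]; pose Ld := [seq p <- Ls | 1 <= 2 * Rad * `|p.2|].
have sz : (size Ls <= size Lc + size Ld)%N.
  rewrite !size_filter -count_predUI; apply: leq_trans (leq_addr _ _).
  rewrite -[leqLHS]count_predT (@eq_in_count _ _ (predU [pred p : pt4 R | 1 <= 2 * Rad * `|p.1.2|] [pred p : pt4 R| 1 <= 2 * Rad * `|p.2|]))//.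
  move=> [[[a b] c] d] /hL[det hn] /=; symmetry.
  by have [-> //|->] := cd_large det hn; rewrite orbT.
have hc : (size Lc)%:R * (lam / (V * delta)) ^+ 4 <= C * (delta^-1 ^+ 3 * delta^-1 `^ eps) * (size Ks)%:R.
  apply: hC => // [|z r|k kK|]; [|exact: filt|by apply: le_trans RT; case: (hK k kK)|].
    by move=> [[[a b] c] d]; rewrite mem_filter => /andP[hc /hL[det hn]]; exact: sl2_okp R0 hT det hn hc.
  move=> [[[a b] c] d]; rewrite mem_filter => /andP[hc pL]; have [det hn] := hL _ pL.
  exists (undup [seq k.1.1 | k <- Ks & `[< hitc delta k (a, b, c, d) >]]); split; first exact: undup_uniq.
    apply: (hits_lower (x := a) (y := c)) (hE _ pL) => //.
    by move=> [[k1 k2] k3] s /= [].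
  move=> j; rewrite mem_undup => /mapP[k]; rewrite mem_filter => /andP[/asboolP hk kK ->].
  by exists k.
have hd : (size Ld)%:R * (lam / (V * delta)) ^+ 4 <= C * (delta^-1 ^+ 3 * delta^-1 `^ eps) * (size Ks)%:R.
  rewrite -(size_map rot Ld) -(size_map rotc Ks); apply: hC => // [|z r h1 h2|k|].
  - move=> p /mapP[[[[a b] c] d]]; rewrite mem_filter => /andP[hd /hL[det hn]] ->.
    apply: (sl2_okp R0 hT); [by rewrite -det; ring| |by rewrite /= in hd].
    apply: le_lt_trans hn; rewrite /norm4 le_eqVlt; apply/orP; left; apply/eqP; congr Num.sqrt; ring.
  - case: z => [[[z1 z2] z3] z4]; rewrite count_map.
    apply: le_trans (filt (fun p => 1 <= 2 * Rad * `|p.2|) (- z2, z1, - z4, z3) r h1 h2).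
    by rewrite ler_nat; apply: sub_count => p /=; rewrite in_ball4_rot.
  - by move=> /mapP[k' kK ->]; apply: le_trans RT; case: (hK k' kK).
  move=> p /mapP[[[[a b] c] d]]; rewrite mem_filter => /andP[hd pL] ->; have [det hn] := hL _ pL.
  exists (undup [seq k.1.2 | k <- Ks & `[< hitc delta k (a, b, c, d) >]]); split; first exact: undup_uniq.
    apply: (hits_lower (x := b) (y := d)) (hE _ pL) => //.
    by move=> [[k1 k2] k3] s /= [].
  move=> j; rewrite mem_undup => /mapP[k]; rewrite mem_filter => /andP[/asboolP hk kK ->].
  by exists (rotc k); [exact: map_f|split => //; exact: hitc_rot].
apply: (@le_trans _ _ (lam ^+ 4 * (delta ^+ 2 * (size Lc)%:R) + lam ^+ 4 * (delta ^+ 2 * (size Ld)%:R))).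
  rewrite -mulrDr -mulrDr -natrD; apply: ler_wpM2l; first by rewrite exprn_ge0// ltW.
  by apply: ler_wpM2l; [rewrite exprn_ge0// ltW|rewrite ler_nat].
apply: le_trans (lerD (fin _ hc) (fin _ hd)) _.
by rewrite le_eqVlt; apply/orP; left; apply/eqP; ring.
Qed.

End Final.

Theorem theorem1p2 (R : realType) :
  forall eps : R, 0 < eps ->
  exists M : R, 0 < M /\
  forall Rad : R, 0 < Rad ->
  exists delta0 : R, 0 < delta0 /\
  forall delta : R, 0 < delta -> delta <= delta0 ->
  forall (L : seq (pt4 R)) (E : set (pt3 R)) (lam : R),
    uniq L ->
    (forall p, p \in L -> SL2param p /\ norm4 p < Rad) ->
    (forall (z : pt4 R) (r : R), delta <= r -> r <= 1 ->
        (count (in_ball4 z r) L)%:R <= (r / delta) ^+ 2) ->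
    union_of_dcubes delta E ->
    E `<=` ball3_0 Rad ->
    0 < lam ->
    (forall p, p \in L -> (lam%:E <= line_meas p E)%E) ->
    ((powR delta eps * powR lam M * (delta ^+ 2 * (size L)%:R))%:E
       <= leb3 E)%E.
Proof.
move=> eps e0; exists 4; split=> // Rad R0.
(* Half of delta^eps cancels the loss delta^(-eps/2); the other half absorbs the constant C, which
   depends on Rad, once delta is at most delta0. *)
pose e := eps / 2; have e1 : 0 < e by rewrite divr_gt0.
have [C C0 hC] := class_bound e1 R0.
have C1 : 0 < (C + 1)^-1 by rewrite invr_gt0 ltr_wpDl.
pose d0 : R := Num.min 1 ((C + 1)^-1 `^ e^-1).
have d00 : 0 < d0 by rewrite lt_min ltr01 powR_gt0.
exists d0; split=> // delta dp dd0 L E lam _ hL ball [K EK] ER l0 hE.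
have d1 : delta <= 1 by apply: le_trans dd0 _; rewrite ge_min lexx.
have [Ks [uK KE hK]] : exists Ks, [/\ uniq Ks, K = [set` Ks] &
    forall k, k \in Ks -> `|delta * k.1.1%:~R| <= Rad /\ `|delta * k.1.2%:~R| <= Rad].
  by apply: cubes_finite; rewrite -?EK.
rewrite KE in EK; rewrite EK in hE *.
apply: le_trans (leb3_cubes_ge dp uK); rewrite lee_fin.
have h := ler_wpM2l (powR_ge0 delta eps) (hC delta lam L Ks dp d1 l0 hL ball hK hE).
rewrite powR_mulrn ?(ltW l0)// -[leLHS]mulrA; apply: le_trans h _.
rewrite [leLHS]mulrA -[leRHS]mul1r.
apply: ler_wpM2r; first by rewrite mulr_ge0// exprn_ge0// ltW.
have di : delta `^ e * delta^-1 `^ e = 1.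
  by rewrite -powRM ?invr_ge0 ?(ltW dp)// divff ?powR1 ?gt_eqF.
have ee : delta `^ eps = delta `^ e * delta `^ e.
  by rewrite -powRD ?(gt_eqF dp) ?implybT// /e; congr (_ `^ _); field.
rewrite ee (_ : _ * _ * (C * _) = C * delta `^ e * (delta `^ e * delta^-1 `^ e)); last by ring.
rewrite di mulr1; have hd : delta `^ e <= (C + 1)^-1.
  apply: (@le_trans _ _ (((C + 1)^-1 `^ e^-1) `^ e)); last by rewrite -powRrM mulVf ?gt_eqF// powRr1 ?(ltW C1).
  apply: ge0_ler_powR; rewrite ?nnegrE ?powR_ge0 ?(ltW e1) ?(ltW dp)//.
  by apply: le_trans dd0 _; rewrite ge_min lexx orbT.
apply: le_trans (ler_wpM2l C0 hd) _.
by rewrite ler_pdivrMr ?mul1r ?lerDl// ltr_wpDl.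
Qed.
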